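(* Let $\kappa\ge1$ and $o\in V_\kappa$. The map $j_o: B_\Gamma(\ell^2(V_\kappa))\to B(\ell^2(V_\kappa)_{\mathrm{rad}(o)})$, $T[\varphi]\mapsto P_{\mathrm{rad}(o)}T[\varphi]P_{\mathrm{rad}(o)}$ (viewed as an operator on $\ell^2(V_\kappa)_{\mathrm{rad}(o)}$), is an isometric embedding of $C^*$-algebras. Moreover, letting $U_o:\ell^2(V_\kappa)_{\mathrm{rad}(o)}\to L^2(\Pi_\kappa)$ be the unitary operator determined by $U_o\big(\mathbf{1}_{S_n(o)}/\sqrt{\#S_n(o)}\big)=P_n/\|P_n\|_{L^2(\Pi_\kappa)}$ for all $n\ge0$, we have, simultaneously for all $\varphi\in L^\infty(\Pi_\kappa)$, $$U_o\,P_{\mathrm{rad}(o)}T[\varphi]P_{\mathrm{rad}(o)}=M_\varphi\,U_o\quad\text{on }\ell^2(V_\kappa)_{\mathrm{rad}(o)},$$ where $M_\varphi\psi=\varphi\psi$ is the multiplication operator on $L^2(\Pi_\kappa)$.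
   Context: $\mathrm{T}_\kappa=(V_\kappa,E_\kappa)$ is the Cayley tree of order $\kappa$ (infinite connected acyclic graph, every vertex of degree $\kappa+1$), $d$ its graph distance, $S_n(o)=\{x\in V_\kappa: d(x,o)=n\}$. Bounded operators on $\ell^2(V_\kappa)$ are identified with kernels $A(x,y)=\langle A\delta_y,\delta_x\rangle$; $B_\Gamma(\ell^2(V_\kappa))$ is the $C^*$-algebra of bounded operators whose kernel has the form $\alpha(d(x,y))$ for some $\alpha:\mathbb{N}_0\to\mathbb{C}$. $\ell^2(V_\kappa)_{\mathrm{rad}(o)}$ is the subspace of $\eta\in\ell^2(V_\kappa)$ with $\eta_x=\eta_y$ whenever $d(x,o)=d(y,o)$, and $P_{\mathrm{rad}(o)}$ the orthogonal projection onto it. Cartier–Dunau polynomials: $P_0=1$, $P_1(t)=t$, $tP_n=\frac{\kappa}{\kappa+1}P_{n+1}+\frac1{\kappa+1}P_{n-1}$ ($n\ge1$). $d\Pi_\kappa(t)=\frac{\kappa+1}{2\pi}\frac{\sqrt{4\kappa(\kappa+1)^{-2}-t^2}}{1-t^2}\mathbf{1}_{[-2\sqrt\kappa/(\kappa+1),\,2\sqrt\kappa/(\kappa+1)]}(t)dt$ (a probability measure for which $(P_n)$ is orthogonal). For $\varphi\in L^1(\Pi_\kappa)$, $\widehat\varphi(n)=\int P_n\varphi\,d\Pi_\kappa$ and $T[\varphi](x,y)=\widehat\varphi(d(x,y))$; every element of $B_\Gamma(\ell^2(V_\kappa))$ is of the form $T[\varphi]$ with $\varphi\in L^\infty(\Pi_\kappa)$.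 *)

(* Defs.v *)
From mathcomp Require Import complex.
From mathcomp Require Import all_boot all_order all_algebra.
From mathcomp Require Import all_classical all_reals all_analysis.
Import order.Order.TTheory GRing.Theory Num.Theory.
Import numFieldNormedType.Exports.
Set Implicit Arguments. Unset Strict Implicit. Unset Printing Implicit Defensive.
Local Open Scope classical_set_scope.
Local Open Scope ring_scope.

(* The Cayley tree T_k of order k: vertices = reduced words over the    *)
(* alphabet {0..k} (no two consecutive equal letters); x ~ y iff one    *)
(* word extends the other by one letter.  The root (empty word) has     *)
(* k+1 neighbours and every other vertex has 1 + k neighbours, so every *)
(* vertex has degree k+1 and the graph is an infinite tree.             *)

Definition reduced (k : nat) (s : seq 'I_k.+1) : bool :=
  sorted (fun a b : 'I_k.+1 => a != b) s.

Definition vertex (k : nat) := {s : seq 'I_k.+1 | reduced s}.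

Definition root (k : nat) : vertex k := exist _ [::] isT.

Fixpoint lcp (T : eqType) (s t : seq T) : nat :=
  match s, t with
  | a :: s', b :: t' => if a == b then (lcp s' t').+1 else 0
  | _, _ => 0
  end.

Definition dist (k : nat) (x y : vertex k) : nat :=
  (size (val x) + size (val y) - 2 * lcp (val x) (val y))%N.

Definition vsum (R : realType) (k m : nat) (F : vertex k -> R[i]) : R[i] :=
  \sum_(t : m.-tuple 'I_k.+1 | reduced t) F (insubd (root k) (tval t)).

Definition rvsum (R : realType) (k m : nat) (F : vertex k -> R) : R :=
  \sum_(t : m.-tuple 'I_k.+1 | reduced t) F (insubd (root k) (tval t)).

(* sum of F over the (finite) sphere S_n(o) = {x | d(x,o) = n};
   every such x has word length <= size o + n *)
Definition sphsum (R : realType) (k : nat) (o : vertex k) (n : nat)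
    (F : vertex k -> R[i]) : R[i] :=
  \sum_(m < (size (val o) + n).+1)
     vsum m (fun x => if dist x o == n then F x else 0).

Definition sphcard (R : realType) (k : nat) (o : vertex k) (n : nat) : R :=
  \sum_(m < (size (val o) + n).+1)
     rvsum m (fun x => if dist x o == n then 1 else 0).

Definition cconj (R : realType) (z : R[i]) : R[i] := Complex (complex.Re z) (- complex.Im z).
Definition sqn (R : realType) (z : R[i]) : R := complex.Re z ^+ 2 + complex.Im z ^+ 2.
Definition rC (R : realType) (x : R) : R[i] := Complex x 0.

Definition csum (R : realType) (u : nat -> R[i]) : R[i] :=
  Complex (lim (series (fun n => complex.Re (u n)) @ \oo))
          (lim (series (fun n => complex.Im (u n)) @ \oo)).

Definition ccvg (R : realType) (u : nat -> R[i]) : Prop :=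
  cvg (series (fun n => complex.Re (u n)) @ \oo) /\ cvg (series (fun n => complex.Im (u n)) @ \oo).

Definition l2 (R : realType) (k : nat) (eta : vertex k -> R[i]) : Prop :=
  cvg (series (fun m => rvsum m (fun x => sqn (eta x))) @ \oo).

Definition l2norm (R : realType) (k : nat) (eta : vertex k -> R[i]) : R :=
  Num.sqrt (lim (series (fun m => rvsum m (fun x => sqn (eta x))) @ \oo)).

Definition l2dot (R : realType) (k : nat) (eta xi : vertex k -> R[i]) : R[i] :=
  csum (fun m => vsum m (fun x => eta x * cconj (xi x))).

Definition kop (R : realType) (k : nat) (alpha : nat -> R[i])
    (eta : vertex k -> R[i]) : vertex k -> R[i] :=
  fun x => csum (fun m => vsum m (fun y => alpha (dist x y) * eta y)).

(* alpha is the kernel of a bounded operator on l^2(V_k), i.e. the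
   operator with kernel alpha(d(x,y)) is in B_Gamma(l^2(V_k)) *)
Definition BGamma (R : realType) (k : nat) (alpha : nat -> R[i]) : Prop :=
  exists M : R, forall eta : vertex k -> R[i], l2 eta ->
    (forall x, ccvg (fun m => vsum m (fun y => alpha (dist x y) * eta y))) /\
    l2 (kop alpha eta) /\ l2norm (kop alpha eta) <= M * l2norm eta.

Definition opnorm (R : realType) (k : nat) (D : set (vertex k -> R[i]))
    (A : (vertex k -> R[i]) -> (vertex k -> R[i])) : R :=
  sup [set l2norm (A eta) | eta in [set eta | D eta /\ l2 eta /\ l2norm eta <= 1]].

Definition radial (R : realType) (k : nat) (o : vertex k) (eta : vertex k -> R[i]) : Prop :=
  forall x y, dist x o = dist y o -> eta x = eta y.

Definition radproj (R : realType) (k : nat) (o : vertex k)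
    (eta : vertex k -> R[i]) : vertex k -> R[i] :=
  fun x => rC (sphcard R o (dist x o))^-1 * sphsum o (dist x o) eta.

Definition jo (R : realType) (k : nat) (o : vertex k) (alpha : nat -> R[i])
    (eta : vertex k -> R[i]) : vertex k -> R[i] :=
  radproj o (kop alpha (radproj o eta)).

Definition sphvec (R : realType) (k : nat) (o : vertex k) (n : nat) : vertex k -> R[i] :=
  fun x => if dist x o == n then rC (Num.sqrt (sphcard R o n))^-1 else 0.

Definition CDa (R : realType) (k : nat) : R :=
  2 * Num.sqrt (k%:R) / (k.+1)%:R.

Definition CDw (R : realType) (k : nat) (t : R) : R :=
  (k.+1)%:R / (2 * pi) * (Num.sqrt (CDa R k ^+ 2 - t ^+ 2) / (1 - t ^+ 2)).

Fixpoint CDpair (R : realType) (k n : nat) (t : R) : R * R :=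
  match n with
  | 0 => (1, t)
  | n'.+1 => let pq := CDpair k n' t in
             (pq.2, ((k.+1)%:R * t * pq.2 - pq.1) / k%:R)
  end.

Definition CDpoly (R : realType) (k n : nat) (t : R) : R := (CDpair k n t).1.

Definition supp (R : realType) (k : nat) : set R := `[- CDa R k, CDa R k].

Definition PiInt (R : realType) (k : nat) (f : R -> R) : R :=
  Rintegral lebesgue_measure (supp k) (fun t => f t * CDw k t).

(* Pi_k-almost everywhere (the density is > 0 exactly on ]-a, a[) *)
Definition Pi_ae (R : realType) (k : nat) (P : R -> Prop) : Prop :=
  {ae lebesgue_measure, forall t : R, t \in `]- CDa R k, CDa R k[ -> P t}.

Definition cmeasurable (R : realType) (k : nat) (f : R -> R[i]) : Prop :=
  measurable_fun (supp k) (fun t => complex.Re (f t)) /\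
  measurable_fun (supp k) (fun t => complex.Im (f t)).

Definition L2Pi (R : realType) (k : nat) (f : R -> R[i]) : Prop :=
  cmeasurable k f /\
  (\int[lebesgue_measure]_(t in supp k) (sqn (f t) * CDw k t)%:E < +oo)%E.

Definition L2Pinorm (R : realType) (k : nat) (f : R -> R[i]) : R :=
  Num.sqrt (PiInt k (fun t => sqn (f t))).

Definition LinfPi (R : realType) (k : nat) (f : R -> R[i]) : Prop :=
  cmeasurable k f /\ exists M : R, Pi_ae k (fun t => sqn (f t) <= M).

Definition CDhat (R : realType) (k : nat) (phi : R -> R[i]) (n : nat) : R[i] :=
  Complex (PiInt k (fun t => CDpoly k n t * complex.Re (phi t)))
          (PiInt k (fun t => CDpoly k n t * complex.Im (phi t))).

Definition CDnormalized (R : realType) (k n : nat) : R -> R[i] :=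
  fun t => rC (CDpoly k n t / Num.sqrt (PiInt k (fun s => CDpoly k n s ^+ 2))).

(* Main.v *)
(* Exactly one neighbour of a vertex is closer to a given other point, so sums over spheres of functions of the distance obey the three-term recursion of the Cartier-Dunau polynomials. This gives the product formula [sum_(y in S_n(o)) P_(d(y,x)) = #S_n P_n P_(d(x,o))], and with the moments [int P_n dPi = [n = 0]] it yields both the orthogonality of the [P_n], [||P_n||^2 = 1 / #S_n], and the fact that [T[phi]] acts on radial vectors as multiplication by [phi], through Parseval's identity. The moments come from the substitution [t = a cos th]; completeness of the [P_n] comes from approximating indicators of half-lines by polynomials, and [U_o] is onto by Riesz-Fischer.

For the isometry, let [q] be the squared norm of [A] on radial vectors and [B = A* A]. The orbit of a point mass under [B] is radial about its base point, with a profile independent of that point, so [||B^m eta||^2] grows at most like [q^(2m)] for every finitely supported [eta]. Since [m |-> ||B^m eta||^2] is log-convex, its first ratio is already at most [q^2], and [||A eta||^2 <= q ||eta||^2] follows. *)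

Require Import Defs.
From mathcomp Require Import complex.
From mathcomp Require Import all_boot all_order all_algebra.
From mathcomp Require Import all_classical all_reals all_analysis.
From mathcomp Require Import measurable_realfun.
From mathcomp Require Import zify ring lra.
Import order.Order.TTheory GRing.Theory Num.Theory.
Import numFieldNormedType.Exports.
Set Implicit Arguments. Unset Strict Implicit. Unset Printing Implicit Defensive.
Local Open Scope classical_set_scope.
Local Open Scope ring_scope.

(** * The edge-labelled tree *)

(** No automorphism of the tree is constructed. Homogeneity enters only through [sphQ], which writes
    a sum over a sphere about any centre as a function of one distance. Radial vectors are therefore
    handled through their profiles, sequences indexed by the distance, and [nsq_rad_base] carries a
    norm from one base point to another. The price is two exhaustions of the vertex set: balls about
    the root, along which [l2] and [kop] take their limits, and spheres about [o]. Absolute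
    summability allows the passage between them.

    The isometry is proved for an arbitrary bounded kernel and does not use its representation as
    T[phi]. Conversely, the intertwining relation does not presuppose that T[phi] is bounded: by
    Bessel's inequality the rows of its kernel are in l^2, which is enough to apply it pointwise.

    For [k = 1] the density is unbounded near the end points, so its integrals are computed on
    smaller intervals and passed to the limit. *)

Lemma lcp_le_size (n : nat) (s t : seq 'I_n) : (lcp s t <= size s)%N.
Proof. by elim: s t => [|a s IH] [|b t] //=; case: eqP => //= _; exact: IH. Qed.

Lemma lcpC (n : nat) (s t : seq 'I_n) : lcp s t = lcp t s.
Proof.
by elim: s t => [|a s IH] [|b t] //=; rewrite eq_sym; case: eqP => //= _; rewrite IH.
Qed.

Lemma lcp_id (n : nat) (s : seq 'I_n) : lcp s s = size s.
Proof. by elim: s => //= a s ->; rewrite eqxx. Qed.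

Lemma lcp_size_eq (n : nat) (s t : seq 'I_n) :
  lcp s t = size s -> size t = size s -> s = t.
Proof.
elim: s t => [|a s IH] [|b t] //=; case: eqP => //= -> [h] [h'].
by rewrite (IH t).
Qed.

Lemma lcp_rcons (n : nat) (s t : seq 'I_n) (a : 'I_n) :
  lcp (rcons s a) t =
  if [&& lcp s t == size s, size s < size t & nth a t (size s) == a]%N
  then (size s).+1 else lcp s t.
Proof.
elim: s t => [|b s IH] [|c t] //=; first by rewrite eq_sym; case: eqP.
by case: eqP => //= _; rewrite IH eqSS ltnS; case: ifP.
Qed.

Lemma lcp_ord_le (n : nat) (s t : seq 'I_n) :
  (lcp s t <= size s)%N /\ (lcp s t <= size t)%N.
Proof. by split; [|rewrite lcpC]; exact: lcp_le_size. Qed.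

Lemma lcp_nth (n : nat) (s t : seq 'I_n) (a : 'I_n) i :
  (i < lcp s t)%N -> nth a s i = nth a t i.
Proof.
by elim: s t i => [|b s IH] [|c t] // i; rewrite /=; case: eqP => //= ->; case: i => //= i /IH.
Qed.

Lemma reduced_rcons (k : nat) (s : seq 'I_k.+1) a :
  reduced (rcons s a) = reduced s && ((s == [::]) || (last a s != a)).
Proof. by rewrite /reduced; case: s => [|b s] //=; rewrite rcons_path. Qed.

(* The letters label the edges: [x] and [step x a] are the two ends of an edge labelled [a], and [a] runs over the [k+1] neighbours of [x]. *)
Definition stepw (k : nat) (s : seq 'I_k.+1) (a : 'I_k.+1) : seq 'I_k.+1 :=
  if s is b :: s' then if last b s' == a then belast b s' else rcons s a
  else [:: a].

Lemma stepw_rcons k (s : seq 'I_k.+1) (b a : 'I_k.+1) :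
  stepw (rcons s b) a = if b == a then s else rcons (rcons s b) a.
Proof.
rewrite /stepw headI; case: s => [|c s] /=; first by case: eqP.
by rewrite last_rcons belast_rcons.
Qed.

Lemma stepw_reduced k (s : seq 'I_k.+1) (a : 'I_k.+1) :
  reduced s -> reduced (stepw s a).
Proof.
case/lastP: s => [|s b] //; rewrite stepw_rcons => sb.
case: eqP => [_|/eqP ba]; first by move: sb; rewrite reduced_rcons => /andP[].
by rewrite reduced_rcons sb last_rcons ba orbT.
Qed.

Definition step k (x : vertex k) (a : 'I_k.+1) : vertex k :=
  exist _ (stepw (val x) a) (stepw_reduced a (valP x)).

(** Deleting a final [a] leaves a word that does not end in [a], by reducedness, so the second step
    appends the letter again. *)
Lemma stepwK k (s : seq 'I_k.+1) (a : 'I_k.+1) :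
  reduced s -> stepw (stepw s a) a = s.
Proof.
case/lastP: s => [|s b]; first by rewrite /= eqxx.
rewrite stepw_rcons; case: eqP => [->|ba] sb; last first.
  by rewrite stepw_rcons eqxx.
case/lastP: s sb => [|s c] //; rewrite stepw_rcons reduced_rcons last_rcons.
by move=> /andP[_]; case: (rcons s c =P _) => [|_ /negPf ->] //; case: s.
Qed.

Lemma stepK k a : involutive (@step k ^~ a).
Proof. by move=> x; apply: val_inj; rewrite /= stepwK //; exact: valP. Qed.

Lemma distxx k (x : vertex k) : dist x x = 0%N.
Proof. by rewrite /dist lcp_id mul2n -addnn subnn. Qed.

Lemma distC k (x y : vertex k) : dist x y = dist y x.
Proof. by rewrite /dist lcpC addnC. Qed.

Lemma dist_eq0 k (x y : vertex k) : (dist x y == 0%N) = (x == y).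
Proof.
apply/eqP/eqP => [|->]; last exact: distxx.
rewrite /dist => h; apply: val_inj; move: (val x) (val y) h => s t h.
by have [h1 h2] := lcp_ord_le s t; apply: lcp_size_eq => /=; lia.
Qed.

Lemma dist_step_eq k (x : vertex k) a : dist (step x a) x = 1%N.
Proof.
rewrite /dist /step /=; case: x => /= s; case/lastP: s => [|s b] // _.
rewrite stepw_rcons; case: eqP => [_|ba].
  by rewrite lcpC lcp_rcons lcp_id eqxx ltnn /= size_rcons; lia.
by rewrite lcp_rcons lcp_id eqxx ltnn /= !size_rcons; lia.
Qed.

(* The word of [a0] is the next letter of [z] when [x] is a prefix of [z], and the last letter of [x] otherwise. *)
Lemma dist_step k (x z : vertex k) : x != z ->
  exists a0, forall a, dist (step x a) z =
    if a == a0 then (dist x z).-1 else (dist x z).+1.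
Proof.
rewrite -dist_eq0 /dist => xz0.
have := valP x; have := valP z; move: xz0.
rewrite /step /=; move: (val x) (val z) => s t st0 rt rs.
have [ls lt] := lcp_ord_le s t.
have [lst|lst] := eqVneq (lcp s t) (size s).
  have sst : (size s < size t)%N by lia.
  have [a1 _] : exists a1 : 'I_k.+1, true by exists ord0.
  exists (nth a1 t (size s)) => a.
  have {1}-> : nth a1 t (size s) = nth a t (size s) by exact: set_nth_default.
  case/lastP: s rs lst {ls} lt st0 sst => [|s b] rs lst lt st0 sst.
    rewrite /= in lst st0 sst *; case: t rt lst lt st0 sst => [|c t] //= _ _ _ _ _.
    by rewrite eq_sym; case: eqP => _; lia.
  rewrite stepw_rcons; move: lst lt st0 sst; rewrite size_rcons => lst lt st0 sst.
  have bE : b = nth b t (size s).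
    by rewrite -(@lcp_nth _ (rcons s b)) ?lst// nth_rcons ltnn eqxx.
  have tb : nth b t (size s).+1 != b.
    rewrite {2}bE eq_sym; move: rt; rewrite /reduced.
    by move/(sortedP b) => /(_ _ sst).
  have [ba|ba] := eqVneq b a.
    subst a; rewrite eq_sym (negPf tb); move: lst; rewrite lcp_rcons.
    case: ifP => [/and3P[/eqP h _ _] _|_ h]; last first.
      by have := lcp_le_size s t; rewrite h ltnn.
    by rewrite h; lia.
  by rewrite lcp_rcons !size_rcons !lst sst eqxx /= eq_sym; case: eqP => _; lia.
case/lastP: s rs lst {ls} lt st0 => [|s b] rs lst lt st0 //.
exists b => a; rewrite stepw_rcons eq_sym.
move: lst; rewrite size_rcons => lst.
have h : lcp s t = lcp (rcons s b) t.
  by move: lst; rewrite lcp_rcons; case: ifP => //; rewrite eqxx.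
have [ls _] := lcp_ord_le s t.
have [ba|ba] := eqVneq a b; first by rewrite h; lia.
by rewrite lcp_rcons !size_rcons (negPf lst) /=; lia.
Qed.

(** The radial part of the adjacency operator: a vertex at distance [n > 0] has one closer and [k]
    farther neighbours, and at distance [0] all [k.+1] neighbours are farther. *)
Definition nbr (k : nat) (V : nmodType) (g : nat -> V) (n : nat) : V :=
  if n is m.+1 then g m + g m.+2 *+ k else g 1%N *+ k.+1.

Lemma sum_step (k : nat) (V : nmodType) (g : nat -> V) (x z : vertex k) :
  \sum_a g (dist (step x a) z) = nbr k g (dist x z).
Proof.
have [->|xz] := eqVneq x z.
  rewrite distxx /= (eq_bigr (fun=> g 1%N)) ?sumr_const ?card_ord // => a _.
  by rewrite dist_step_eq.
have [a0 a0E] := dist_step xz.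
have := xz; rewrite -dist_eq0; case: (dist x z) a0E => // n a0E _.
rewrite (bigD1 a0) //= a0E eqxx /=; congr (_ + _).
rewrite (eq_bigr (fun=> g n.+2)) => [|a /negPf aa0]; last by rewrite a0E aa0.
by rewrite sumr_const cardC1 card_ord.
Qed.

(** * Spheres *)

Definition words (k m : nat) : seq (vertex k) :=
  [seq insubd (Defs.root k) (tval t) | t <- enum [pred t : m.-tuple 'I_k.+1 | reduced t]].

Lemma big_words (k m : nat) (V : nmodType) (F : vertex k -> V) :
  \sum_(t : m.-tuple 'I_k.+1 | reduced t) F (insubd (Defs.root k) (tval t)) =
  \sum_(x <- words k m) F x.
Proof. by rewrite big_map big_enum. Qed.

Lemma val_words k (s : seq 'I_k.+1) :
  reduced s -> val (insubd (Defs.root k) s) = s.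
Proof. by move=> h; rewrite val_insubd h. Qed.

Lemma mem_words k m (x : vertex k) : (x \in words k m) = (size (val x) == m).
Proof.
apply/mapP/eqP => [[t]|h].
  by rewrite mem_enum => /val_words tr ->; rewrite tr size_tuple.
have hm : size (val x) == m by rewrite h.
exists (Tuple hm); first by rewrite mem_enum inE /= (valP x).
by rewrite /= valKd.
Qed.

Lemma words_uniq k m : uniq (words k m).
Proof.
rewrite map_inj_in_uniq ?enum_uniq // => t t'; rewrite !mem_enum => tr tr' h.
by apply: val_inj; rewrite /= -(val_words tr) h val_words.
Qed.

(** The strict bound [size < N] matches the [N]-th partial sum of a series over word lengths. *)
Definition ball_seq (k N : nat) : seq (vertex k) :=
  flatten [seq words k m | m <- iota 0 N].

Lemma mem_ball_seq k N (x : vertex k) : (x \in ball_seq k N) = (size (val x) < N)%N.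
Proof.
apply/flatten_mapP/idP => [[m]|h].
  by rewrite mem_iota mem_words => /andP[_ h] /eqP ->.
by exists (size (val x)); rewrite ?mem_iota // mem_words.
Qed.

Lemma ball_seqS k N : ball_seq k N.+1 = ball_seq k N ++ words k N.
Proof. by rewrite /ball_seq -addn1 iotaD map_cat flatten_cat /= cats0. Qed.

Lemma ball_seq_uniq k N : uniq (ball_seq k N).
Proof.
elim: N => // N IH; rewrite ball_seqS cat_uniq IH words_uniq andbT /=.
by apply/hasPn => x; rewrite mem_words mem_ball_seq => /eqP ->; rewrite ltnn.
Qed.

Lemma big_ball_seq k N (V : nmodType) (F : vertex k -> V) :
  \sum_(x <- ball_seq k N) F x = \sum_(m < N) \sum_(x <- words k m) F x.
Proof.
elim: N => [|N IH]; first by rewrite big_ord0 /ball_seq big_nil.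
by rewrite ball_seqS big_cat IH big_ord_recr.
Qed.

Definition sph k (o : vertex k) (n : nat) : seq (vertex k) :=
  [seq x <- ball_seq k (size (val o) + n).+1 | dist x o == n].

Lemma dist_triangle_root k (x o : vertex k) :
  (size (val x) <= size (val o) + dist x o)%N /\
  (dist x o <= size (val o) + size (val x))%N.
Proof.
rewrite /dist; move: (val x) (val o) => s t; have := lcp_ord_le s t; lia.
Qed.

Lemma mem_sph k (o : vertex k) n x : (x \in sph o n) = (dist x o == n).
Proof.
rewrite mem_filter mem_ball_seq andb_idr // => /eqP <-.
by rewrite ltnS; have [] := dist_triangle_root x o.
Qed.

Lemma sph_uniq k (o : vertex k) n : uniq (sph o n).
Proof. by rewrite filter_uniq // ball_seq_uniq. Qed.

Lemma big_sph k (V : nmodType) (o : vertex k) n N (F : vertex k -> V) :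
  (size (val o) + n < N)%N ->
  \sum_(x <- sph o n) F x = \sum_(x <- ball_seq k N | dist x o == n) F x.
Proof.
move=> oN; rewrite -[RHS]big_filter; apply/perm_big/uniq_perm.
- exact: sph_uniq.
- by rewrite filter_uniq // ball_seq_uniq.
move=> x; rewrite mem_sph mem_filter mem_ball_seq andb_idr // => /eqP xo.
by rewrite (leq_ltn_trans _ oN) // -xo; have [] := dist_triangle_root x o.
Qed.

(** Double counting of the edges with an end in [S_n(o)]: for each letter [a] the map [step ^~ a] is
    an involution, so the sum can be indexed by the other end [z]. The indicator of the sphere,
    summed over the neighbours of [z], is then given by [sum_step]. *)
Lemma sum_sph_nbr k (V : nmodType) (o : vertex k) n N (f : vertex k -> V) :
  (size (val o) + n.+1 < N)%N ->
  \sum_(y <- sph o n) \sum_a f (step y a) =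
  \sum_(z <- ball_seq k N) nbr k (fun d => if d == n then f z else 0) (dist z o).
Proof.
move=> oN; under [RHS]eq_bigr do
  rewrite -(sum_step (fun d => if d == n then f _ else 0)).
rewrite exchange_big [RHS]exchange_big; apply: eq_bigr => a _.
have sI : injective (fun x => step x a) := inv_inj (stepK a).
rewrite -big_mkcond -[RHS]big_filter -(big_map (@step k ^~ a) predT f).
apply/perm_big/uniq_perm.
- by rewrite map_inj_uniq ?sph_uniq.
- by rewrite filter_uniq // ball_seq_uniq.
move=> z; rewrite mem_filter mem_ball_seq -[in LHS](stepK a z) (mem_map sI).
rewrite mem_sph andb_idr // => /eqP h; apply: leq_ltn_trans oN.
have [h1 _] := dist_triangle_root z o; apply: leq_trans h1 _.
rewrite leq_add2l; have [h2|/dist_step[a0 /(_ a)]] := boolP (z == o).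
  by rewrite (eqP h2) distxx.
by case: ifP => _; rewrite h => //; lia.
Qed.

(** A vertex of [S_(n+2)] has one neighbour in [S_(n+1)], and a vertex of [S_n] has [k] of them,
    except that [o] itself has [k.+1]. This is the correction [n == 0]. *)
Lemma sum_sph_step k (V : nmodType) (o : vertex k) n (f : vertex k -> V) :
  \sum_(y <- sph o n.+1) \sum_a f (step y a) =
  \sum_(y <- sph o n.+2) f y + (\sum_(y <- sph o n) f y) *+ (k + (n == 0)%N).
Proof.
set N := (size (val o) + n).+3.
rewrite (@sum_sph_nbr _ _ _ _ N) ?(@big_sph _ _ _ n.+2 N) ?(@big_sph _ _ _ n N) /N; try lia.
rewrite [X in _ + X *+ _]big_mkcond [X in X + _]big_mkcond /=.
rewrite -sumrMnl -big_split; apply: eq_bigr => z _ /=.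
case: (dist z o) => [|d] /=; rewrite !eqSS.
  by rewrite eq_sym; case: n {N} => [|n]; rewrite ?add0r ?addn1 ?mul0rn.
congr (_ + _); have [<-|_] := eqVneq d.+1 n; rewrite ?mul0rn //.
by rewrite addn0.
Qed.

Lemma sph0 k (o : vertex k) : perm_eq (sph o 0) [:: o].
Proof.
apply: uniq_perm; rewrite ?sph_uniq // => x.
by rewrite mem_sph inE dist_eq0.
Qed.

Lemma sum_sph0 k (V : nmodType) (o : vertex k) (f : vertex k -> V) :
  \sum_(y <- sph o 0) f y = f o.
Proof. by rewrite (perm_big _ (sph0 o)) big_seq1. Qed.

Lemma sum_sph1 k (V : nmodType) (o : vertex k) (f : vertex k -> V) :
  \sum_(y <- sph o 1) f y = \sum_a f (step o a).
Proof.
rewrite -(sum_sph0 o (fun y => \sum_a f (step y a))).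
set N := (size (val o)).+2.
rewrite (@sum_sph_nbr _ _ _ _ N) ?(@big_sph _ _ _ 1 N) /N; try lia.
rewrite big_mkcond; apply: eq_bigr => z _.
by case: (dist z o) => [|d] /=; rewrite ?mul0rn // eqSS addr0.
Qed.

(** The recursion of [sum_sph_step], solved for the outer sphere. As an operator on sequences this
    is a polynomial of degree [n] in [nbr]: up to the factor [#S_n], the Cartier-Dunau polynomial of
    [nbr / (k + 1)]. *)
Fixpoint sphQ (k : nat) (V : zmodType) (n : nat) (g : nat -> V) : nat -> V :=
  match n with
  | 0 => g
  | p.+1 => match p with
            | 0 => nbr k g
            | q.+1 => fun j => sphQ k p (nbr k g) j - sphQ k q g j *+ (k + (q == 0)%N)
            end
  end.

(* Spherical sums satisfy a three-term recursion in the radius, so that the sum over [S_n(o)] of a function of the distance to [x] only depends on [dist x o]. *)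
Lemma sum_sph_dist k (V : zmodType) (o x : vertex k) n (g : nat -> V) :
  \sum_(y <- sph o n) g (dist y x) = sphQ k n g (dist x o).
Proof.
elim/ltn_ind: n g => [[|[|n]]] IH g.
- by rewrite sum_sph0 distC.
- by rewrite sum_sph1 sum_step distC.
have := sum_sph_step o n (fun y => g (dist y x)).
under eq_bigr do rewrite sum_step.
rewrite (IH n.+1 (ltnSn _) (nbr k g)) (IH n _ g) //.
by move=> /= ->; rewrite addrK.
Qed.

(** * The Cartier-Dunau measure *)

Lemma cvg_invSS (R : realType) : (fun m : nat => m.+2%:R^-1 : R) @ \oo --> (0 : R).
Proof.
have := @cvg_harmonic R; rewrite -(cvg_shiftS (@harmonic R)).
by apply: cvg_trans; rewrite /harmonic.
Qed.

(* Under [t = a cos th] the integrand becomes smooth up to the end points, and [G] is a primitive of it in [th]. *)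
Section theta_integral.
Variables (R : realType) (a : R) (f G : R -> R).
Hypothesis a0 : 0 < a.
Hypothesis cf : forall t : R, - a < t < a -> {for t, continuous f}.
Hypothesis dG : forall th : R, 0 < th < pi ->
  is_derive th 1 G (- (f (a * cos th) * (a * sin th))).
Local Notation mu := (@lebesgue_measure R).

(** The shift by two keeps [e m] strictly below [1 <= pi / 2], so that [0 < c m < a]. *)
Let e (m : nat) : R := m.+2%:R^-1.
Let c (m : nat) : R := a * cos (e m).

Let e_gt0 m : 0 < e m. Proof. by rewrite invr_gt0. Qed.

Let e_ltpihalf m : e m < pi / 2.
Proof.
by rewrite (lt_le_trans _ (pihalf_ge1 R)) // invf_lt1 // ltr1n.
Qed.

Let e_ltpi m : e m < pi.
Proof.
have := e_ltpihalf m; have := pi_gt0 R => p1 /lt_trans; apply.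
by rewrite ltr_pdivrMr // mulr_natr mulr2n ltrDl.
Qed.

Let e_itv m : e m \in `[0, pi].
Proof. by rewrite in_itv /= !ltW. Qed.

Let cos_e m : 0 < cos (e m) < 1.
Proof.
rewrite cos_gt0_pihalf; last first.
  by rewrite e_ltpihalf andbT (lt_trans _ (e_gt0 m)) // oppr_lt0 divr_gt0 ?pi_gt0.
by rewrite -[X in _ < X](@cos0 R) ltr_cos ?e_itv //= in_itv /= lexx pi_ge0.
Qed.

Let c_gt0 m : 0 < c m.
Proof. by rewrite mulr_gt0 //; case/andP: (cos_e m). Qed.

Let c_lta m : c m < a.
Proof. by rewrite gtr_pMr //; case/andP: (cos_e m). Qed.

Let c_nd : nondecreasing_seq c.
Proof.
apply/nondecreasing_seqP => m; rewrite ler_pM2l //.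
rewrite leNgt ltr_cos ?e_itv // -leNgt.
by rewrite lef_pV2 ?posrE // ler_nat.
Qed.

Let c_cvg : c @ \oo --> a.
Proof.
rewrite -[X in _ --> X]mulr1 -(@cos0 R); apply: cvgMr.
by apply: cvg_comp; [exact: cvg_invSS | exact: continuous_cos].
Qed.

Let F t := G (acos (t / a)).

(** Chain rule: the derivative [- 1 / (a sqrt (1 - (t / a)^2))] of [acos (t / a)] cancels the factor
    [- a sin th], since [sin (acos u) = sqrt (1 - u^2)]. *)
Let theta_deriv (t : R) : - a < t < a -> is_derive t 1 F (f t).
Proof.
move=> /andP[ta1 ta2].
have ta : -1 < t / a < 1 by rewrite ltr_pdivlMr // mulN1r ta1 ltr_pdivrMr // mul1r.
have tae : -1 <= t / a <= 1 by case/andP: ta => *; rewrite !ltW.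
have tha : 0 < acos (t / a) < pi.
  by rewrite acos_gt0 ?acos_ltpi //; case/andP: ta => h1 h2; rewrite ?h1 ?h2 ?(ltW h1) ?(ltW h2).
have d1 := is_derive1_acos ta.
have d2 : is_derive t 1 (fun t => t / a) (a^-1).
  have -> : (fun t => t / a) = a^-1 *: (id : R -> R).
    by apply/funext => u /=; rewrite /GRing.scale /= mulrC.
  by apply: is_derive_eq; rewrite /GRing.scale /= mulr1.
have d3 := @is_derive1_comp _ (@acos R) (fun t => t / a) t _ _ d1 d2.
have d4 := @is_derive1_comp _ G (fun t => acos (t / a)) t _ _ (dG tha) d3.
apply: is_derive_eq d4 _.
rewrite acosK ?in_itv //= sin_acos //.
have s0 : Num.sqrt (1 - (t / a) ^+ 2) != 0.
  rewrite sqrtr_eq0 -ltNge subr_gt0; move: (t / a) ta => u /andP[? ?]; nra.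
have -> : a * (t / a) = t by rewrite mulrC divfK ?gt_eqF.
by field; rewrite s0 gt_eqF.
Qed.

Let c_itv m (x : R) : - c m <= x <= c m -> - a < x < a.
Proof.
move=> /andP[x1 x2]; rewrite (le_lt_trans x2 (c_lta m)) andbT.
by rewrite (lt_le_trans _ x1) // ltrN2.
Qed.

Let F_continuous (t : R) : - a < t < a -> {for t, continuous F}.
Proof.
move=> /theta_deriv d.
by apply: differentiable_continuous; apply/derivable1_diffP; exact: ex_derive.
Qed.

(** The fundamental theorem of calculus, applied at a distance from the points [a] and [- a], where
    [f] may be unbounded and [acos (t / a)] has no derivative. *)
Lemma integral_truncated m :
  (\int[mu]_(t in `[(- c m)%R, (c m)%R]) (f t)%:E)%E = (G (e m) - G (pi - e m))%:E.
Proof.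
have cc : - c m < c m by rewrite (lt_trans _ (c_gt0 m)) // oppr_lt0.
have -> : G (e m) = F (c m).
  by rewrite /F /c mulrAC divff ?mul1r ?cosK ?gt_eqF.
have -> : G (pi - e m) = F (- c m).
  rewrite /F /c mulNr mulrAC divff ?mul1r ?gt_eqF //.
  by rewrite acosN ?cos_le1 ?cos_geN1 // cosK.
rewrite EFinB; apply: continuous_FTC2 => //.
- apply: continuous_in_subspaceT => x; rewrite inE /= in_itv /= => xc.
  exact/cf/(c_itv xc).
- split.
  + move=> x; rewrite in_itv /= => /andP[x1 x2].
    have xa : - a < x < a by apply: (@c_itv m); rewrite !ltW.
    by have := theta_deriv xa => d; exact: ex_derive.
  + by apply: cvg_at_right_filter; apply: F_continuous; apply: (@c_itv m); rewrite lexx ltW.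
  + by apply: cvg_at_left_filter; apply: F_continuous; apply: (@c_itv m); rewrite lexx ltW.
- move=> x; rewrite in_itv /= => /andP[x1 x2].
  have xa : - a < x < a by apply: (@c_itv m); rewrite !ltW.
  have d := theta_deriv xa.
  by rewrite derive1E derive_val.
Qed.

Let A m : set R := [set` `[- c m, c m]].

Let A_nd : nondecreasing_seq A.
Proof.
apply/nondecreasing_seqP => m; apply/subsetPset => x; rewrite /A /= !in_itv /=.
move=> /andP[x1 x2]; have cS : c m <= c m.+1 by exact: c_nd.
by rewrite (le_trans x2 cS) (le_trans _ x1) // lerN2.
Qed.

Let A_bigcup : \bigcup_m A m = [set` `]- a, a[].
Proof.
apply/seteqP; split => [x [m _]|x]; rewrite /A /= !in_itv /=; first exact: c_itv.
move=> /andP[x1 x2].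
have xa : `|x| < a by rewrite ltr_norml x1.
have [m _ /(_ m (leqnn _)) /= h] : \forall m \near \oo, `|x| < c m.
  exact: (cvgr_gt a c_cvg).
by exists m => //; rewrite /A /= in_itv /= -ler_norml ltW.
Qed.

Let mf_oo : measurable_fun [set` `]- a, a[] f.
Proof.
apply: subspace_continuous_measurable_fun => //.
by apply: continuous_in_subspaceT => x; rewrite inE /= in_itv /= => /cf.
Qed.

Lemma theta_measurable : measurable_fun [set` `[- a, a]] f.
Proof.
exact: measurable_fun_itv_cc mf_oo.
Qed.

Let integral_cc g : measurable_fun [set` `[- a, a]] g ->
  (\int[mu]_(x in `[(- a)%R, a]) g x = \int[mu]_(x in `](- a)%R, a[) g x)%E.
Proof.
move=> mg; rewrite -integral_itv_bndo_bndc; last first.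
  by apply: measurable_funS mg => //; apply: subset_itvl; rewrite bnd_simp.
rewrite -integral_itv_obnd_cbnd //.
by apply: measurable_funS mg => //; apply: subset_itv => //; rewrite bnd_simp.
Qed.

(** Monotone convergence requires no integrability. This version gives the mass of the density, from
    which the integrability of [w] is deduced. *)
Lemma theta_integral_ge0 (L : R) :
  (forall t, - a < t < a -> 0 <= f t) ->
  (fun m : nat => G (m.+2%:R^-1) - G (pi - m.+2%:R^-1)) @ \oo --> L ->
  (\int[mu]_(t in `[(- a)%R, a]) (f t)%:E)%E = L%:E.
Proof.
move=> f0 GL; rewrite integral_cc; last by apply/measurable_EFinP; exact: theta_measurable.
rewrite -A_bigcup.
have h1 : (\int[mu]_(x in A i) (f x)%:E)%E @[i --> \oo] -->
    (\int[mu]_(x in \bigcup_i A i) (f x)%:E)%E.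
  apply: ge0_nondecreasing_set_cvg_integral => //.
  - by move=> i; apply: measurable_itv.
  - move=> i; apply/measurable_EFinP; apply: measurable_funS mf_oo => //.
    by rewrite -A_bigcup; exact: bigcup_sup.
  - by move=> i x; rewrite /A /= in_itv /= => /c_itv xa; rewrite lee_fin f0.
have h2 : (\int[mu]_(x in A i) (f x)%:E)%E @[i --> \oo] --> L%:E.
  under eq_fun do rewrite integral_truncated.
  by apply/fine_cvgP; split; [exact: nearW | exact: GL].
exact: (cvg_unique _ h1 h2).
Qed.

(** For integrands that change sign; the truncations are dominated by [|f|]. *)
Lemma theta_integral (L : R) :
  mu.-integrable [set` `[- a, a]] (EFin \o f) ->
  (fun m : nat => G (m.+2%:R^-1) - G (pi - m.+2%:R^-1)) @ \oo --> L ->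
  (\int[mu]_(t in `[(- a)%R, a]) (f t)%:E)%E = L%:E.
Proof.
move=> fi GL; rewrite integral_cc; last by apply/measurable_EFinP; exact: theta_measurable.
have fio : mu.-integrable [set` `]- a, a[] (EFin \o f).
  by apply: integrableS fi => //; exact: subset_itv_oo_cc.
have mA m : measurable (A m) by exact: measurable_itv.
have sA m : A m `<=` [set` `]- a, a[] by rewrite -A_bigcup; exact: bigcup_sup.
have [] := @dominated_convergence _ _ _ mu [set` `]- a, a[] (measurable_itv _)
  (fun m => (EFin \o f) \_ (A m)) (EFin \o f) (abse \o (EFin \o f)).
- move=> m; apply: (measurable_restrict _ _ _).1 => //; first exact: mA.
  by apply: measurable_funS (measurable_int _ fio) => //; exact: subIsetl.
- exact: measurable_int fio.
- apply/aeW => x; rewrite /= in_itv /= => xa.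
  have [m _ xm] : (\bigcup_m A m) x by rewrite A_bigcup /= in_itv.
  apply: cvg_near_cst; exists m => // i /= mi.
  rewrite patchE mem_set //.
  by have /subsetPset := A_nd mi; apply.
- exact: integrable_abse.
- apply/aeW => x m _; rewrite patchE; case: ifP => _ //=.
  by rewrite lee_fin normr0.
move=> _ _ h1.
have h2 : (\int[mu]_(x in `](- a)%R, a[) ((EFin \o f) \_ (A i)) x)%E @[i --> \oo] --> L%:E.
  under eq_fun do rewrite -integral_mkcondr setIidr //.
  under eq_fun do rewrite integral_truncated.
  by apply/fine_cvgP; split; [exact: nearW | exact: GL].
exact: (cvg_unique _ h1 h2).
Qed.

End theta_integral.

Section real_derivation.
Variables (R : realType) (x : R) (f g : R -> R) (df dg : R).
Hypotheses (Hf : is_derive x 1 f df) (Hg : is_derive x 1 g dg).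

Lemma is_derive_addfun : is_derive x 1 (fun y => f y + g y) (df + dg).
Proof. exact: is_deriveD. Qed.

Lemma is_derive_mulfun : is_derive x 1 (fun y => f y * g y) (f x * dg + g x * df).
Proof. exact: is_deriveM. Qed.

Lemma is_derive_scalefun c : is_derive x 1 (fun y => c * f y) (c * df).
Proof. exact: is_deriveZ. Qed.
End real_derivation.

Lemma is_derive_sin_mul (R : realType) (c x : R) :
  is_derive x 1 (fun y => sin (c * y)) (c * cos (c * x)).
Proof.
have := @is_derive1_comp R sin (fun y => c * y) x _ _ (is_derive_sin (c * x))
  (is_derive_scalefun (is_derive_id x 1) c).
by move=> d; apply: is_derive_eq d _; ring.
Qed.

Lemma sin_natpi (R : realType) (n : nat) : sin (n%:R * pi) = 0 :> R.
Proof.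
elim: n => [|n IH]; first by rewrite mul0r sin0.
by rewrite -natr1 mulrDl mul1r sinDpi IH oppr0.
Qed.

Lemma sin_piB (R : realType) (x : R) : sin (pi - x) = sin x.
Proof. by rewrite sinD sinN cosN sinpi cospi; ring. Qed.

Lemma cos_piB (R : realType) (x : R) : cos (pi - x) = - cos x.
Proof. by rewrite cosD sinN cosN sinpi cospi; ring. Qed.

Lemma CDpolySS (R : realType) k n (t : R) :
  CDpoly k n.+2 t = (k.+1%:R * t * CDpoly k n.+1 t - CDpoly k n t) / k%:R.
Proof. by []. Qed.

(* [A = a^2], [b = (k-1)/(k+1)]: the derivative of the primitive [- C (th + b atan (b cot th))] of the substituted density. *)
Lemma atan_cot_alg (F : fieldType) (A b s c C : F) : b ^+ 2 = 1 - A ->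
  s != 0 -> 1 - A * c ^+ 2 != 0 -> c ^+ 2 + s ^+ 2 = 1 ->
  - C * (1 + b * ((1 + (b * (c / s)) ^+ 2)^-1 * (b * (c * (- s ^- 2 * c) + s^-1 * - s)))) =
  - (C * (A * s ^+ 2 / (1 - A * c ^+ 2))).
Proof.
move=> bA s0 d0 cs.
have -> : c * (- s ^- 2 * c) + s^-1 * - s = - s ^- 2 * (c ^+ 2 + s ^+ 2) by field.
rewrite cs mulr1.
have s2 : s ^+ 2 = 1 - c ^+ 2 by rewrite -cs addrAC subrr add0r.
have -> : 1 + (b * (c / s)) ^+ 2 = (1 - A * c ^+ 2) / s ^+ 2.
  have -> : 1 + (b * (c / s)) ^+ 2 = (s ^+ 2 + b ^+ 2 * c ^+ 2) / s ^+ 2 by field.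
  by rewrite bA {1}s2; congr (_ / _); ring.
have -> : - C * (1 + b * (((1 - A * c ^+ 2) / s ^+ 2)^-1 * (b * - s ^- 2))) =
   - C * (1 - A * c ^+ 2 - b ^+ 2) / (1 - A * c ^+ 2) by field; rewrite d0.
by rewrite bA s2; field.
Qed.

Section CD.
Variables (R : realType) (k : nat).
Hypothesis k1 : (1 <= k)%N.
Local Notation K := (k%:R : R).
Local Notation a := (CDa R k).
Local Notation mu := (@lebesgue_measure R).
Local Notation P := (@CDpoly R k).
Local Notation w := (@CDw R k).
Local Notation c0 := ((k.+1)%:R / (2 * pi) : R).

Lemma k_gt0 : 0 < K. Proof. by rewrite ltr0n. Qed.

Lemma CDa_gt0 : 0 < a.
Proof. by rewrite /CDa !mulr_gt0 ?invr_gt0 ?sqrtr_gt0 ?k_gt0 // ltr0n. Qed.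

Lemma CDa_sqr : a ^+ 2 = 4 * K / (K + 1) ^+ 2.
Proof.
rewrite /CDa -natr1 !exprMn exprVn sqr_sqrtr ?ltW ?k_gt0 //.
by congr (_ / _); ring.
Qed.

Let b : R := (K - 1) / (K + 1).

Let K1_neq0 : K + 1 != 0. Proof. by rewrite natr1 pnatr_eq0. Qed.

Let b_sqr : b ^+ 2 = 1 - a ^+ 2.
Proof. by rewrite CDa_sqr /b; field. Qed.

Lemma CDa_sqr_le1 : a ^+ 2 <= 1.
Proof. by rewrite -subr_ge0 -b_sqr sqr_ge0. Qed.

Lemma CD_sqr_lt (t : R) : - a < t < a -> t ^+ 2 < a ^+ 2.
Proof. by have := CDa_gt0 => a0 /andP[? ?]; nra. Qed.

Lemma CDw_ge0 (t : R) : - a <= t <= a -> 0 <= w t.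
Proof.
have := CDa_gt0 => a0 /andP[t1 t2].
have ta : t ^+ 2 <= a ^+ 2 by nra.
rewrite /CDw !mulr_ge0 ?invr_ge0 ?mulr_ge0 ?sqrtr_ge0 ?pi_ge0 //.
by rewrite subr_ge0 (le_trans ta CDa_sqr_le1).
Qed.

Lemma CDw_gt0 (t : R) : - a < t < a -> 0 < w t.
Proof.
move=> /CD_sqr_lt ta.
rewrite /CDw !mulr_gt0 ?invr_gt0 ?mulr_gt0 ?sqrtr_gt0 ?pi_gt0 ?subr_gt0 //.
exact: lt_le_trans ta CDa_sqr_le1.
Qed.

Lemma CDw_continuous (t : R) : - a < t < a -> {for t, continuous w}.
Proof.
move=> /CD_sqr_lt ta; apply: continuousM; first exact: cvg_cst.
have c2 : {for t, continuous (fun u : R => u ^+ 2)} by exact: exprn_continuous.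
apply: continuousM.
  apply: continuous_comp; last exact: sqrt_continuous.
  by apply: continuousB => //; exact: cvg_cst.
apply: continuousV; last by apply: continuousB => //; exact: cvg_cst.
by rewrite subr_eq0 eq_sym lt_eqF // (lt_le_trans ta CDa_sqr_le1).
Qed.

Lemma CDpoly_continuous n : continuous (P n).
Proof.
elim/ltn_ind: n => -[|[|n]] IH t.
- exact: cvg_cst.
- exact: cvg_id.
suff : {for t, continuous (fun t : R => (k.+1%:R * t * P n.+1 t - P n t) / K)} by [].
apply: continuousM; last exact: cvg_cst.
apply: continuousB; last exact: IH.
apply: continuousM; last exact: IH.
by apply: continuousM; [exact: cvg_cst | exact: cvg_id].
Qed.

Lemma CDw_cos (th : R) : 0 < th < pi ->
  w (a * cos th) * (a * sin th) =
  c0 * (a ^+ 2 * sin th ^+ 2 / (1 - a ^+ 2 * cos th ^+ 2)).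
Proof.
move=> th0; have s0 := sin_gt0_pi th0.
have -> : w (a * cos th) = c0 * (a * sin th / (1 - a ^+ 2 * cos th ^+ 2)).
  have h : a ^+ 2 - (a * cos th) ^+ 2 = (a * sin th) ^+ 2.
    by rewrite !exprMn sin2cos2; ring.
  by rewrite /CDw h sqrtr_sqr gtr0_norm ?exprMn // mulr_gt0 // CDa_gt0.
by rewrite /=; ring.
Qed.

Lemma CD_denom_neq0 (th : R) : 0 < th < pi -> 1 - a ^+ 2 * cos th ^+ 2 != 0.
Proof.
move=> th0; have s0 := sin_gt0_pi th0.
rewrite gt_eqF // subr_gt0.
have := cos2Dsin2 th; have := CDa_sqr_le1; have := CDa_gt0; nra.
Qed.

Lemma CDw_measurable : measurable_fun [set` `[- a, a]] w.
Proof. by apply: theta_measurable; exact: CDw_continuous. Qed.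

(** As [th] tends to [0], [atan (b cot th)] tends to [pi / 2] when [b > 0]. The two ends together
    give the mass [c0 * pi * (1 - b)], and [1 - b = 2 / (k + 1)]. *)
Lemma integral_CDw : (\int[mu]_(t in `[(- a)%R, a]) (w t)%:E)%E = 1%:E.
Proof.
pose G th : R := - c0 * (th + b * atan (b * (cos th * (sin th)^-1))).
apply: (@theta_integral_ge0 R a w G CDa_gt0 CDw_continuous).
- move=> th th0; have s0 := sin_gt0_pi th0.
  have dV : is_derive th 1 (fun y => (sin y)^-1) (- (sin th) ^- 2 * cos th).
    by apply: is_deriveV; rewrite gt_eqF.
  have d1 := is_derive_scalefun (is_derive_mulfun (is_derive_cos th) dV) b.
  have d2 := is_derive1_comp (is_derive1_atan _) d1.
  have d3 := is_derive_scalefun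
    (is_derive_addfun (is_derive_id th 1) (is_derive_scalefun d2 b)) (- c0).
  apply: is_derive_eq d3 _.
  rewrite CDw_cos //; apply: (@atan_cot_alg _ _ b) => //.
  + by rewrite gt_eqF.
  + exact: CD_denom_neq0.
  + exact: cos2Dsin2.
- by move=> t /andP[t1 t2]; rewrite CDw_ge0 // !ltW.
have aE m : G m.+2%:R^-1 - G (pi - m.+2%:R^-1) =
   c0 * (pi - 2 * m.+2%:R^-1 - 2 * (b * atan (b * (cos m.+2%:R^-1 / sin m.+2%:R^-1)))).
  rewrite /G sin_piB cos_piB; move: (m.+2%:R^-1) => e.
  have -> : b * (- cos e / sin e) = - (b * (cos e / sin e)) by ring.
  by rewrite atanN; ring.
have L1 : c0 * (pi - 2 * 0 - 2 * (b * (pi / 2))) = 1 :> R.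
  have := pi_gt0 R; rewrite /b -natr1; move: (pi : R) => p p0; field.
  by rewrite K1_neq0 gt_eqF.
suff : (fun m : nat => c0 * (pi - 2 * m.+2%:R^-1 -
      2 * (b * atan (b * (cos m.+2%:R^-1 / sin m.+2%:R^-1))))) @ \oo -->
    c0 * (pi - 2 * 0 - 2 * (b * (pi / 2))).
  by rewrite L1 -(funext aE).
apply: cvgMr; apply: cvgB.
  by apply: cvgB; [exact: cvg_cst | apply: cvgMr; exact: cvg_invSS].
(* For [k = 1] the argument of [atan] is constantly zero and does not tend to infinity, but the
   factor [b = 0] removes the term. *)
apply: cvgMr; have [->|b0] := eqVneq b 0.
  by under eq_fun do rewrite mul0r; rewrite mul0r; exact: cvg_cst.
apply: cvgMr; apply: cvg_comp (@cvgy_atan R).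
have b_gt0 : 0 < b.
  by rewrite lt_neqAle eq_sym b0 divr_ge0 // ?subr_ge0 ?ler1n // addr_ge0.
have cs0 m : 0 < cos (m.+2%:R^-1 : R) /\ 0 < sin (m.+2%:R^-1 : R).
  have [e0 e1] : 0 < m.+2%:R^-1 :> R /\ m.+2%:R^-1 < 1 :> R.
    by rewrite invr_gt0 invf_lt1 // ltr1n ltr0n.
  have p1 := pihalf_ge1 R; split.
    apply: cos_gt0_pihalf; rewrite (lt_le_trans e1 p1) andbT (lt_trans _ e0) //.
    by rewrite oppr_lt0 (lt_le_trans ltr01 p1).
  by apply: sin_gt0_pihalf; rewrite e0 (lt_le_trans e1).
have f0 (m : nat) : 0 < b * (cos m.+2%:R^-1 / sin m.+2%:R^-1).
  have [c s] := cs0 m; apply: mulr_gt0; first exact: b_gt0.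
  exact: (divr_gt0 c s).
(* Divergence of [b cot] is read off its reciprocal [sin / (b cos)], which is continuous at [0] and
   vanishes there. *)
apply/gtr0_cvgV0; first exact: nearW.
have L0 : sin 0 * (b * cos 0)^-1 = 0 :> R by rewrite sin0 mul0r.
suff : (fun m : nat => sin (m.+2%:R^-1 : R) * (b * cos (m.+2%:R^-1))^-1) @ \oo -->
    sin 0 * (b * cos 0)^-1.
  rewrite L0; apply: cvg_trans; apply: near_eq_cvg; apply: nearW => m.
  have [c s] := cs0 m; rewrite /unstable.inv_fun /=; field.
  by rewrite b0 !gt_eqF.
apply: cvgM.
  by apply: cvg_comp; [exact: cvg_invSS | exact: continuous_sin].
apply: cvgV; first by rewrite cos0 mulr1.
apply: cvgMr; apply: cvg_comp; [exact: cvg_invSS | exact: continuous_cos].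
Qed.

Local Notation D := (@supp R k).

Lemma measurable_supp : measurable D. Proof. exact: measurable_itv. Qed.

Lemma integrable_CDw : mu.-integrable D (EFin \o w).
Proof.
apply/integrableP; split; first by apply/measurable_EFinP; exact: CDw_measurable.
rewrite [ltLHS](_ : _ = 1%:E) ?ltry // -integral_CDw; apply: eq_integral => t.
by rewrite inE /supp /= in_itv /= => /CDw_ge0 t0; rewrite ger0_norm.
Qed.

Lemma integrable_bounded_CDw (g : R -> R) M : measurable_fun D g ->
  (forall t, D t -> `|g t| <= M) -> mu.-integrable D (fun t => (g t * w t)%:E).
Proof.
move=> mg gM.
apply: (@le_integrable _ _ _ mu D measurable_supp _ (EFin \o (fun t => M * w t))).
- apply/measurable_EFinP; apply: measurable_funM => //; exact: CDw_measurable.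
- move=> t Dt /=; rewrite lee_fin !normrM ler_wpM2r //.
  by rewrite (le_trans (gM _ Dt)) // ler_norm.
- by apply: (@integrableZl _ _ _ mu _ measurable_supp M) integrable_CDw.
Qed.

Lemma CDpoly_bounded n : exists M, forall t, D t -> `|P n t| <= M.
Proof.
elim/ltn_ind: n => -[|[|n]] IH.
- by exists 1 => t _; rewrite /CDpoly /= normr1.
- exists 1 => t; rewrite /supp /= in_itv /= => /andP[t1 t2].
  have := CDa_sqr_le1; have := CDa_gt0; rewrite ler_norml /CDpoly /=; nra.
have [M1 H1] := IH n.+1 (ltnSn _); have [M0 H0] := IH n (ltnW (ltnSn _)).
exists ((k.+1%:R * M1 + M0) / K) => t Dt; rewrite CDpolySS.
have t1 : `|t| <= 1.
  move: Dt; rewrite /supp /= in_itv /= => /andP[t1 t2].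
  have := CDa_sqr_le1; have := CDa_gt0; rewrite ler_norml; nra.
rewrite normrM [`|K^-1|]gtr0_norm ?invr_gt0 ?k_gt0 // ler_pM2r ?invr_gt0 ?k_gt0 //.
rewrite (le_trans (ler_normB _ _)) // lerD ?H0 // !normrM normr_nat -mulrA.
rewrite ler_wpM2l // -[leRHS]mul1r ler_pM ?H1 //.
Qed.

Lemma measurable_CDpoly (E : set R) n : measurable_fun E (P n).
Proof.
apply: measurable_funS (_ : measurable_fun setT (P n)) => //.
by apply: continuous_measurable_fun; exact: CDpoly_continuous.
Qed.

Lemma integrable_CDpolyM (g : R -> R) n M : measurable_fun D g ->
  (forall t, D t -> `|g t| <= M) -> mu.-integrable D (fun t => (P n t * g t * w t)%:E).
Proof.
move=> mg gM; have [M' PM'] := CDpoly_bounded n.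
apply: (@integrable_bounded_CDw _ (M' * M)).
  by apply: measurable_funM => //; exact: measurable_CDpoly.
by move=> t Dt; rewrite normrM ler_pM ?gM ?PM'.
Qed.

Lemma integrable_CDpoly n : mu.-integrable D (fun t => (P n t * w t)%:E).
Proof.
have [M PM] := CDpoly_bounded n.
by apply: (@integrable_bounded_CDw _ M) => //; exact: measurable_CDpoly.
Qed.

End CD.

(* The same for the first moment, with primitive [C (- a sin th + b atan ((a/b) sin th))]; for [b = 0] both sides agree because [a / 0 = 0]. *)
Lemma atan_sin_alg (F : fieldType) (A b s c C : F) :
  1 - A ^+ 2 * c ^+ 2 = b ^+ 2 + A ^+ 2 * s ^+ 2 ->
  s != 0 -> A != 0 -> 1 - A ^+ 2 * c ^+ 2 != 0 ->
  C * (- A * c + b * ((1 + (A / b * s) ^+ 2)^-1 * (A / b * c))) =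
  - (A * c * (C * (A ^+ 2 * s ^+ 2 / (1 - A ^+ 2 * c ^+ 2)))).
Proof.
move=> -> s0 A0; have [->|b0] := eqVneq b 0.
  by rewrite mul0r addr0 expr0n add0r => _; field; rewrite s0.
move=> d0; have -> : 1 + (A / b * s) ^+ 2 = (b ^+ 2 + A ^+ 2 * s ^+ 2) / b ^+ 2 by field.
by field; rewrite exprMn d0.
Qed.

(** * Moments of the measure and the product formula *)

Section CD_moments.
Variables (R : realType) (k : nat).
Hypothesis k1 : (1 <= k)%N.
Local Notation K := (k%:R : R).
Local Notation a := (CDa R k).
Local Notation mu := (@lebesgue_measure R).
Local Notation P := (@CDpoly R k).
Local Notation w := (@CDw R k).
Local Notation D := (@supp R k).
Local Notation c0 := ((k.+1)%:R / (2 * pi) : R).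

Let a0 := CDa_gt0 R k1.
Let K0 := @k_gt0 R k k1.

Lemma PiInt_eq (f : R -> R) (L : R) :
  (\int[mu]_(t in D) (f t * w t)%:E)%E = L%:E -> PiInt k f = L.
Proof. by rewrite /PiInt /Rintegral => ->. Qed.

(** The primitive is a function of [sin th], hence takes equal values at [th] and [pi - th]. *)
Lemma PiInt_CDpoly1 : PiInt k (P 1) = 0.
Proof.
apply: PiInt_eq.
pose b : R := (K - 1) / (K + 1).
pose G th : R := c0 * (- a * sin th + b * atan (a / b * sin th)).
apply: (@theta_integral R a (fun t => P 1 t * w t) G a0).
- move=> t ta; apply: continuousM; first exact: CDpoly_continuous.
  exact: CDw_continuous.
- move=> th th0; have s0 := sin_gt0_pi th0.
  have d1 := is_derive_scalefun (is_derive_sin th) (a / b).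
  have d2 := is_derive1_comp (is_derive1_atan _) d1.
  have d3 := is_derive_scalefun (is_derive_addfun
    (is_derive_scalefun (is_derive_sin th) (- a)) (is_derive_scalefun d2 b)) c0.
  apply: is_derive_eq d3 _.
  rewrite -[P 1 _ * _ * _]mulrA CDw_cos // /CDpoly /=.
  have d0 := CD_denom_neq0 k1 th0.
  have bA : 1 - a ^+ 2 = b ^+ 2.
    by rewrite CDa_sqr // /b; field; rewrite natr1 pnatr_eq0.
  apply: atan_sin_alg => //; rewrite ?gt_eqF //.
  by rewrite -bA sin2cos2; ring.
- exact: integrable_CDpoly.
- by under eq_fun do rewrite /G sin_piB subrr; exact: cvg_cst.
Qed.

Let r : R := Num.sqrt K.

Let r_sqr : r ^+ 2 = K. Proof. by rewrite sqr_sqrtr // ltW. Qed.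

Let r0 : r != 0. Proof. by rewrite gt_eqF // sqrtr_gt0. Qed.

Let aE : a = 2 * r / (K + 1). Proof. by rewrite /CDa natr1. Qed.

Let K1_neq0 : K + 1 != 0. Proof. by rewrite natr1 pnatr_eq0. Qed.

(* The factor [1 - t^2] cancels the denominator of the density, so the moments of [P_n - P_(n+2)] are trigonometric integrals. *)
Lemma CDpoly_diff_cos (n : nat) (th : R) :
  (P n (a * cos th) - P n.+2 (a * cos th)) * sin th =
  (K + 1) / (K * r ^+ n) * (1 - a ^+ 2 * cos th ^+ 2) * sin (n.+1%:R * th).
Proof.
elim/ltn_ind: n => -[|[|n]] IH.
- rewrite CDpolySS /CDpoly /= mul1r -natr1 expr0 mulr1.
  by rewrite -exprMn; field; rewrite gt_eqF.
- have -> : sin (2%:R * th) = 2 * (cos th * sin th).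
    by rewrite mulr_natl mulr2n sinD; ring.
  rewrite 2!CDpolySS /CDpoly /= -!natr1 expr1 -exprMn.
  have -> : cos th * sin th = (K + 1) / (2 * r) * (a * cos th) * sin th.
    rewrite aE; field; rewrite ?r0 ?K1_neq0 //.
  move: (a * cos th) => t; rewrite -r_sqr; field.
  by rewrite r0.
have hS : sin (n.+3%:R * th) = 2 * cos th * sin (n.+2%:R * th) - sin (n.+1%:R * th).
  have -> : n.+3%:R * th = n.+2%:R * th + th by rewrite -natr1; ring.
  have -> : n.+1%:R * th = n.+2%:R * th - th by rewrite -[n.+2%:R]natr1; ring.
  by rewrite !sinD sinN cosN; ring.
rewrite [P n.+2 _]CDpolySS [P n.+4 _]CDpolySS -natr1.
set t := a * cos th.
have -> : ((K + 1) * t * P n.+1 t - P n t) / K - ((K + 1) * t * P n.+3 t - P n.+2 t) / K =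
   ((K + 1) * t * (P n.+1 t - P n.+3 t) - (P n t - P n.+2 t)) / K by field; rewrite gt_eqF.
rewrite mulrAC mulrBl -[(K + 1) * t * _ * _]mulrA IH // IH // hS.
have -> : (K + 1) * t = 2 * r * cos th by rewrite /t aE; field.
have rS : r ^+ n.+2 = K * r ^+ n by rewrite 2!exprS mulrA -expr2 r_sqr.
rewrite rS exprS; have := expf_neq0 n r0; move: (r ^+ n) => rn rn0.
by field; rewrite rn0 r0 gt_eqF.
Qed.

(** By [CDpoly_diff_cos] the integrand in [th] is a multiple of [sin ((n + 1) th) sin th], which is
    half of [cos (n th) - cos ((n + 2) th)]. Over [[0, pi]] its integral vanishes unless [n = 0]. *)
Lemma PiInt_CDpoly_diff n :
  PiInt k (fun t => P n t - P n.+2 t) = (n == 0)%:R.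
Proof.
apply: PiInt_eq.
pose C : R := c0 * a ^+ 2 * ((K + 1) / (K * r ^+ n)) / 2.
pose g (m : nat) (th : R) := if m is 0 then th else m%:R^-1 * sin (m%:R * th).
have dg m (th : R) : is_derive th 1 (g m) (cos (m%:R * th)).
  case: m => [|m]; first by rewrite mul0r cos0; exact: is_derive_id.
  apply: is_derive_eq (is_derive_scalefun (is_derive_sin_mul _ _) _) _.
  by rewrite mulrA mulVf ?mul1r // pnatr_eq0.
pose G th : R := - C * (g n th + - 1 * g n.+2 th).
have dG (th : R) : is_derive th 1 G (- C * (cos (n%:R * th) + - 1 * cos (n.+2%:R * th))).
  exact: (is_derive_scalefun (is_derive_addfun (dg n th) (is_derive_scalefun (dg n.+2 th) (- 1))) (- C)).
apply: (@theta_integral R a (fun t => (P n t - P n.+2 t) * w t) G a0).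
- move=> t ta; apply: continuousM; last exact: CDw_continuous.
  by apply: continuousB; exact: CDpoly_continuous.
- move=> th th0; have s0 := sin_gt0_pi th0.
  apply: is_derive_eq (dG th) _.
  rewrite -[_ * w _ * _]mulrA CDw_cos //; have d0 := CD_denom_neq0 k1 th0.
  have -> : cos (n%:R * th) + - 1 * cos (n.+2%:R * th) = 2 * sin (n.+1%:R * th) * sin th.
    have -> : n.+2%:R * th = n.+1%:R * th + th by rewrite -natr1; ring.
    have -> : n%:R * th = n.+1%:R * th - th by rewrite -[n.+1%:R]natr1; ring.
    by rewrite !cosD sinN cosN; ring.
  have := CDpoly_diff_cos n th; set X := P n _ - _; set S := sin (n.+1%:R * th).
  rewrite /C; move: (cos th ^+ 2) d0 ((K + 1) / (K * r ^+ n)) => c2 d0 q XE.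
  have -> : X * (c0 * (a ^+ 2 * sin th ^+ 2 / (1 - a ^+ 2 * c2))) =
     (X * sin th) * (c0 * (a ^+ 2 * sin th / (1 - a ^+ 2 * c2))) by ring.
  rewrite XE; set q0 := _ / (2 * pi); clearbody q0; field.
  exact: d0.
- have -> : EFin \o (fun t => (P n t - P n.+2 t) * w t) =
    (fun t => (P n t * w t)%:E - (P n.+2 t * w t)%:E)%E.
    by apply/funext => t /=; rewrite mulrBl.
  by apply: integrableB; [exact: measurable_supp | exact: integrable_CDpoly..].
have cG (th : R) : {for th, continuous G}.
  by apply: differentiable_continuous; apply/derivable1_diffP; exact: ex_derive.
have <- : G 0 - G pi = (n == 0)%:R.
  rewrite /G /C /g; case: n {dG cG G C} => [|n] /=; last first.
    by rewrite !sin_natpi !mulr0 sin0; ring.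
  rewrite sin_natpi mulr0 sin0 expr0 CDa_sqr // -natr1.
  have := pi_gt0 R; move: (pi : R) => p p0; field.
  by rewrite K1_neq0 !gt_eqF.
have hpi : (fun m : nat => pi - m.+2%:R^-1 : R) @ \oo --> (pi : R).
  suff : (fun m : nat => pi - m.+2%:R^-1 : R) @ \oo --> pi - 0 by rewrite subr0.
  by apply: cvgB; [exact: cvg_cst | exact: cvg_invSS].
apply: cvgB; first exact: (cvg_comp _ G (@cvg_invSS R) (cG 0)).
exact: (cvg_comp _ G hpi (cG pi)).
Qed.

(** The differences determine the moments in steps of two, starting from the mass [1] and the first
    moment [0]. *)
Lemma PiInt_CDpoly n : PiInt k (P n) = (n == 0)%:R.
Proof.
have PiB m : PiInt k (P m) - PiInt k (P m.+2) = (m == 0)%:R.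
  rewrite -PiInt_CDpoly_diff /PiInt -RintegralB //=; last 3 first.
  - exact: measurable_supp.
  - exact: integrable_CDpoly.
  - exact: integrable_CDpoly.
  by apply: eq_Rintegral => t _; rewrite mulrBl.
elim/ltn_ind: n => -[|[|n]] IH.
- apply: PiInt_eq; rewrite -(integral_CDw R k1).
  by apply: eq_integral => t _; rewrite mul1r.
- exact: PiInt_CDpoly1.
have := PiB n; rewrite IH; last by rewrite (ltn_trans (ltnSn n)).
by move=> h; apply: oppr_inj; apply: (addrI (n == 0)%:R); rewrite h /= oppr0 addr0.
Qed.

(* The cardinality of a sphere of radius [n], see [size_sph]. *)
Definition sphn (n : nat) : R := if n is m.+1 then k.+1%:R * K ^+ m else 1.

Lemma sphn_gt0 n : 0 < sphn n.
Proof. by case: n => [|n] //=; rewrite mulr_gt0 ?exprn_gt0 ?ltr0n. Qed.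

(** The sequence [d |-> P d t] is an eigenvector of [nbr] for the eigenvalue [(k + 1) t], so a
    polynomial in [nbr] multiplies it by a scalar. The constant [c] absorbs the eigenvalue in the
    induction. *)
Lemma sphQ_CDpoly n (c t : R) j :
  sphQ k n (fun d => c * P d t) j = c * sphn n * P n t * P j t.
Proof.
have nbrE c' : nbr k (fun d => c' * P d t) = fun d => (c' * k.+1%:R * t) * P d t.
  apply/funext => -[|d] /=; first by rewrite /CDpoly /= -mulr_natr; ring.
  by rewrite CDpolySS -mulr_natr; field; rewrite gt_eqF.
elim/ltn_ind: n c => -[|[|n]] IH c /=.
- by rewrite !mulr1.
- by rewrite nbrE expr0 mulr1.
have -> : sphQ k n.+1 (nbr k (fun d => c * P d t)) j -
   sphQ k n (fun d => c * P d t) j *+ (k + (n == 0)%N) =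
   c * k.+1%:R * t * sphn n.+1 * P n.+1 t * P j t -
   c * sphn n * P n t * P j t *+ (k + (n == 0)%N).
  by rewrite nbrE !IH.
rewrite CDpolySS -mulr_natr exprS; case: n {IH} => [|n] /=.
  by rewrite addn1 expr0; field; rewrite gt_eqF.
by rewrite addn0 exprS; field; rewrite gt_eqF.
Qed.

(* The product formula for spherical functions: averaging [P_(d(., x))] over [S_n(o)] multiplies its value at [o] by [P_n]. *)
Lemma sum_sph_CDpoly (o x : vertex k) n (t : R) :
  \sum_(y <- sph o n) P (dist y x) t = sphn n * P n t * P (dist x o) t.
Proof.
rewrite -[RHS]mul1r !mulrA -sphQ_CDpoly -sum_sph_dist.
by apply: eq_bigr => y _; rewrite mul1r.
Qed.

Lemma CDpoly1 n : P n 1 = 1.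
Proof.
elim/ltn_ind: n => -[|[|n]] IH //.
by rewrite CDpolySS !IH // -natr1; field; rewrite gt_eqF.
Qed.

(** At [t = 1] every [P n] equals one, and the product formula counts the sphere. *)
Lemma size_sph (o : vertex k) n : (size (sph o n))%:R = sphn n.
Proof.
have := sum_sph_CDpoly o o n 1; rewrite !CDpoly1 !mulr1 => <-.
rewrite (eq_bigr (fun=> 1)) => [|y _]; last by rewrite CDpoly1.
by rewrite big_const_seq count_predT iter_addr_0.
Qed.

Lemma sph_point (o : vertex k) n : {x : vertex k | dist x o = n}.
Proof.
have : size (sph o n) != 0%N.
  by rewrite -(pnatr_eq0 R) size_sph gt_eqF // sphn_gt0.
case E: (sph o n) => [|x s] // _; exists x.
by apply/eqP; rewrite -mem_sph E mem_head.
Qed.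

End CD_moments.

Lemma sum_mem_uniq (R : pzSemiRingType) (T : eqType) (s : seq T) (y : T) :
  uniq s -> \sum_(z <- s) (z == y)%:R = (y \in s)%:R :> R.
Proof.
move=> us; have [ys|ys] := boolP (y \in s).
  rewrite (bigD1_seq y) //= eqxx big1 ?addr0 // => z /negPf -> //.
rewrite big1_seq // => z /andP[_ zs]; case: eqP => // zy.
by rewrite -zy zs in ys.
Qed.

(** * The space L^2(Pi) *)

Section Pi_integral.
Variables (R : realType) (k : nat).
Hypothesis k1 : (1 <= k)%N.
Local Notation mu := (@lebesgue_measure R).
Local Notation P := (@CDpoly R k).
Local Notation w := (@CDw R k).
Local Notation D := (@supp R k).

Definition Pi_integrable (g : R -> R) : Prop :=
  mu.-integrable D (EFin \o (fun t => g t * w t)).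

Let mD : measurable (D : set (g_sigma_algebraType R.-ocitv.-measurable)) := @measurable_supp R k.

Lemma Pi_integrableD (f g : R -> R) : Pi_integrable f -> Pi_integrable g ->
  Pi_integrable (fun t => f t + g t).
Proof.
move=> fi gi; have := integrableD mD fi gi.
apply: eq_integrable => // t _ /=; by rewrite mulrDl EFinD.
Qed.

Lemma PiIntD (f g : R -> R) : Pi_integrable f -> Pi_integrable g ->
  PiInt k (fun t => f t + g t) = PiInt k f + PiInt k g.
Proof.
move=> fi gi; rewrite /PiInt -RintegralD //.
by apply: eq_Rintegral => t _; rewrite mulrDl.
Qed.

Lemma Pi_integrableZ (c : R) (f : R -> R) : Pi_integrable f ->
  Pi_integrable (fun t => c * f t).
Proof.
move=> fi; have := integrableZl mD c fi.
apply: eq_integrable => // t _ /=; by rewrite -mulrA EFinM.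
Qed.

Lemma PiIntZ (c : R) (f : R -> R) : Pi_integrable f ->
  PiInt k (fun t => c * f t) = c * PiInt k f.
Proof.
move=> fi; rewrite /PiInt -RintegralZl //.
by apply: eq_Rintegral => t _; rewrite mulrA.
Qed.

Lemma Pi_integrable0 : Pi_integrable (fun=> 0).
Proof.
apply: eq_integrable (integrable0 mu D) => // t _ /=.
by rewrite mul0r.
Qed.

Lemma PiInt0 : PiInt k (fun=> 0 : R) = 0.
Proof.
by rewrite /PiInt /Rintegral integral0_eq // => t _; rewrite mul0r.
Qed.

Lemma Pi_integrable_sum (I : Type) (s : seq I) (F : I -> R -> R) :
  (forall i, Pi_integrable (F i)) -> Pi_integrable (fun t => \sum_(i <- s) F i t).
Proof.
move=> iF; elim: s => [|i s IH].
  by have := Pi_integrable0; congr Pi_integrable; apply/funext => t; rewrite big_nil.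
have := Pi_integrableD (iF i) IH.
by congr Pi_integrable; apply/funext => t; rewrite big_cons.
Qed.

Lemma PiInt_sum (I : Type) (s : seq I) (F : I -> R -> R) :
  (forall i, Pi_integrable (F i)) ->
  PiInt k (fun t => \sum_(i <- s) F i t) = \sum_(i <- s) PiInt k (F i).
Proof.
move=> iF; elim: s => [|i s IH].
  rewrite big_nil -[RHS]PiInt0.
  by congr PiInt; apply/funext => t; rewrite big_nil.
rewrite big_cons -IH -PiIntD //; last exact: Pi_integrable_sum.
by congr PiInt; apply/funext => t; rewrite big_cons.
Qed.

Lemma PiInt_ge0 (f : R -> R) : (forall t, D t -> 0 <= f t) -> 0 <= PiInt k f.
Proof.
move=> f0; apply: Rintegral_ge0 => t Dt; rewrite mulr_ge0 ?f0 //.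
by apply: CDw_ge0 => //; move: Dt; rewrite /supp /= in_itv.
Qed.

Lemma Pi_integrable_CDpoly n : Pi_integrable (P n).
Proof. exact: integrable_CDpoly. Qed.

(** With [y] at distance [m] from [x], the product formula makes [P n * P m] the mean of
    [P (dist z y)] over the [z] in [S_n(x)]. Only [z = y] has a nonzero integral, and [y] is on that
    sphere exactly when [n = m]. *)
Lemma PiInt_orth n m :
  PiInt k (fun t => P n t * P m t) = (n == m)%:R / sphn R k n.
Proof.
have [y yx] := sph_point R k1 (Defs.root k) m.
set x := Defs.root k in yx.
have hn := sphn_gt0 R k1 n.
have -> : (fun t => P n t * P m t) =
   fun t => (sphn R k n)^-1 * \sum_(z <- sph x n) P (dist z y) t.
  apply/funext => t; rewrite sum_sph_CDpoly // yx -mulrA mulKf //.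
  by rewrite gt_eqF.
have iP z : Pi_integrable (P (dist z y)) by exact: Pi_integrable_CDpoly.
rewrite PiIntZ; last exact: Pi_integrable_sum.
rewrite PiInt_sum // mulrC; congr (_ / _).
rewrite (eq_bigr (fun z => (z == y)%:R)) => [|z _]; last first.
  by rewrite PiInt_CDpoly // dist_eq0.
by rewrite sum_mem_uniq ?sph_uniq // mem_sph yx eq_sym.
Qed.

End Pi_integral.

Lemma quadratic_nonneg (R : realFieldType) (A B C : R) : 0 <= A ->
  (forall c, 0 <= c ^+ 2 * A + 2 * c * B + C) -> B ^+ 2 <= A * C.
Proof.
move=> A0 H; move: A0; rewrite le_eqVlt => /predU1P[A0|A0].
  rewrite -A0 mul0r; have [->|B0] := eqVneq B 0; first by rewrite expr0n.
  (* With [A = 0] the form is affine in [c], and at this point it takes the value [-1]. *)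
  have := H (- (C + 1) / (2 * B)); rewrite -A0 mulr0 add0r.
  have -> : 2 * (- (C + 1) / (2 * B)) * B = - (C + 1) by field.
  by move=> ?; exfalso; lra.
have := H (- B / A).
have -> : (- B / A) ^+ 2 * A + 2 * (- B / A) * B + C = (A * C - B ^+ 2) / A.
  by field; rewrite gt_eqF.
by rewrite pmulr_lge0 ?invr_gt0 // subr_ge0.
Qed.

Section Pi_L2.
Variables (R : realType) (k : nat).
Hypothesis k1 : (1 <= k)%N.
Local Notation mu := (@lebesgue_measure R).
Local Notation P := (@CDpoly R k).
Local Notation w := (@CDw R k).
Local Notation D := (@supp R k).
Local Notation h := (sphn R k).

Let mD : measurable (D : set (g_sigma_algebraType R.-ocitv.-measurable)) := @measurable_supp R k.

Let w_ge0 (t : R) : D t -> 0 <= w t.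
Proof. by rewrite /supp /= in_itv /=; exact: CDw_ge0. Qed.

Definition Pi_L2 (f : R -> R) : Prop :=
  measurable_fun D f /\ Pi_integrable k (fun t => f t ^+ 2).

Lemma Pi_integrable_le (f g : R -> R) : measurable_fun D f -> Pi_integrable k g ->
  (forall t, D t -> `|f t| <= g t) -> Pi_integrable k f.
Proof.
move=> mf gi fg; apply: (@le_integrable _ _ _ mu D mD _ _ _ _ gi) => //.
  by apply/measurable_EFinP; apply: measurable_funM => //; exact: CDw_measurable.
move=> t Dt /=; rewrite lee_fin !normrM ler_wpM2r //.
by rewrite (le_trans (fg _ Dt)) // ler_norm.
Qed.

Lemma Pi_L2M (f g : R -> R) : Pi_L2 f -> Pi_L2 g -> Pi_integrable k (fun t => f t * g t).
Proof.
move=> [mf fi] [mg gi].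
apply: (Pi_integrable_le _ (Pi_integrableD fi gi)); first exact: (measurable_funM mf mg).
move=> t _; rewrite normrM -[f t ^+ 2]real_normK ?num_real // -[g t ^+ 2]real_normK ?num_real //.
have := normr_ge0 (f t); have := normr_ge0 (g t).
move: `|f t| `|g t| => x y; nra.
Qed.

Lemma Pi_L2Z (c : R) (f : R -> R) : Pi_L2 f -> Pi_L2 (fun t => c * f t).
Proof.
move=> [mf fi]; split; first by apply: measurable_funM => //; exact: measurable_cst.
have := Pi_integrableZ (c ^+ 2) fi.
by congr Pi_integrable; apply/funext => t; rewrite exprMn.
Qed.

Lemma Pi_L2D (f g : R -> R) : Pi_L2 f -> Pi_L2 g -> Pi_L2 (fun t => f t + g t).
Proof.
move=> f2 g2; split; first by apply: measurable_funD; [exact: f2.1|exact: g2.1].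
have := Pi_integrableD (Pi_integrableD f2.2 g2.2) (Pi_integrableZ 2 (Pi_L2M f2 g2)).
by congr Pi_integrable; apply/funext => t; ring.
Qed.

Lemma Pi_L2B (f g : R -> R) : Pi_L2 f -> Pi_L2 g -> Pi_L2 (fun t => f t - g t).
Proof.
move=> f2 g2; have := Pi_L2D f2 (Pi_L2Z (- 1) g2).
by congr Pi_L2; apply/funext => t; rewrite mulN1r.
Qed.

Lemma Pi_L2_bounded (f : R -> R) M : measurable_fun D f ->
  (forall t, D t -> `|f t| <= M) -> Pi_L2 f.
Proof.
move=> mf fM; split => //.
apply: (@integrable_bounded_CDw R k k1 _ (M ^+ 2)); first exact: measurable_funX.
by move=> t Dt; rewrite normrX lerXn2r ?nnegrE ?fM // (le_trans _ (fM _ Dt)).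
Qed.

Lemma Pi_L2_CDpoly n : Pi_L2 (P n).
Proof.
have [M PM] := CDpoly_bounded R k1 n.
by apply: Pi_L2_bounded PM; exact: measurable_CDpoly.
Qed.

Lemma Pi_L2_0 : Pi_L2 (fun=> 0).
Proof. by apply: (@Pi_L2_bounded _ 0) => // t _; rewrite normr0. Qed.

Lemma Pi_L2_mul_bounded (f g : R -> R) M : Pi_L2 f -> measurable_fun D g ->
  (forall t, D t -> `|g t| <= M) -> Pi_L2 (fun t => g t * f t).
Proof.
move=> [mf fi] mg gM; have mgf := measurable_funM mg mf.
split => //; apply: (Pi_integrable_le _ (Pi_integrableZ (M ^+ 2) fi)).
  exact: measurable_funX.
move=> t Dt; rewrite normrX normrM exprMn -[f t ^+ 2]real_normK ?num_real //.
rewrite ler_wpM2r ?sqr_ge0 // lerXn2r ?nnegrE ?gM // (le_trans _ (gM _ Dt)) //.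
Qed.

Definition Pi_dot (f g : R -> R) : R := PiInt k (fun t => f t * g t).

Lemma Pi_dotC f g : Pi_dot f g = Pi_dot g f.
Proof. by congr PiInt; apply/funext => t; rewrite mulrC. Qed.

Lemma Pi_dotDl f g u : Pi_L2 f -> Pi_L2 g -> Pi_L2 u ->
  Pi_dot (fun t => f t + g t) u = Pi_dot f u + Pi_dot g u.
Proof.
move=> f2 g2 u2; rewrite /Pi_dot -PiIntD; try exact: Pi_L2M.
by congr PiInt; apply/funext => t; rewrite mulrDl.
Qed.

Lemma Pi_dotZl c f u : Pi_L2 f -> Pi_L2 u ->
  Pi_dot (fun t => c * f t) u = c * Pi_dot f u.
Proof.
move=> f2 u2; rewrite /Pi_dot -PiIntZ; last exact: Pi_L2M.
by congr PiInt; apply/funext => t; rewrite mulrA.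
Qed.

Lemma Pi_dotBl f g u : Pi_L2 f -> Pi_L2 g -> Pi_L2 u ->
  Pi_dot (fun t => f t - g t) u = Pi_dot f u - Pi_dot g u.
Proof.
move=> f2 g2 u2.
have -> : (fun t => f t - g t) = (fun t => f t + - 1 * g t).
  by apply/funext => t; rewrite mulN1r.
by rewrite Pi_dotDl // ?Pi_dotZl // ?mulN1r //; exact: Pi_L2Z.
Qed.

Lemma Pi_dot_ge0 f : 0 <= Pi_dot f f.
Proof. by apply: PiInt_ge0 => // t _; rewrite -expr2 sqr_ge0. Qed.

Lemma Pi_dotDD f g : Pi_L2 f -> Pi_L2 g ->
  Pi_dot (fun t => f t + g t) (fun t => f t + g t) =
  Pi_dot f f + 2 * Pi_dot f g + Pi_dot g g.
Proof.
move=> f2 g2; have fg2 := Pi_L2D f2 g2.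
rewrite Pi_dotDl // !(Pi_dotC _ (fun t => f t + g t)) !Pi_dotDl //.
by rewrite (Pi_dotC g f); ring.
Qed.

Lemma Pi_dotBB f g : Pi_L2 f -> Pi_L2 g ->
  Pi_dot (fun t => f t - g t) (fun t => f t - g t) =
  Pi_dot f f - 2 * Pi_dot f g + Pi_dot g g.
Proof.
move=> f2 g2; have fg2 := Pi_L2B f2 g2.
rewrite Pi_dotBl // !(Pi_dotC _ (fun t => f t - g t)) !Pi_dotBl //.
by rewrite (Pi_dotC g f); ring.
Qed.

Lemma Pi_cauchy_schwarz f g : Pi_L2 f -> Pi_L2 g ->
  Pi_dot f g ^+ 2 <= Pi_dot f f * Pi_dot g g.
Proof.
move=> f2 g2; apply: quadratic_nonneg => [|c]; first exact: Pi_dot_ge0.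
have cf2 := Pi_L2Z c f2.
have := Pi_dot_ge0 (fun t => c * f t + g t); rewrite Pi_dotDD // !Pi_dotZl //.
by rewrite Pi_dotC Pi_dotZl // mulrA -expr2 mulrA.
Qed.

Definition CDsum (c : nat -> R) (N : nat) (t : R) : R := \sum_(n < N) c n * P n t.

Lemma CDsumS c N : CDsum c N.+1 = fun t => CDsum c N t + c N * P N t.
Proof. by apply/funext => t; rewrite /CDsum big_ord_recr. Qed.

Lemma CDsum0 c : CDsum c 0 = fun=> 0.
Proof. by apply/funext => t; rewrite /CDsum big_ord0. Qed.

Lemma Pi_L2_CDsum c N : Pi_L2 (CDsum c N).
Proof.
elim: N => [|N IH]; first by rewrite CDsum0; exact: Pi_L2_0.
by rewrite CDsumS; apply: Pi_L2D => //; apply: Pi_L2Z; exact: Pi_L2_CDpoly.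
Qed.

Lemma Pi_dot_CDsuml c N f : Pi_L2 f ->
  Pi_dot (CDsum c N) f = \sum_(n < N) c n * Pi_dot f (P n).
Proof.
move=> f2; elim: N => [|N IH].
  rewrite big_ord0 CDsum0 -[RHS](@PiInt0 R k).
  by congr PiInt; apply/funext => t; rewrite mul0r.
have P2 := Pi_L2_CDpoly N.
rewrite CDsumS big_ord_recr /= -IH Pi_dotDl ?Pi_dotZl 1?(Pi_dotC (P N)) //.
- exact: Pi_L2_CDsum.
- exact: Pi_L2Z.
Qed.

Lemma Pi_dot_CDsum_CDpoly c N m :
  Pi_dot (CDsum c N) (P m) = if (m < N)%N then c m / h m else 0.
Proof.
rewrite Pi_dot_CDsuml; last exact: Pi_L2_CDpoly.
under eq_bigr do rewrite /Pi_dot PiInt_orth //.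
case: ifP => [mN|/negbT mN].
  rewrite (bigD1 (Ordinal mN)) //= eqxx mul1r big1 ?addr0 // => i im.
  by rewrite (_ : (m == i) = false) ?mul0r ?mulr0 // eq_sym; apply: negPf.
rewrite big1 // => i _; rewrite (_ : (m == i) = false) ?mul0r ?mulr0 //.
by apply/negP => /eqP mi; rewrite mi ltn_ord in mN.
Qed.

Lemma Pi_dot_CDsum_CDsum c N : Pi_dot (CDsum c N) (CDsum c N) = \sum_(n < N) c n ^+ 2 / h n.
Proof.
rewrite Pi_dot_CDsuml; last exact: Pi_L2_CDsum.
apply: eq_bigr => i _; rewrite Pi_dot_CDsum_CDpoly ltn_ord expr2.
by rewrite mulrA.
Qed.

End Pi_L2.

(** * The Riesz-Fischer theorem *)

Lemma sum_half_le2 (R : realType) n : \sum_(j < n) (2^-1 : R) ^+ j <= 2.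
Proof.
suff -> : \sum_(j < n) (2^-1 : R) ^+ j = 2 - 2 * 2^-1 ^+ n.
  by rewrite gerBl mulr_ge0 // exprn_ge0.
elim: n => [|n IH]; first by rewrite big_ord0 expr0; ring.
by rewrite big_ord_recr /= IH exprS; field.
Qed.

Lemma nondecreasing_sum_cvg (R : realType) (u : nat -> R) (C : R) :
  (forall n, 0 <= u n) -> (forall n, \sum_(j < n) u j <= C) -> cvgn (series u).
Proof.
move=> u0 uC; apply: nondecreasing_is_cvgn.
  by apply/nondecreasing_seqP => n; rewrite seriesEnat /= big_nat_recr //= lerDl.
by exists C => _ [n _ <-]; rewrite seriesEnat /= big_mkord.
Qed.

(* AM-GM turns the weighted square summability of the increments into absolute summability: [|d| <= (2^j d^2 + 2^-j) / 2]. *)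
Lemma cvgn_weighted_increments (R : realType) (v : nat -> R) (C : R) :
  (forall n, \sum_(j < n) 2 ^+ j * (v j.+1 - v j) ^+ 2 <= C) -> cvgn v.
Proof.
move=> vC; pose d := telescope v.
have dE j : d j = v j.+1 - v j by [].
have cd : cvgn (series d).
  apply: normed_cvg; apply: (@nondecreasing_sum_cvg _ _ ((C + 2) / 2)) => n; first exact: normr_ge0.
  apply: (@le_trans _ _ (\sum_(j < n) (2 ^+ j * d j ^+ 2 + 2^-1 ^+ j) / 2)).
    apply: ler_sum => j _; rewrite exprVn.
    have E (p x : R) : 0 < p -> x <= (p * x ^+ 2 + p^-1) / 2.
      move=> p0; rewrite -subr_ge0.
      have -> : (p * x ^+ 2 + p^-1) / 2 - x = (p * x - 1) ^+ 2 / (p * 2) by field; rewrite gt_eqF.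
      by rewrite mulr_ge0 ?sqr_ge0 // invr_ge0 mulr_ge0 // ltW.
    by rewrite -[d j ^+ 2]real_normK ?num_real //; apply: E; rewrite exprn_gt0.
  rewrite -mulr_suml ler_pM2r ?invr_gt0 // big_split lerD //=; first exact: vC.
  exact: sum_half_le2.
have -> : v = (fun n => v 0%N + series d n).
  by apply/funext => n; rewrite telescopeK /= addrC subrK.
by apply: is_cvgD => //; exact: is_cvg_cst.
Qed.

Lemma limn_einf_le (R : realType) (u : nat -> \bar R) (C : \bar R) :
  (forall n, (u n <= C)%E) -> (limn_einf u <= C)%E.
Proof.
move=> uC; rewrite limn_einf_lim; apply: lime_le; first exact: is_cvg_einfs.
apply: nearW => n; apply: le_trans (uC n); apply: ereal_inf_lbound.
by exists n => //=.
Qed.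

Lemma limn_einf_ge0 (R : realType) (u : nat -> \bar R) :
  (forall n, (0 <= u n)%E) -> (0 <= limn_einf u)%E.
Proof.
move=> u0; rewrite limn_einf_lim; apply: lime_ge; first exact: is_cvg_einfs.
by apply: nearW => n; apply: le_ereal_inf_tmp => _ [m _ <-].
Qed.

Section Riesz_Fischer.
Variables (R : realType) (k : nat).
Hypothesis k1 : (1 <= k)%N.
Local Notation mu := (@lebesgue_measure R).
Local Notation P := (@CDpoly R k).
Local Notation w := (@CDw R k).
Local Notation D := (@supp R k).
Local Notation h := (sphn R k).

Let mD : measurable (D : set (g_sigma_algebraType R.-ocitv.-measurable)) := @measurable_supp R k.

Let w_ge0 (t : R) : D t -> 0 <= w t.
Proof. by rewrite /supp /= in_itv /=; exact: CDw_ge0. Qed.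

Lemma Pi_integrable_integral (f : R -> R) : Pi_integrable k f ->
  (\int[mu]_(t in D) (f t * w t)%:E)%E = (PiInt k f)%:E.
Proof. by move=> fi; rewrite /PiInt /Rintegral fineK //; exact: integrable_fin_num. Qed.

Variable e : nat -> R.
Hypothesis ce : cvgn (series (fun n => h n * e n ^+ 2)).

Let s := series (fun n => h n * e n ^+ 2).
Let L := limn s.
(** Since [||P_n||^2 = 1 / h n], the weights [h n * e n] give [S N] the coefficients [e n] for
    [n < N] and the squared norm [s N]. *)
Let S N := CDsum k (fun n => h n * e n) N.

Let s_nd : nondecreasing_seq s.
Proof.
apply/nondecreasing_seqP => n; rewrite /s seriesEnat /= big_nat_recr //= lerDl.
by rewrite mulr_ge0 ?sqr_ge0 // ltW // sphn_gt0.
Qed.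

Let S_L2 N : Pi_L2 k (S N). Proof. exact: Pi_L2_CDsum. Qed.

Let h_neq0 n : h n != 0. Proof. by rewrite gt_eqF // sphn_gt0. Qed.

Let S_dot N M : (N <= M)%N -> Pi_dot k (S N) (S M) = s N.
Proof.
move=> NM; rewrite /S Pi_dot_CDsuml //.
rewrite /s seriesEnat /= big_mkord; apply: eq_bigr => n _.
rewrite Pi_dot_CDsum_CDpoly // (leq_trans (ltn_ord n) NM).
have := h_neq0 n; by move=> h0; field.
Qed.

Let S_diff N M : (N <= M)%N ->
  Pi_dot k (fun t => S M t - S N t) (fun t => S M t - S N t) = s M - s N.
Proof.
move=> NM; rewrite Pi_dotBB // Pi_dotC !S_dot //; ring.
Qed.

(** The rate [4^-j] leaves [2^-j], still summable, after multiplication by the weights [2^j] of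
    [cvgn_weighted_increments]. *)
Let exG : {G : nat -> nat | forall j, L - s (G j) <= 4^-1 ^+ j}.
Proof.
apply: constructive_indefinite_description.
have : forall j, exists N, L - s N <= 4^-1 ^+ j.
  move=> j; have e0 : 0 < 4^-1 ^+ j :> R by rewrite exprn_gt0.
  have sL : s @ \oo --> L by exact: ce.
  have [N _ /(_ N (leqnn _)) /= HN] := cvgr_dist_le _ _ sL _ e0.
  by exists N; apply: le_trans HN; rewrite ler_norm.
move=> /choice[G0 HG]; by exists G0.
Qed.

(** Summing the indices makes the subsequence nondecreasing and larger than [j], and keeps the tail
    bound of [exG]. *)
Let G j := (\sum_(i < j.+1) (sval exG i).+1)%N.

Let G_homo i j : (i <= j)%N -> (G i <= G j)%N.
Proof.
move=> /subnKC <-; elim: (j - i)%N => [|m IH]; first by rewrite addn0.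
by rewrite addnS; apply: (leq_trans IH); rewrite [G (i + m).+1]big_ord_recr leq_addr.
Qed.

Let G_ge j : (j < G j)%N.
Proof.
elim: j => [|j IH]; first by rewrite /G big_ord_recr /= addnS.
rewrite [G j.+1]big_ord_recr /= -/(G j) addnS ltnS; apply: (leq_trans IH).
exact: leq_addr.
Qed.

Let G_tail j : L - s (G j) <= 4^-1 ^+ j.
Proof.
apply: le_trans (svalP exG j); rewrite lerD2l lerN2 s_nd //.
by rewrite /G big_ord_recr /= addnS ltnW // ltnS leq_addl.
Qed.

Let s_le N : s N <= L. Proof. exact: nondecreasing_cvgn_le. Qed.

Let u j := S (G j).

Let u_diff i j : (i <= j)%N ->
  Pi_dot k (fun t => u j t - u i t) (fun t => u j t - u i t) <= 4^-1 ^+ i.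
Proof.
move=> ij; rewrite S_diff ?G_homo //; apply: le_trans (G_tail i).
by rewrite lerD2r s_le.
Qed.

(** Its integral is at most [2], so it is finite almost everywhere; where [w t > 0] this is the
    hypothesis of [cvgn_weighted_increments] for [j |-> u j t]. *)
Let Phi (t : R) : \bar R := (\sum_(j <oo) (2 ^+ j * (u j.+1 t - u j t) ^+ 2 * w t)%:E)%E.

Let diff_integrable i j : Pi_integrable k (fun t => (u j t - u i t) ^+ 2).
Proof. by have [] := Pi_L2B k1 (S_L2 (G j)) (S_L2 (G i)). Qed.

Let Phi_term_measurable j :
  measurable_fun D (fun t => (2 ^+ j * (u j.+1 t - u j t) ^+ 2 * w t)%:E).
Proof.
exact: measurable_int (Pi_integrableZ (2 ^+ j) (diff_integrable j j.+1)).
Qed.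

Let Phi_term_ge0 j (t : R) : D t -> (0 <= (2 ^+ j * (u j.+1 t - u j t) ^+ 2 * w t)%:E)%E.
Proof.
move=> Dt; rewrite lee_fin; apply: mulr_ge0; last exact: w_ge0.
by apply: mulr_ge0; [exact: exprn_ge0 | exact: sqr_ge0].
Qed.

Let Phi_integrable : mu.-integrable D Phi.
Proof.
apply/integrableP; split.
  by apply: ge0_emeasurable_sum => [j t Dt _|j _]; [exact: Phi_term_ge0 | exact: Phi_term_measurable].
rewrite [ltLHS](_ : _ = \int[mu]_(t in D) Phi t)%E; last first.
  apply: eq_integral => t; rewrite inE => Dt; rewrite gee0_abs //.
  by apply: nneseries_ge0 => j _ _; exact: Phi_term_ge0.
rewrite integral_nneseries //.
apply: (@le_lt_trans _ _ 2%:E); last exact: ltry.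
apply: lime_le; first by apply: is_cvg_nneseries => j _ _; apply: integral_ge0 => t; exact: Phi_term_ge0.
apply: nearW => n; rewrite big_mkord.
apply: le_trans (_ : (\sum_(j < n) (2^-1 ^+ j)%:E <= _)%E); last first.
  by rewrite sumEFin lee_fin sum_half_le2.
apply: lee_sum => j _.
rewrite Pi_integrable_integral ?lee_fin; last exact/Pi_integrableZ/diff_integrable.
rewrite PiIntZ; last exact: diff_integrable.
have := u_diff (leqnSn j); rewrite /Pi_dot.
have -> : PiInt k (fun t => (u j.+1 t - u j t) ^+ 2) =
   PiInt k (fun t => (u j.+1 t - u j t) * (u j.+1 t - u j t)) by [].
move=> H; apply: le_trans (ler_wpM2l (exprn_ge0 _ _) H) _ => //.
by rewrite -exprMn (_ : 2 * 4^-1 = 2^-1) //; field.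
Qed.

Let u_cvg : {ae mu, forall t : R, D t -> w t != 0 -> cvgn (fun j => u j t)}.
Proof.
apply: filterS (integrable_ae mD Phi_integrable) => t Ht Dt wt.
have w0 : 0 < w t by rewrite lt_neqAle eq_sym wt w_ge0.
apply: (@cvgn_weighted_increments _ _ (fine (Phi t) / w t)) => n.
have : (\sum_(0 <= j < n) (2 ^+ j * (u j.+1 t - u j t) ^+ 2 * w t)%:E <= Phi t)%E.
  by apply: nneseries_lim_ge => j _ _; exact: Phi_term_ge0.
by rewrite big_mkord sumEFin -[Phi t]fineK ?Ht // lee_fin ler_pdivlMr // mulr_suml.
Qed.

(** The upper limit is measurable with no convergence assumed and agrees with the limit wherever
    that exists; [fine] sends infinite values to zero. *)
Let f (t : R) : R := fine (limn_esup (fun j => (u j t)%:E)).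

Let f_lim (t : R) : cvgn (fun j => u j t) -> (fun j => u j t) @ \oo --> f t.
Proof.
move=> cu; rewrite /f is_cvg_limn_esupE; last first.
  by apply/cvg_ex; exists (limn (fun j => u j t))%:E; apply/fine_cvgP; split; [exact: nearW | exact: cu].
by rewrite EFin_lim.
Qed.

Let u_measurable j : measurable_fun D (u j). Proof. by have [] := S_L2 (G j). Qed.

Let f_measurable : measurable_fun D f.
Proof.
apply: measurableT_comp => //.
by apply: measurable_fun_limn_esup => j; apply/measurable_EFinP; exact: u_measurable.
Qed.

Let fu_measurable j : measurable_fun D (fun t => f t - u j t).
Proof. by apply: measurable_funB; [exact: f_measurable | exact: u_measurable]. Qed.

(** Fatou's lemma: the squared norm of [u (i + j) - u j] is at most [4^-j] for every [i], and the
    integrands converge to that of [f - u j]. *)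
Let fu_integral j : (\int[mu]_(t in D) ((f t - u j t) ^+ 2 * w t)%:E <= (4^-1 ^+ j)%:E)%E.
Proof.
pose g i (t : R) := ((u (i + j)%N t - u j t) ^+ 2 * w t)%:E.
have mg i : measurable_fun D (g i) by exact: measurable_int (diff_integrable j (i + j)).
have g0 i (t : R) : D t -> (0 <= g i t)%E.
  by move=> Dt; rewrite lee_fin mulr_ge0 ?sqr_ge0 ?w_ge0.
have := fatou mu mD mg g0.
have -> : (\int[mu]_(x in D) limn_einf (g^~ x) =
   \int[mu]_(t in D) ((f t - u j t) ^+ 2 * w t)%:E)%E.
  apply: ge0_ae_eq_integral => //.
  - have -> : (fun t => limn_einf (g^~ t)) = (fun t => - limn_esup (fun i => - g i t))%E.
      by apply/funext => t; rewrite (limn_esupN (g^~ t)) oppeK.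
    apply: measurableT_comp => //; apply: measurable_fun_limn_esup => i.
    by apply: measurableT_comp => //; exact: mg.
  - apply/measurable_EFinP; apply: measurable_funM; last exact: CDw_measurable.
    exact: measurable_funX (fu_measurable j).
  - move=> t Dt; by apply: limn_einf_ge0 => i; exact: g0.
  - by move=> t Dt; rewrite lee_fin mulr_ge0 ?sqr_ge0 ?w_ge0.
  move: u_cvg; apply: filterS; first exact: (ae_filter_ringOfSetsType mu).
  move=> t Ht Dt.
  have gc : (fun i => g i t) @ \oo --> ((f t - u j t) ^+ 2 * w t)%:E.
    apply/fine_cvgP; split; first exact: nearW.
    (* Where the density vanishes, [u] is not known to converge, but both sides are zero. *)
    have [w0|w0] := eqVneq (w t) 0.
      by rewrite w0 mulr0; apply: cvg_near_cst; apply: nearW => i; rewrite /= w0 mulr0.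
    suff : (fun i => (u (i + j)%N t - u j t) ^+ 2 * w t) @ \oo --> (f t - u j t) ^+ 2 * w t by [].
    apply: cvgMl; rewrite expr2; under eq_fun do rewrite expr2.
    have uc : (fun i => u (i + j)%N t - u j t) @ \oo --> f t - u j t.
      apply: cvgB; last exact: cvg_cst.
      by have := f_lim (Ht Dt w0); rewrite -(cvg_shiftn j).
    exact: cvgM.
  by rewrite is_cvg_limn_einfE ?(cvg_lim _ gc) //; apply/cvg_ex; exists ((f t - u j t) ^+ 2 * w t)%:E.
move/le_trans; apply; apply: limn_einf_le => i.
rewrite Pi_integrable_integral; last exact: diff_integrable.
by rewrite lee_fin; apply: u_diff; exact: leq_addl.
Qed.

Let fu_L2 j : Pi_L2 k (fun t => f t - u j t).
Proof.
have m1 := fu_measurable j.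
split => //; apply/integrableP; split.
  apply/measurable_EFinP; apply: measurable_funM; last exact: CDw_measurable.
  exact: measurable_funX.
rewrite [ltLHS](_ : _ = \int[mu]_(t in D) ((f t - u j t) ^+ 2 * w t)%:E)%E; last first.
  by apply: eq_integral => t; rewrite inE => Dt; rewrite gee0_abs // lee_fin mulr_ge0 ?sqr_ge0 ?w_ge0.
exact: le_lt_trans (fu_integral j) (ltry _).
Qed.

Let f_L2 : Pi_L2 k f.
Proof.
have := Pi_L2D k1 (fu_L2 0) (S_L2 (G 0)).
by congr Pi_L2; apply/funext => t; rewrite subrK.
Qed.

Let fu_dot j : Pi_dot k (fun t => f t - u j t) (fun t => f t - u j t) <= 4^-1 ^+ j.
Proof.
have [_ i2] := fu_L2 j; have := fu_integral j.
by rewrite Pi_integrable_integral.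
Qed.

Let pow4_cvg0 (c : R) : (fun j => 4^-1 ^+ j * c) @ \oo --> 0.
Proof.
rewrite -[X in _ --> X](mul0r c); apply: cvgMl.
by apply: cvg_expr; rewrite ger0_norm // invf_lt1 // ltr1n.
Qed.

(** The [n]-th coefficient of [u j] is exactly [e n] once [n <= j], and coefficients are continuous
    by Cauchy-Schwarz. *)
Let f_coef n : Pi_dot k f (P n) = e n.
Proof.
have P2 := Pi_L2_CDpoly R k1 n.
have H j : (n <= j)%N -> (Pi_dot k f (P n) - e n) ^+ 2 <= 4^-1 ^+ j * Pi_dot k (P n) (P n).
  move=> nj; have -> : e n = Pi_dot k (u j) (P n).
    rewrite /u /S Pi_dot_CDsum_CDpoly // (leq_ltn_trans nj (G_ge j)).
    by rewrite mulrAC divff ?mul1r.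
  rewrite -Pi_dotBl //; last exact: S_L2.
  apply: le_trans (Pi_cauchy_schwarz k1 (fu_L2 j) P2) _.
  by rewrite ler_wpM2r ?fu_dot // Pi_dot_ge0.
apply/eqP; rewrite -subr_eq0 -sqrf_eq0 eq_le sqr_ge0 andbT.
rewrite -(cvg_lim _ (pow4_cvg0 (Pi_dot k (P n) (P n)))) //.
apply: limr_ge; first by apply/cvg_ex; exists 0; exact: pow4_cvg0.
by exists n => // j /= nj; exact: H.
Qed.

(** Knowing the coefficients of [f], [||f - u j||^2] equals [||f||^2 - s (G j)], and it tends to
    zero. *)
Let f_norm : Pi_dot k f f = L.
Proof.
have fuE j : Pi_dot k (fun t => f t - u j t) (fun t => f t - u j t) = Pi_dot k f f - s (G j).
  rewrite Pi_dotBB //; last exact: S_L2.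
  rewrite S_dot // Pi_dotC Pi_dot_CDsuml //.
  have -> : \sum_(n < G j) h n * e n * Pi_dot k f (P n) = s (G j).
    by rewrite /s seriesEnat /= big_mkord; apply: eq_bigr => n _; rewrite f_coef expr2 mulrA.
  by ring.
have H j : `|Pi_dot k f f - L| <= 4^-1 ^+ j * 2.
  have h1 := fu_dot j; rewrite fuE in h1.
  have h2 := Pi_dot_ge0 k1 (fun t => f t - u j t); rewrite fuE in h2.
  have h3 := G_tail j; have h4 := s_le (G j).
  rewrite ler_norml; apply/andP; split; lra.
apply/eqP; rewrite -subr_eq0 -normr_eq0 eq_le normr_ge0 andbT.
rewrite -(cvg_lim _ (pow4_cvg0 2)) //.
apply: limr_ge; first by apply/cvg_ex; exists 0; exact: pow4_cvg0.
exact: nearW.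
Qed.

Lemma Riesz_Fischer : exists g, [/\ Pi_L2 k g, forall n, Pi_dot k g (P n) = e n &
  Pi_dot k g g = limn (series (fun n => h n * e n ^+ 2))].
Proof. by exists f. Qed.

End Riesz_Fischer.

(** * Completeness of the Cartier-Dunau polynomials *)

Lemma bernoulli_sub (R : realType) (y : R) n :
  0 <= y <= 1 -> 1 - n%:R * y <= (1 - y) ^+ n.
Proof.
move=> /andP[y0 y1]; elim: n => [|n IH]; first by rewrite mul0r subr0 expr0.
have y1' : 0 <= 1 - y by rewrite subr_ge0.
rewrite exprS; apply: le_trans (ler_wpM2l y1' IH).
rewrite -natr1; have := ler0n R n; move: (n%:R : R) => N N0; nra.
Qed.

(** Bounds [(1 - y)^n] by [1 / (1 + n y)], small as soon as [n y] is large; [bernoulli_sub] keeps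
    the same power near one when [n y] is small. *)
Lemma bernoulli_inv (R : realType) (y : R) n :
  0 <= y <= 1 -> (1 - y) ^+ n * (1 + n%:R * y) <= 1.
Proof.
move=> /andP[y0 y1]; elim: n => [|n IH]; first by rewrite mul0r addr0 expr0 mulr1.
have y1' : 0 <= 1 - y by rewrite subr_ge0.
have p0 : 0 <= (1 - y) ^+ n by rewrite exprn_ge0.
apply: le_trans IH; rewrite exprS mulrAC mulrC ler_wpM2l //.
rewrite -natr1; have := ler0n R n; move: (n%:R : R) => N N0; nra.
Qed.

Section step_approximation.
Variable R : realType.
Implicit Types u : R.

(* A polynomial in [u] that converges to the indicator of [u < 1/2] on [0, 1] minus [1/2]. *)
Definition step_approx u (n : nat) : R := (1 - u ^+ n) ^+ (2 ^ n).

Lemma step_approx_itv u n : 0 <= u <= 1 -> 0 <= step_approx u n <= 1.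
Proof.
move=> /andP[u0 u1].
have /andP[v0 v1] : 0 <= 1 - u ^+ n <= 1.
  by rewrite subr_ge0 exprn_ile1 //= gerBl exprn_ge0.
by rewrite exprn_ge0 // exprn_ile1.
Qed.

(** The exponent [2 ^ n] turns [u ^ n] into [2 ^ n * u ^ n = (2 u) ^ n] in both Bernoulli bounds,
    hence the threshold [1/2]. *)
Lemma step_approx_lt u : 0 <= u -> u < 2^-1 -> step_approx u @ \oo --> (1 : R).
Proof.
move=> u0 u2; have u1 : u <= 1 by lra.
apply: (@squeeze_cvgr _ _ _ _ (fun n => 1 - (2 * u) ^+ n) (fun=> 1)).
- apply: nearW => n; have un : 0 <= u ^+ n <= 1 by rewrite exprn_ge0 // exprn_ile1.
  have /andP[_ ->] := @step_approx_itv u n ltac:(by rewrite u0 u1).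
  by rewrite andbT; have := bernoulli_sub (2 ^ n) un; rewrite natrX exprMn.
- suff : (fun n => 1 - (2 * u) ^+ n) @ \oo --> (1 - 0 : R) by rewrite subr0.
  apply: cvgB; first exact: cvg_cst.
  apply: cvg_expr; rewrite ger0_norm ?mulr_ge0 //; lra.
- exact: cvg_cst.
Qed.

Lemma step_approx_gt u : 2^-1 < u -> u <= 1 -> step_approx u @ \oo --> (0 : R).
Proof.
move=> u2 u1; have u0 : 0 < u by apply: lt_trans u2; rewrite invr_gt0.
have u01 : 0 <= u <= 1 by rewrite ltW.
apply: (@squeeze_cvgr _ _ _ _ (fun=> 0) (fun n => (2 * u)^-1 ^+ n)).
- apply: nearW => n; have un : 0 <= u ^+ n <= 1 by rewrite exprn_ge0 ?exprn_ile1 // ltW.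
  have /andP[s0 _] := step_approx_itv n u01; rewrite s0 /=.
  have un0 : 0 < (2 * u) ^+ n by rewrite exprn_gt0 // mulr_gt0.
  rewrite exprVn -[leRHS]mul1r ler_pdivlMr //.
  apply: le_trans (bernoulli_inv (2 ^ n) un).
  by rewrite natrX -exprMn ler_wpM2l // lerDr.
- exact: cvg_cst.
apply: cvg_expr; rewrite ger0_norm ?invr_ge0 ?mulr_ge0 ?(ltW u0) //.
by rewrite invf_lt1 ?mulr_gt0 //; move: u2; lra.
Qed.

End step_approximation.

Section Pi_complete.
Variables (R : realType) (k : nat).
Hypothesis k1 : (1 <= k)%N.
Local Notation K := (k%:R : R).
Local Notation mu := (@lebesgue_measure R).
Local Notation P := (@CDpoly R k).
Local Notation w := (@CDw R k).
Local Notation D := (@supp R k).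
Local Notation h := (sphn R k).

Let mD : measurable (D : set (g_sigma_algebraType R.-ocitv.-measurable)) := @measurable_supp R k.

Lemma supp_norm_le1 (t : R) : D t -> `|t| <= 1.
Proof.
rewrite /supp /= in_itv /= => /andP[t1 t2].
have := CDa_sqr_le1 R k1; have := CDa_gt0 R k1; rewrite ler_norml; nra.
Qed.

Lemma Pi_L2_expM (f : R -> R) i : Pi_L2 k f -> Pi_L2 k (fun t => t ^+ i * f t).
Proof.
move=> f2; apply: (Pi_L2_mul_bounded k1 f2 (M := 1)).
  apply: measurable_funX; exact: measurable_id.
by move=> t Dt; rewrite normrX exprn_ile1 // supp_norm_le1.
Qed.

(** The three-term recursion trades a factor [t] for a shift of [n]: by induction on [i],
    [t ^ i * f] is orthogonal to all the [P n] at once. *)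
Lemma PiInt_moment0 (f : R -> R) : Pi_L2 k f -> (forall n, Pi_dot k f (P n) = 0) ->
  forall i, PiInt k (fun t => t ^+ i * f t) = 0.
Proof.
move=> f2 f0 i.
suff : Pi_dot k (fun t => t ^+ i * f t) (P 0) = 0.
  by rewrite /Pi_dot => <-; congr PiInt; apply/funext => t; rewrite mulr1.
elim: i 0%N => [|i IH] n.
  by rewrite -[RHS](f0 n); congr PiInt; apply/funext => t; rewrite expr0 mul1r.
have i2 := Pi_L2_expM i f2; have P2 m := Pi_L2_CDpoly R k1 m.
case: n => [|n].
  by rewrite -[RHS](IH 1%N); congr PiInt; apply/funext => t; rewrite exprS /CDpoly /=; ring.
have -> : Pi_dot k (fun t => t ^+ i.+1 * f t) (P n.+1) =
    Pi_dot k (fun t => K / k.+1%:R * P n.+2 t + k.+1%:R^-1 * P n t) (fun t => t ^+ i * f t).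
  congr PiInt; apply/funext => t; rewrite CDpolySS exprS; field.
  by rewrite addrC natr1 !pnatr_eq0 /= -lt0n k1.
by rewrite Pi_dotDl ?Pi_dotZl 1?Pi_dotC ?IH 1?Pi_dotC ?IH ?mulr0 ?addr0 //; exact: Pi_L2Z.
Qed.

Lemma PiInt_horner0 (f : R -> R) (p : {poly R}) :
  Pi_L2 k f -> (forall n, Pi_dot k f (P n) = 0) ->
  PiInt k (fun t => p.[t] * f t) = 0.
Proof.
move=> f2 f0.
have -> : (fun t => p.[t] * f t) = fun t => \sum_(i < size p) p`_i * (t ^+ i * f t).
  by apply/funext => t; rewrite horner_coef mulr_suml; apply: eq_bigr => i _; rewrite mulrA.
have iE i : Pi_integrable k (fun t => t ^+ i * f t).
  have := Pi_L2M k1 (Pi_L2_expM i f2) (Pi_L2_CDpoly R k1 0).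
  by congr Pi_integrable; apply/funext => t; rewrite mulr1.
rewrite PiInt_sum => [|i]; last exact: Pi_integrableZ.
by rewrite big1 // => i _; rewrite PiIntZ // PiInt_moment0 // mulr0.
Qed.

(** [u] is the increasing affine map with [u x = 1/2] that sends the support into [[0, 1]], because
    [|t - x| <= 1 + |x|] there. The polynomials [p n] tend to the indicator of [t < x] except at
    [x], a null set, and [|f w|] dominates. *)
Lemma integral_step0 (f : R -> R) (x : R) :
  Pi_L2 k f -> (forall n, Pi_dot k f (P n) = 0) ->
  (\int[mu]_(t in D) (((fun t => f t * w t) \_ `]-oo, x]) t)%:E)%E = 0%E.
Proof.
move=> f2 f0; pose C : R := 1 + `|x|.
have C0 : 0 < C by rewrite ltr_pwDl.
pose u t : R := (t - x) / (2 * C) + 2^-1.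
have uD (t : R) : D t -> 0 <= u t <= 1.
  move=> /supp_norm_le1 t1; have : `|t - x| <= C by rewrite (le_trans (ler_normB _ _)) // lerD.
  rewrite ler_norml => /andP[h1 h2].
  have -> : u t = (t - x + C) / (2 * C) by rewrite /u; field; rewrite gt_eqF.
  rewrite divr_ge0 ?mulr_ge0 ?(ltW C0) //=; last by lra.
  by rewrite ler_pdivrMr ?mulr_gt0 //; lra.
pose U : {poly R} := (2 * C)^-1 *: ('X - x%:P) + (2^-1)%:P.
pose p n : {poly R} := (1 - U ^+ n) ^+ (2 ^ n).
have pE n t : (p n).[t] = step_approx (u t) n.
  by rewrite /p /step_approx !hornerE /u [_^-1 * _]mulrC.
have fi : Pi_integrable k f.
  have := Pi_L2M k1 f2 (Pi_L2_CDpoly R k1 0).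
  by congr Pi_integrable; apply/funext => t; rewrite mulr1.
have mp n : measurable_fun D (fun t => (p n).[t]).
  apply: (@measurable_funS _ _ _ _ setT) => //.
  by apply: continuous_measurable_fun; exact: continuous_horner.
have [] := @dominated_convergence _ _ _ mu D mD
  (fun n t => ((p n).[t] * f t * w t)%:E)
  (fun t => (((fun t => f t * w t) \_ `]-oo, x]) t)%:E)
  (abse \o (EFin \o (fun t => f t * w t))).
- move=> n; apply/measurable_EFinP; apply: measurable_funM; last exact: CDw_measurable.
  exact: (measurable_funM (mp n) f2.1).
- apply/measurable_EFinP; apply: (measurable_restrict _ _ _).1 => //.
  apply: (@measurable_funS _ _ _ _ D) => //.
  by apply/measurable_EFinP; exact: measurable_int fi.
- have x0 : mu [set x] = 0%E by exact: lebesgue_measure_set1.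
  exists [set x]; split => // t /= /not_implyP[Dt h]; apply: contrapT => tx; apply: h.
  apply/fine_cvgP; split; first exact: nearW.
  suff : (fun n => step_approx (u t) n * f t * w t) @ \oo -->
      (((fun t => f t * w t) \_ `]-oo, x]) t).
    by under eq_fun do rewrite -pE.
  rewrite patchE; have [] := ltgtP t x => [lt|gt|//].
  + rewrite mem_set /= ?in_itv /= ?ltW // -[X in _ --> X]mul1r.
    under eq_fun do rewrite -mulrA.
    apply: cvgMl; apply: step_approx_lt; first by case/andP: (uD t Dt).
    by rewrite /u gtrDr pmulr_llt0 ?invr_gt0 ?mulr_gt0 // subr_lt0.
  + rewrite memNset /= ?in_itv /= -?ltNge //; last by apply/negP; rewrite -ltNge.
    rewrite -[X in _ --> X](mul0r (f t * w t)).
    under eq_fun do rewrite -mulrA.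
    apply: cvgMl; apply: step_approx_gt; last by case/andP: (uD t Dt).
    by rewrite /u ltrDr mulr_gt0 ?invr_gt0 ?mulr_gt0 // subr_gt0.
- exact: integrable_abse fi.
- apply/aeW => t n Dt /=; rewrite lee_fin -mulrA normrM.
  have /andP[s0 s1] := step_approx_itv n (uD t Dt).
  by rewrite pE ger0_norm // ler_piMl.
move=> _ _ h1.
have h2 : (\int[mu]_(t in D) ((p n).[t] * f t * w t)%:E)%E @[n --> \oo] --> 0%E.
  apply: cvg_near_cst; apply: nearW => n.
  have pi : Pi_integrable k (fun t => (p n).[t] * f t).
    have := Pi_L2M k1 (Pi_L2_mul_bounded k1 (M := 1) f2 (mp n) _) (Pi_L2_CDpoly R k1 0).
    have -> : (fun t => (p n).[t] * f t * P 0 t) = (fun t => (p n).[t] * f t).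
      by apply/funext => t; rewrite mulr1.
    apply=> t Dt; have /andP[s0 s1] := step_approx_itv n (uD t Dt).
    by rewrite pE ger0_norm.
  by rewrite Pi_integrable_integral // PiInt_horner0.
exact: (cvg_unique _ h1 h2).
Qed.

(** The integral of [f w] over each half-line vanishes, so Lebesgue differentiation gives [f w = 0]
    almost everywhere, and [w] is positive on the open interval. *)
Lemma Pi_dot0_ae (f : R -> R) : Pi_L2 k f -> (forall n, Pi_dot k f (P n) = 0) ->
  Pi_ae k (fun t => f t = 0).
Proof.
move=> f2 f0; pose g := (fun t => f t * w t) \_ D.
have fi : Pi_integrable k f.
  have := Pi_L2M k1 f2 (Pi_L2_CDpoly R k1 0).
  by congr Pi_integrable; apply/funext => t; rewrite mulr1.
have gi : mu.-integrable setT (EFin \o g).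
  by rewrite /g -restrict_EFin; apply/(integrable_mkcond _ mD).1.
have gF x : (\int[mu]_(t in `]-oo, x]) g t)%R = 0.
  rewrite /Rintegral (_ : \int[mu]_(t in `]-oo, x]) (g t)%:E = 0)%E //.
  rewrite -(integral_step0 x f2 f0).
  rewrite [LHS]integral_mkcond [RHS]integral_mkcond; apply: eq_integral => t _.
  by rewrite [LHS]patchE [RHS]patchE /g !patchE; case: ifP; case: ifP.
have gl : locally_integrable setT g by apply: open_integrable_locally; first exact: openT.
have gy y : mu.-integrable `]-oo, y] (EFin \o g) by exact: integrableS gi.
have := FTC1Ny gy gl.
apply: filterS; first exact: (ae_filter_ringOfSetsType mu).
move=> t [_]; rewrite (_ : (fun x => _) = cst 0); last exact/funext.
rewrite derive1_cst => gt ta.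
have Dt : t \in D.
  by rewrite inE /supp /=; exact: subset_itv_oo_cc ta.
have w0 : 0 < w t by apply: CDw_gt0 => //; move: ta; rewrite in_itv.
move: gt => /esym; rewrite /g patchE Dt => /eqP.
by rewrite mulf_eq0 (gt_eqF w0) orbF => /eqP.
Qed.

End Pi_complete.

(** * Parseval's identity *)

Section Parseval.
Variables (R : realType) (k : nat).
Hypothesis k1 : (1 <= k)%N.
Local Notation mu := (@lebesgue_measure R).
Local Notation P := (@CDpoly R k).
Local Notation w := (@CDw R k).
Local Notation D := (@supp R k).
Local Notation h := (sphn R k).

Let mD : measurable (D : set (g_sigma_algebraType R.-ocitv.-measurable)) := @measurable_supp R k.

(** The density is zero at both end points, so passing from the open to the closed interval costs
    nothing. *)
Lemma Pi_ae_supp (Q : R -> Prop) :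
  Pi_ae k Q -> {ae mu, forall t, D t -> w t != 0 -> Q t}.
Proof.
rewrite /Pi_ae; apply: filterS; first exact: (ae_filter_ringOfSetsType mu).
move=> t Qt; rewrite /supp /= in_itv /= => /andP[t1 t2] w0; apply: Qt.
rewrite in_itv /= !lt_neqAle t1 t2 !andbT.
apply/andP; split; apply: contra w0 => /eqP tE.
  by rewrite /CDw -tE sqrrN subrr sqrtr0 mul0r mulr0.
by rewrite /CDw tE subrr sqrtr0 mul0r mulr0.
Qed.

Lemma PiInt_ae_eq (f g : R -> R) : measurable_fun D f -> measurable_fun D g ->
  Pi_ae k (fun t => f t = g t) -> PiInt k f = PiInt k g.
Proof.
move=> mf mg /Pi_ae_supp fg; rewrite /PiInt /Rintegral; congr fine.
apply: ae_eq_integral => //.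
- by apply/measurable_EFinP; apply: measurable_funM => //; exact: CDw_measurable.
- by apply/measurable_EFinP; apply: measurable_funM => //; exact: CDw_measurable.
move: fg; apply: filterS; first exact: (ae_filter_ringOfSetsType mu).
move=> t fg Dt; have [->|w0] := eqVneq (w t) 0; first by rewrite !mulr0.
by rewrite fg.
Qed.

Lemma Pi_ae_and (Q S : R -> Prop) :
  Pi_ae k Q -> Pi_ae k S -> Pi_ae k (fun t => Q t /\ S t).
Proof.
rewrite /Pi_ae; apply: filterS2; first exact: (ae_filter_ringOfSetsType mu).
by move=> t Qt St ta; split; [exact: Qt | exact: St].
Qed.

Lemma Pi_ae_imp (Q S : R -> Prop) :
  (forall t, Q t -> S t) -> Pi_ae k Q -> Pi_ae k S.
Proof.
move=> QS; rewrite /Pi_ae; apply: filterS; first exact: (ae_filter_ringOfSetsType mu).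
by move=> t Qt ta; apply/QS/Qt.
Qed.

Lemma Pi_L2_ext (f g : R -> R) : Pi_L2 k f -> Pi_L2 k g ->
  (forall n, Pi_dot k f (P n) = Pi_dot k g (P n)) -> Pi_ae k (fun t => f t = g t).
Proof.
move=> f2 g2 fg; have := Pi_dot0_ae k1 (Pi_L2B k1 f2 g2).
have H n : Pi_dot k (fun t => f t - g t) (P n) = 0.
  by rewrite Pi_dotBl ?fg ?subrr //; exact: Pi_L2_CDpoly.
by move=> /(_ H); apply: Pi_ae_imp => t /eqP; rewrite subr_eq0 => /eqP.
Qed.

Lemma Pi_Bessel (f : R -> R) : Pi_L2 k f ->
  cvgn (series (fun n => h n * Pi_dot k f (P n) ^+ 2)).
Proof.
move=> f2; apply: (@nondecreasing_sum_cvg _ _ (Pi_dot k f f)) => N.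
  by rewrite mulr_ge0 ?sqr_ge0 // ltW // sphn_gt0.
pose c n := h n * Pi_dot k f (P n).
have S2 := Pi_L2_CDsum k1 c N.
have := Pi_dot_ge0 k1 (fun t => f t - CDsum k c N t).
rewrite Pi_dotBB // Pi_dot_CDsum_CDsum // Pi_dotC Pi_dot_CDsuml //.
set s := \sum_(n < N) _.
have -> : \sum_(n < N) c n ^+ 2 / h n = s.
  apply: eq_bigr => n _; rewrite /c; have := sphn_gt0 R k1 n => hn.
  by field; rewrite gt_eqF.
have -> : \sum_(n < N) h n * Pi_dot k f (P n) ^+ 2 = s.
  by apply: eq_bigr => n _; rewrite /c; ring.
by move=> H; lra.
Qed.

(** Riesz-Fischer yields a [g] with the coefficients of [f] whose squared norm is the sum of the
    series, and completeness identifies [f] with [g]. *)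
Lemma Pi_Parseval (f : R -> R) : Pi_L2 k f ->
  series (fun n => h n * Pi_dot k f (P n) ^+ 2) @ \oo --> Pi_dot k f f.
Proof.
move=> f2; have [g [g2 gc gn]] := Riesz_Fischer k1 (Pi_Bessel f2).
suff -> : Pi_dot k f f = Pi_dot k g g by rewrite gn; exact: Pi_Bessel.
have fg := Pi_L2_ext f2 g2 (fun n => esym (gc n)).
apply: PiInt_ae_eq.
- by have [mf _] := f2; exact: (measurable_funM mf mf).
- by have [mg _] := g2; exact: (measurable_funM mg mg).
- by apply: Pi_ae_imp fg => t ->.
Qed.

Lemma Pi_Parseval2 (f g : R -> R) : Pi_L2 k f -> Pi_L2 k g ->
  series (fun n => h n * Pi_dot k f (P n) * Pi_dot k g (P n)) @ \oo --> Pi_dot k f g.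
Proof.
move=> f2 g2.
have cD := Pi_Parseval (Pi_L2D k1 f2 g2); have cB := Pi_Parseval (Pi_L2B k1 f2 g2).
have -> : series (fun n => h n * Pi_dot k f (P n) * Pi_dot k g (P n)) =
   fun N => 4^-1 * (series (fun n => h n * Pi_dot k (fun t => f t + g t) (P n) ^+ 2) N -
     series (fun n => h n * Pi_dot k (fun t => f t - g t) (P n) ^+ 2) N).
  apply/funext => N; rewrite !seriesEnat /= -sumrB mulr_sumr; apply: eq_bigr => n _.
  have P2 := Pi_L2_CDpoly R k1 n.
  by rewrite Pi_dotDl // Pi_dotBl //; field.
have -> : Pi_dot k f g = 4^-1 * (Pi_dot k (fun t => f t + g t) (fun t => f t + g t) -
    Pi_dot k (fun t => f t - g t) (fun t => f t - g t)).
  by rewrite Pi_dotDD // Pi_dotBB //; field.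
by apply: cvgMr; apply: cvgB.
Qed.

End Parseval.

(** * Sums over the vertices *)

Section vertex_sums.
Variables (R : realType) (k : nat).
Local Notation V := (vertex k).
Implicit Types (F G : V -> R) (o : V).

Lemma rvsumE m F : rvsum m F = \sum_(x <- words k m) F x.
Proof. exact: big_words. Qed.

Lemma series_rvsum F N : series (fun m => rvsum m F) N = \sum_(x <- ball_seq k N) F x.
Proof.
rewrite seriesEnat /= big_mkord big_ball_seq.
by apply: eq_bigr => m _; rewrite rvsumE.
Qed.

(** Absolute summability, so that the sum may be taken along spheres about any vertex. *)
Definition Vsummable F : Prop :=
  exists C : R, forall N, \sum_(x <- ball_seq k N) `|F x| <= C.

Definition Vsum F : R := limn (series (fun m => rvsum m F)).

Lemma ball_seq_sum_le F N M : (forall x, 0 <= F x) -> (N <= M)%N ->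
  \sum_(x <- ball_seq k N) F x <= \sum_(x <- ball_seq k M) F x.
Proof.
move=> F0 /subnKC <-; elim: (M - N)%N => [|m IH]; first by rewrite addn0.
by rewrite addnS ball_seqS big_cat /= (le_trans IH) // lerDl sumr_ge0.
Qed.

Lemma Vsummable_le F G : (forall x, `|F x| <= G x) -> Vsummable G -> Vsummable F.
Proof.
move=> FG [C GC]; exists C => N; apply: le_trans (GC N).
by apply: ler_sum => x _; rewrite (le_trans (FG x)) // ler_norm.
Qed.

Lemma Vsummable_norm F : Vsummable F -> Vsummable (fun x => `|F x|).
Proof. by move=> [C FC]; exists C => N; under eq_bigr do rewrite normr_id. Qed.

Lemma VsummableD F G : Vsummable F -> Vsummable G -> Vsummable (fun x => F x + G x).
Proof.
move=> [C FC] [C' GC]; exists (C + C') => N; apply: le_trans (lerD (FC N) (GC N)).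
by rewrite -big_split; apply: ler_sum => x _; exact: ler_normD.
Qed.

Lemma VsummableZ c F : Vsummable F -> Vsummable (fun x => c * F x).
Proof.
move=> [C FC]; exists (`|c| * C) => N.
under eq_bigr do rewrite normrM.
by rewrite -mulr_sumr ler_wpM2l.
Qed.

Lemma VsummableN F : Vsummable F -> Vsummable (fun x => - F x).
Proof. by move=> [C FC]; exists C => N; under eq_bigr do rewrite normrN. Qed.

Lemma VsummableB F G : Vsummable F -> Vsummable G -> Vsummable (fun x => F x - G x).
Proof. by move=> sF sG; apply: VsummableD => //; exact: VsummableN. Qed.

Let cvg_Vsum_ge0 F : (forall x, 0 <= F x) -> Vsummable F ->
  cvgn (fun N => \sum_(x <- ball_seq k N) F x).
Proof.
move=> F0 [C FC]; apply: nondecreasing_is_cvgn.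
  by move=> N M NM; exact: ball_seq_sum_le.
exists C => _ [N _ <-]; apply: le_trans (FC N).
by apply: ler_sum => x _; rewrite ler_norm.
Qed.

(** [F] is the difference of the nonnegative functions [|F| + F] and [|F|], whose partial sums are
    monotone and bounded. *)
Lemma cvg_ball_Vsum F : Vsummable F ->
  (fun N => \sum_(x <- ball_seq k N) F x) @ \oo --> Vsum F.
Proof.
move=> sF; rewrite /Vsum (_ : series _ = fun N => \sum_(x <- ball_seq k N) F x); last first.
  by apply/funext => N; exact: series_rvsum.
have sA := Vsummable_norm sF.
have := is_cvgB (cvg_Vsum_ge0 _ (VsummableD sA sF)) (cvg_Vsum_ge0 _ sA).
rewrite (_ : _ - _ = fun N => \sum_(x <- ball_seq k N) F x); last first.
  apply/funext => N; rewrite -[LHS]/(\sum_(x <- _) _ - \sum_(x <- _) _) -sumrB.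
  by apply: eq_bigr => x _; ring.
apply; last by move=> x.
by move=> x; rewrite -lerBlDr sub0r -normrN ler_norm.
Qed.

Lemma cvg_Vsum F : Vsummable F -> series (fun m => rvsum m F) @ \oo --> Vsum F.
Proof.
move=> sF; rewrite (_ : series _ = fun N => \sum_(x <- ball_seq k N) F x).
  exact: cvg_ball_Vsum.
by apply/funext => N; exact: series_rvsum.
Qed.

Lemma cvg_Vsummable F : (forall x, 0 <= F x) ->
  cvgn (series (fun m => rvsum m F)) -> Vsummable F.
Proof.
move=> F0 cF; exists (Vsum F) => N.
under eq_bigr do rewrite ger0_norm //.
rewrite -series_rvsum; apply: nondecreasing_cvgn_le => // n m nm.
by rewrite !series_rvsum; exact: ball_seq_sum_le.
Qed.

Lemma ball_le_Vsum F N : (forall x, 0 <= F x) -> Vsummable F ->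
  \sum_(x <- ball_seq k N) F x <= Vsum F.
Proof.
move=> F0 sF; rewrite -series_rvsum; apply: nondecreasing_cvgn_le => [n m nm|].
  by rewrite !series_rvsum; exact: ball_seq_sum_le.
by apply/cvg_ex; exists (Vsum F); exact: cvg_Vsum.
Qed.

Lemma Vsum_unique F L : (fun N => \sum_(x <- ball_seq k N) F x) @ \oo --> L -> Vsum F = L.
Proof.
move=> FL; apply/cvg_lim => //.
rewrite (_ : series _ = fun N => \sum_(x <- ball_seq k N) F x) //.
by apply/funext => N; exact: series_rvsum.
Qed.

Lemma VsumD F G : Vsummable F -> Vsummable G ->
  Vsum (fun x => F x + G x) = Vsum F + Vsum G.
Proof.
move=> sF sG; apply: Vsum_unique; under eq_fun do rewrite big_split.
by apply: cvgD; exact: cvg_ball_Vsum.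
Qed.

Lemma VsumZ c F : Vsummable F -> Vsum (fun x => c * F x) = c * Vsum F.
Proof.
move=> sF; apply: Vsum_unique; under eq_fun do rewrite -mulr_sumr.
by apply: cvgMr; exact: cvg_ball_Vsum.
Qed.

Lemma VsumN F : Vsummable F -> Vsum (fun x => - F x) = - Vsum F.
Proof.
move=> sF; apply: Vsum_unique; under eq_fun do rewrite sumrN.
by apply: cvgN; exact: cvg_ball_Vsum.
Qed.

Lemma VsumB F G : Vsummable F -> Vsummable G ->
  Vsum (fun x => F x - G x) = Vsum F - Vsum G.
Proof. by move=> sF sG; rewrite VsumD ?VsumN //; exact: VsummableN. Qed.

Lemma Vsum_ge0 F : (forall x, 0 <= F x) -> Vsummable F -> 0 <= Vsum F.
Proof. by move=> F0 sF; apply: le_trans (ball_le_Vsum 0 F0 sF); rewrite /ball_seq big_nil. Qed.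

Lemma le_Vsum F G : Vsummable F -> Vsummable G -> (forall x, F x <= G x) -> Vsum F <= Vsum G.
Proof.
move=> sF sG FG; rewrite -subr_ge0 -VsumB //; apply: Vsum_ge0; last exact: VsummableB.
by move=> x; rewrite subr_ge0.
Qed.

Lemma ball_seq_sum_supp F N M : (N <= M)%N ->
  (forall x, ~~ (size (val x) < N)%N -> F x = 0) ->
  \sum_(x <- ball_seq k M) F x = \sum_(x <- ball_seq k N) F x.
Proof.
move=> /subnKC <- F0; elim: (M - N)%N => [|m IH]; first by rewrite addn0.
rewrite addnS ball_seqS big_cat /= IH [X in _ + X]big1_seq ?addr0 // => x.
by rewrite mem_words => /andP[_ /eqP xs]; apply: F0; rewrite xs -leqNgt leq_addr.
Qed.

Lemma Vsummable_supp F N : (forall x, ~~ (size (val x) < N)%N -> F x = 0) -> Vsummable F.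
Proof.
move=> F0; exists (\sum_(x <- ball_seq k N) `|F x|) => M.
have [NM|/ltnW MN] := leqP N M; last by apply: ball_seq_sum_le.
rewrite -(@ball_seq_sum_supp (fun x => `|F x|) N M) // => x xN.
by rewrite F0 // normr0.
Qed.

Lemma Vsum_supp F N : (forall x, ~~ (size (val x) < N)%N -> F x = 0) ->
  Vsum F = \sum_(x <- ball_seq k N) F x.
Proof.
move=> F0; apply: Vsum_unique; apply: cvg_near_cst.
by exists N => // M /= NM; rewrite (ball_seq_sum_supp NM).
Qed.

Lemma ball_seq_sum_cond F N M : (N <= M)%N ->
  \sum_(x <- ball_seq k M | (size (val x) < N)%N) F x = \sum_(x <- ball_seq k N) F x.
Proof.
move=> NM; rewrite -big_filter; apply/perm_big/uniq_perm.
- by rewrite filter_uniq // ball_seq_uniq.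
- exact: ball_seq_uniq.
move=> x; rewrite mem_filter !mem_ball_seq andb_idr // => /leq_trans; exact.
Qed.

Lemma ball_le_dist_sum o F N M : (forall x, 0 <= F x) -> (N <= M)%N ->
  \sum_(x <- ball_seq k N) F x <=
  \sum_(x <- ball_seq k M | (dist x o < N + size (val o))%N) F x.
Proof.
move=> F0 NM; rewrite -(ball_seq_sum_cond _ NM) big_mkcond [leRHS]big_mkcond.
apply: ler_sum => x _; case: ifP => [xN|_]; last by case: ifP.
rewrite (_ : (dist x o < N + size (val o))%N) //.
have [_ h] := dist_triangle_root x o; apply: leq_ltn_trans h _.
by rewrite addnC ltn_add2r.
Qed.

Lemma big_sph_ball o N M F : (size (val o) + N <= M)%N ->
  \sum_(n < N) \sum_(x <- sph o n) F x =
  \sum_(x <- ball_seq k M | (dist x o < N)%N) F x.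
Proof.
move=> oM; elim: N oM => [|N IH] oM.
  by rewrite big_ord0 big1 // => x; rewrite ltn0.
rewrite big_ord_recr /= IH; last by rewrite (leq_trans _ oM) // leq_add2l.
rewrite (@big_sph _ _ _ N M); last by rewrite -addnS.
rewrite [RHS](bigID (fun x => (dist x o < N)%N)) /=; congr (_ + _).
  by apply: eq_bigl => x; rewrite ltnS andb_idl // => /ltnW.
by apply: eq_bigl => x; rewrite -leqNgt ltnS -eqn_leq.
Qed.

(** If [c] is the distance from [o] to the root, the ball of radius [N + c] about [o] lies between
    the balls of radii [N] and [N + 2c] about the root. *)
Let sph_sum_ge0 o F : (forall x, 0 <= F x) -> Vsummable F ->
  series (fun n => \sum_(x <- sph o n) F x) @ \oo --> Vsum F.
Proof.
move=> F0 sF; set c := size (val o).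
rewrite -(cvg_shiftn c).
apply: (@squeeze_cvgr _ _ _ _ (fun N => \sum_(x <- ball_seq k N) F x)
   (fun N => \sum_(x <- ball_seq k (N + (c + c))) F x)).
- apply: nearW => N; rewrite seriesEnat /= big_mkord.
  rewrite (@big_sph_ball o _ (N + (c + c))); last by rewrite -/c addnCA addnA.
  apply/andP; split; last first.
    by rewrite big_mkcond; apply: ler_sum => x _; case: ifP.
  by apply: ball_le_dist_sum => //; rewrite leq_addr.
- exact: cvg_ball_Vsum.
- by rewrite (cvg_shiftn (c + c) (fun N => \sum_(x <- ball_seq k N) F x)); exact: cvg_ball_Vsum.
Qed.

Lemma cvg_sph_Vsum o F : Vsummable F ->
  series (fun n => \sum_(x <- sph o n) F x) @ \oo --> Vsum F.
Proof.
move=> sF; have sA := Vsummable_norm sF.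
have -> : series (fun n => \sum_(x <- sph o n) F x) = fun N =>
   series (fun n => \sum_(x <- sph o n) (`|F x| + F x)) N -
   series (fun n => \sum_(x <- sph o n) `|F x|) N.
  apply/funext => N; rewrite !seriesEnat /= -sumrB; apply: eq_bigr => n _.
  by rewrite -sumrB; apply: eq_bigr => x _; ring.
have -> : Vsum F = Vsum (fun x => `|F x| + F x) - Vsum (fun x => `|F x|).
  by rewrite VsumD //; ring.
apply: cvgB; apply: sph_sum_ge0 => //; last exact: VsummableD.
by move=> x; rewrite -lerBlDr sub0r -normrN ler_norm.
Qed.

Lemma Vsummable_sph o F C : (forall x, 0 <= F x) ->
  (forall N, \sum_(n < N) \sum_(x <- sph o n) F x <= C) -> Vsummable F.
Proof.
move=> F0 FC; exists C => N; under eq_bigr do rewrite ger0_norm //.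
apply: le_trans (FC (N + size (val o))%N).
rewrite (@big_sph_ball o _ (size (val o) + (N + size (val o)))) //.
by apply: ball_le_dist_sum => //; rewrite addnCA leq_addr.
Qed.

End vertex_sums.

(** * Complex sums and the Hilbert space of square summable functions *)

Section complex_parts.
Variable R : realType.
Local Notation Re := (@complex.Re R).
Local Notation Im := (@complex.Im R).
Implicit Types z u : R[i].

Lemma complex_ext z u : Re z = Re u -> Im z = Im u -> z = u.
Proof. by case: z => a b; case: u => c d /= -> ->. Qed.

Lemma Re_add z u : Re (z + u) = Re z + Re u. Proof. by case: z; case: u. Qed.
Lemma Im_add z u : Im (z + u) = Im z + Im u. Proof. by case: z; case: u. Qed.
Lemma Re_mul z u : Re (z * u) = Re z * Re u - Im z * Im u. Proof. by case: z; case: u. Qed.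
Lemma Im_mul z u : Im (z * u) = Re z * Im u + Im z * Re u. Proof. by case: z; case: u. Qed.

Lemma Re_sum (I : Type) (s : seq I) (Q : pred I) (F : I -> R[i]) :
  Re (\sum_(i <- s | Q i) F i) = \sum_(i <- s | Q i) Re (F i).
Proof. by apply: (big_morph Re Re_add). Qed.

Lemma Im_sum (I : Type) (s : seq I) (Q : pred I) (F : I -> R[i]) :
  Im (\sum_(i <- s | Q i) F i) = \sum_(i <- s | Q i) Im (F i).
Proof. by apply: (big_morph Im Im_add). Qed.

Lemma Re_conj z : Re (cconj z) = Re z. Proof. by []. Qed.
Lemma Im_conj z : Im (cconj z) = - Im z. Proof. by []. Qed.

Lemma cconjM z u : cconj (z * u) = cconj z * cconj u.
Proof. by case: z => a b; case: u => c d; apply: complex_ext => /=; ring. Qed.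

Lemma cconjK z : cconj (cconj z) = z.
Proof. by apply: complex_ext => //=; rewrite opprK. Qed.

Lemma sqn_ge0 z : 0 <= sqn z. Proof. by rewrite addr_ge0 ?sqr_ge0. Qed.

Lemma sqn0 : sqn (0 : R[i]) = 0. Proof. by rewrite /sqn /= expr0n addr0. Qed.

Lemma sqnM z u : sqn (z * u) = sqn z * sqn u.
Proof. by rewrite /sqn Re_mul Im_mul; ring. Qed.

Lemma sqn_conj z : sqn (cconj z) = sqn z.
Proof. by rewrite /sqn /= sqrrN. Qed.

Lemma sqnD_le z u : sqn (z + u) <= 2 * (sqn z + sqn u).
Proof.
rewrite /sqn Re_add Im_add; have := sqr_ge0 (Re z - Re u); have := sqr_ge0 (Im z - Im u).
move: (Re z) (Re u) (Im z) (Im u) => a b c d; nra.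
Qed.

Lemma Re_le_sqn z u : `|Re (z * u)| <= sqn z + sqn u.
Proof.
rewrite Re_mul /sqn ler_norml.
move: (Re z) (Re u) (Im z) (Im u) => a b c d.
have := sqr_ge0 (a - b); have := sqr_ge0 (a + b); have := sqr_ge0 (c - d).
by have := sqr_ge0 (c + d) => *; apply/andP; split; nra.
Qed.

Lemma Im_le_sqn z u : `|Im (z * u)| <= sqn z + sqn u.
Proof.
rewrite Im_mul /sqn ler_norml.
move: (Re z) (Re u) (Im z) (Im u) => a b c d.
have := sqr_ge0 (a - d); have := sqr_ge0 (a + d); have := sqr_ge0 (c - b).
by have := sqr_ge0 (c + b) => *; apply/andP; split; nra.
Qed.

End complex_parts.

Section complex_vertex_sums.
Variables (R : realType) (k : nat).
Local Notation V := (vertex k).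
Local Notation Re := (@complex.Re R).
Local Notation Im := (@complex.Im R).
Implicit Types (F G eta xi : V -> R[i]) (o : V).

Definition CVsummable F : Prop :=
  Vsummable (fun x => Re (F x)) /\ Vsummable (fun x => Im (F x)).

Definition CVsum F : R[i] := csum (fun m => vsum m F).

Arguments CVsum : simpl never.

Lemma vsumE m F : vsum m F = \sum_(x <- words k m) F x.
Proof. exact: big_words. Qed.

Lemma Re_vsum m F : Re (vsum m F) = rvsum m (fun x => Re (F x)).
Proof. by rewrite /vsum Re_sum. Qed.

Lemma Im_vsum m F : Im (vsum m F) = rvsum m (fun x => Im (F x)).
Proof. by rewrite /vsum Im_sum. Qed.

Lemma Re_CVsum F : Re (CVsum F) = Vsum (fun x => Re (F x)).
Proof. by rewrite /CVsum /csum /=; under eq_fun do rewrite Re_vsum. Qed.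

Lemma Im_CVsum F : Im (CVsum F) = Vsum (fun x => Im (F x)).
Proof. by rewrite /CVsum /csum /=; under eq_fun do rewrite Im_vsum. Qed.

Lemma CVsummable_ccvg F : CVsummable F -> ccvg (fun m => vsum m F).
Proof.
move=> [sr si]; split.
  under eq_fun do rewrite Re_vsum.
  by apply/cvg_ex; exists (Vsum (fun x => Re (F x))); exact: cvg_Vsum.
under eq_fun do rewrite Im_vsum.
by apply/cvg_ex; exists (Vsum (fun x => Im (F x))); exact: cvg_Vsum.
Qed.

Lemma CVsummableD F G : CVsummable F -> CVsummable G -> CVsummable (fun x => F x + G x).
Proof.
move=> [F1 F2] [G1 G2]; split.
  by have := VsummableD F1 G1; congr Vsummable; apply/funext => x; rewrite Re_add.
by have := VsummableD F2 G2; congr Vsummable; apply/funext => x; rewrite Im_add.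
Qed.

Lemma CVsumD F G : CVsummable F -> CVsummable G ->
  CVsum (fun x => F x + G x) = CVsum F + CVsum G.
Proof.
move=> [F1 F2] [G1 G2]; apply: complex_ext.
  by rewrite Re_add !Re_CVsum -VsumD //; congr Vsum; apply/funext => x; rewrite Re_add.
by rewrite Im_add !Im_CVsum -VsumD //; congr Vsum; apply/funext => x; rewrite Im_add.
Qed.

Lemma CVsummableZ c F : CVsummable F -> CVsummable (fun x => c * F x).
Proof.
move=> [F1 F2]; split.
  have := VsummableB (VsummableZ (Re c) F1) (VsummableZ (Im c) F2).
  by congr Vsummable; apply/funext => x; rewrite Re_mul.
have := VsummableD (VsummableZ (Re c) F2) (VsummableZ (Im c) F1).
by congr Vsummable; apply/funext => x; rewrite Im_mul.
Qed.

Lemma CVsumZ c F : CVsummable F -> CVsum (fun x => c * F x) = c * CVsum F.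
Proof.
move=> [F1 F2]; apply: complex_ext.
  rewrite Re_mul !Re_CVsum !Im_CVsum -!VsumZ // -VsumB; try exact: VsummableZ.
  by congr Vsum; apply/funext => x; rewrite Re_mul.
rewrite Im_mul !Re_CVsum !Im_CVsum -!VsumZ // -VsumD; try exact: VsummableZ.
by congr Vsum; apply/funext => x; rewrite Im_mul.
Qed.

Lemma CVsum_conj F : CVsummable F -> CVsum (fun x => cconj (F x)) = cconj (CVsum F).
Proof.
move=> [F1 F2]; apply: complex_ext; first by rewrite Re_conj !Re_CVsum.
by rewrite Im_conj !Im_CVsum -VsumN.
Qed.

Lemma CVsummable0 : CVsummable (fun=> 0).
Proof. by split; apply: (@Vsummable_supp _ _ _ 0). Qed.

Lemma CVsum0 : CVsum (fun=> 0) = 0.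
Proof.
have := CVsumZ 0 CVsummable0; rewrite [RHS]mul0r => H; rewrite -[RHS]H.
by congr CVsum; apply/funext => x; rewrite mul0r.
Qed.

Lemma CVsummable_sum (I : Type) (s : seq I) (F : I -> V -> R[i]) :
  (forall i, CVsummable (F i)) -> CVsummable (fun x => \sum_(i <- s) F i x).
Proof.
move=> sF; elim: s => [|i s IH].
  by have := CVsummable0; congr CVsummable; apply/funext => x; rewrite big_nil.
have := CVsummableD (sF i) IH.
by congr CVsummable; apply/funext => x; rewrite big_cons.
Qed.

Lemma CVsum_sum (I : Type) (s : seq I) (F : I -> V -> R[i]) :
  (forall i, CVsummable (F i)) ->
  CVsum (fun x => \sum_(i <- s) F i x) = \sum_(i <- s) CVsum (F i).
Proof.
move=> sF; elim: s => [|i s IH].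
  by rewrite big_nil -[RHS]CVsum0; congr CVsum; apply/funext => x; rewrite big_nil.
rewrite big_cons -IH -CVsumD //; last exact: CVsummable_sum.
by congr CVsum; apply/funext => x; rewrite big_cons.
Qed.

Lemma CVsum_supp F N : (forall x, ~~ (size (val x) < N)%N -> F x = 0) ->
  CVsum F = \sum_(x <- ball_seq k N) F x.
Proof.
move=> F0; apply: complex_ext.
  by rewrite Re_CVsum Re_sum (@Vsum_supp _ _ _ N) // => x /F0 ->.
by rewrite Im_CVsum Im_sum (@Vsum_supp _ _ _ N) // => x /F0 ->.
Qed.

Lemma l2P eta : l2 eta <-> Vsummable (fun x => sqn (eta x)).
Proof.
split=> [|s]; first by apply: cvg_Vsummable => x; exact: sqn_ge0.
by apply/cvg_ex; exists (Vsum (fun x => sqn (eta x))); exact: cvg_Vsum.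
Qed.

Definition nsq eta : R := Vsum (fun x => sqn (eta x)).

Lemma l2normE eta : l2norm eta = Num.sqrt (nsq eta). Proof. by []. Qed.

Lemma nsq_ge0 eta : l2 eta -> 0 <= nsq eta.
Proof. by move=> /l2P s; apply: Vsum_ge0 => // x; exact: sqn_ge0. Qed.

Lemma l2_le eta xi (c : R) : (forall x, sqn (eta x) <= c * sqn (xi x)) -> l2 xi -> l2 eta.
Proof.
move=> ex /l2P sx; apply/l2P; apply: Vsummable_le (VsummableZ c sx) => x.
by rewrite ger0_norm // sqn_ge0.
Qed.

Lemma l2D eta xi : l2 eta -> l2 xi -> l2 (fun x => eta x + xi x).
Proof.
move=> /l2P s1 /l2P s2; apply/l2P; apply: Vsummable_le (VsummableZ 2 (VsummableD s1 s2)) => x.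
by rewrite ger0_norm ?sqn_ge0 // sqnD_le.
Qed.

Lemma l2Z c eta : l2 eta -> l2 (fun x => c * eta x).
Proof. by apply: (@l2_le _ _ (sqn c)) => x; rewrite sqnM. Qed.

Lemma nsqZ c eta : l2 eta -> nsq (fun x => c * eta x) = sqn c * nsq eta.
Proof.
by move=> /l2P s; rewrite /nsq -VsumZ //; congr Vsum; apply/funext => x; rewrite sqnM.
Qed.

Lemma nsqD_le eta xi : l2 eta -> l2 xi ->
  nsq (fun x => eta x + xi x) <= 2 * (nsq eta + nsq xi).
Proof.
move=> l1 l2'; have /l2P s := l2D l1 l2'; move: l1 l2' => /l2P s1 /l2P s2.
rewrite /nsq -VsumD // -VsumZ; last exact: VsummableD.
apply: le_Vsum => //; first exact/VsummableZ/VsummableD.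
by move=> x; exact: sqnD_le.
Qed.

Lemma l2_conj eta : l2 eta -> l2 (fun x => cconj (eta x)).
Proof. by apply: (@l2_le _ _ 1) => x; rewrite sqn_conj mul1r. Qed.

Lemma nsq_conj eta : nsq (fun x => cconj (eta x)) = nsq eta.
Proof. by congr Vsum; apply/funext => x; rewrite sqn_conj. Qed.

Lemma l2_supp eta N : (forall x, ~~ (size (val x) < N)%N -> eta x = 0) -> l2 eta.
Proof.
by move=> e0; apply/l2P; apply: (@Vsummable_supp _ _ _ N) => x /e0 ->; rewrite sqn0.
Qed.

Lemma CVsummableM eta xi : l2 eta -> l2 xi -> CVsummable (fun x => eta x * xi x).
Proof.
move=> /l2P s1 /l2P s2; split; apply: Vsummable_le (VsummableD s1 s2) => x.
  exact: Re_le_sqn.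
exact: Im_le_sqn.
Qed.

(** The real inner product suffices for norms and for Cauchy-Schwarz by a real discriminant;
    [l2dot_adjoint] recovers the complex one. *)
Definition rdot eta xi : R := Re (l2dot eta xi).

Lemma rdotE eta xi :
  rdot eta xi = Vsum (fun x => Re (eta x) * Re (xi x) + Im (eta x) * Im (xi x)).
Proof.
rewrite /rdot /l2dot -/(CVsum _) Re_CVsum; congr Vsum; apply/funext => x.
by rewrite Re_mul /=; ring.
Qed.

Lemma rdotC eta xi : rdot eta xi = rdot xi eta.
Proof. by rewrite !rdotE; congr Vsum; apply/funext => x; ring. Qed.

Lemma rdot_nsq eta : rdot eta eta = nsq eta.
Proof. by rewrite rdotE; congr Vsum; apply/funext => x; rewrite /sqn; ring. Qed.

Lemma rdotDl eta eta' xi : l2 eta -> l2 eta' -> l2 xi ->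
  rdot (fun x => eta x + eta' x) xi = rdot eta xi + rdot eta' xi.
Proof.
move=> l1 l2' l3; have l3' := l2_conj l3.
rewrite /rdot /l2dot -!/(CVsum _) -Re_add -CVsumD; try exact: CVsummableM.
by congr (Re (CVsum _)); apply/funext => x; rewrite mulrDl.
Qed.

Lemma rdotZl (c : R) eta xi : l2 eta -> l2 xi ->
  rdot (fun x => rC c * eta x) xi = c * rdot eta xi.
Proof.
move=> l1 l2'; have s := CVsummableM l1 (l2_conj l2').
rewrite /rdot /l2dot -!/(CVsum _).
have -> : c * Re (CVsum (fun x => eta x * cconj (xi x))) =
   Re (rC c * CVsum (fun x => eta x * cconj (xi x))) by rewrite Re_mul /= mul0r subr0.
by rewrite -CVsumZ //; congr (Re (CVsum _)); apply/funext => x; rewrite mulrA.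
Qed.

Lemma nsqD eta xi : l2 eta -> l2 xi ->
  nsq (fun x => eta x + xi x) = nsq eta + 2 * rdot eta xi + nsq xi.
Proof.
move=> l1 l2'; have l3 := l2D l1 l2'.
rewrite -!rdot_nsq rdotDl // !(rdotC _ (fun x => eta x + xi x)) !rdotDl //.
by rewrite (rdotC xi eta); ring.
Qed.

Lemma rdot_cauchy_schwarz eta xi : l2 eta -> l2 xi ->
  rdot eta xi ^+ 2 <= nsq eta * nsq xi.
Proof.
move=> l1 l2'; apply: quadratic_nonneg; first exact: nsq_ge0.
move=> c; have lc := l2Z (c := rC c) l1; have := nsq_ge0 (l2D lc l2').
rewrite nsqD // nsqZ // rdotZl //.
have -> : sqn (rC c) = c ^+ 2 by rewrite /sqn /= expr0n addr0.
by rewrite mulrA.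
Qed.

Definition trunc (N : nat) eta : V -> R[i] :=
  fun x => if (size (val x) < N)%N then eta x else 0.

Lemma l2_trunc N eta : l2 (trunc N eta).
Proof. by apply: (@l2_supp _ N) => x /negPf xN; rewrite /trunc xN. Qed.

Lemma nsq_trunc N eta : l2 eta -> nsq (trunc N eta) <= nsq eta.
Proof.
move=> le; have /l2P s := le; have /l2P s' := @l2_trunc N eta.
apply: le_Vsum => // x; rewrite /trunc; case: ifP => // _.
by rewrite sqn0 sqn_ge0.
Qed.

Lemma nsq_trunc_cvg eta : l2 eta ->
  (fun N => nsq (fun x => eta x - trunc N eta x)) @ \oo --> 0.
Proof.
move=> /l2P s.
have -> : (fun N => nsq (fun x => eta x - trunc N eta x)) =
   fun N => nsq eta - \sum_(x <- ball_seq k N) sqn (eta x).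
  apply/funext => N.
  have st : Vsummable (fun x => sqn (trunc N eta x)) by apply/l2P; exact: l2_trunc.
  have -> : \sum_(x <- ball_seq k N) sqn (eta x) = Vsum (fun x => sqn (trunc N eta x)).
    rewrite (@Vsum_supp _ _ _ N) => [|x /negPf xN]; last by rewrite /trunc xN sqn0.
    by apply: eq_big_seq => x; rewrite mem_ball_seq /trunc => ->.
  rewrite /nsq -VsumB //; congr Vsum; apply/funext => x; rewrite /trunc.
  by case: ifP => _; rewrite ?subrr ?sqn0 ?subr0 // subrr.
suff : (fun N => nsq eta - \sum_(x <- ball_seq k N) sqn (eta x)) @ \oo --> nsq eta - nsq eta.
  by rewrite subrr.
apply: cvgB; first exact: cvg_cst.
exact: cvg_ball_Vsum.
Qed.

End complex_vertex_sums.

Lemma cvg_sqr_dist (R : realType) (u : nat -> R) (L : R) (v : nat -> R) :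
  (forall n, (u n - L) ^+ 2 <= v n) -> v @ \oo --> 0 -> u @ \oo --> L.
Proof.
move=> uv v0; apply/cvgrPdist_le => e e0.
have e20 : 0 < e ^+ 2 by rewrite exprn_gt0.
apply: filterS (cvgr_dist_le _ _ v0 _ e20) => n; rewrite sub0r normrN => vn.
rewrite -(@ler_pXn2r _ 2) ?nnegrE ?(ltW e0) // distrC real_normK ?num_real //.
by rewrite (le_trans (uv n)) // (le_trans (ler_norm _)).
Qed.

(** * Radial vectors and kernel operators *)

Section kernel_operators.
Variables (R : realType) (k : nat).
Local Notation V := (vertex k).
Local Notation Re := (@complex.Re R).
Local Notation Im := (@complex.Im R).
Implicit Types (eta xi : V -> R[i]) (o x y : V) (alpha beta g : nat -> R[i]).

Definition single o (c : R[i]) : V -> R[i] := fun x => if x == o then c else 0.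

Definition rad o g : V -> R[i] := fun x => g (dist x o).

Lemma radial_rad_fun o g : radial o (rad o g).
Proof. by move=> x y xy; rewrite /rad xy. Qed.

Lemma single_rad o c : single o c = rad o (fun n => if n == 0%N then c else 0).
Proof. by apply/funext => x; rewrite /single /rad dist_eq0. Qed.

Lemma single_supp o c x : ~~ (size (val x) < (size (val o)).+1)%N -> single o c x = 0.
Proof. by rewrite /single; case: eqP => // ->; rewrite ltnSn. Qed.

Lemma l2_single o c : l2 (single o c).
Proof. exact: l2_supp (@single_supp o c). Qed.

Lemma kop_single alpha o c : kop alpha (single o c) = fun x => alpha (dist x o) * c.
Proof.
apply/funext => x; rewrite /kop -/(CVsum _).
rewrite (@CVsum_supp _ _ _ (size (val o)).+1) => [|y /single_supp ->]; last exact: mulr0.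
rewrite (bigD1_seq o) ?ball_seq_uniq ?mem_ball_seq //= {1}/single eqxx.
by rewrite big1 ?addr0 // => y /negPf yo; rewrite /single yo mulr0.
Qed.

Lemma BGamma_l2 alpha eta : BGamma k alpha -> l2 eta -> l2 (kop alpha eta).
Proof. by move=> [M HM] le; have [_ []] := HM eta le. Qed.

Lemma BGamma_bound alpha : BGamma k alpha ->
  exists2 M : R, 0 <= M & forall eta, l2 eta -> nsq (kop alpha eta) <= M * nsq eta.
Proof.
move=> [M HM]; exists (M ^+ 2); first exact: sqr_ge0.
move=> eta le; have [_ [lk]] := HM eta le; rewrite !l2normE => H.
rewrite -[leLHS]sqr_sqrtr ?nsq_ge0 // -[nsq eta]sqr_sqrtr ?nsq_ge0 // -exprMn.
by rewrite lerXn2r // nnegrE ?sqrtr_ge0 // (le_trans _ H) ?sqrtr_ge0.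
Qed.

(** The kernel is symmetric, so the row at [x] is the image of the point mass at [x]. Hence the
    series defining [kop] converge absolutely. *)
Lemma BGamma_row alpha x : BGamma k alpha -> l2 (fun y => alpha (dist x y)).
Proof.
move=> bA; have := BGamma_l2 bA (@l2_single x 1); rewrite kop_single.
by congr l2; apply/funext => y; rewrite mulr1 distC.
Qed.

Lemma kop_summable alpha eta x : BGamma k alpha -> l2 eta ->
  CVsummable (fun y => alpha (dist x y) * eta y).
Proof. by move=> bA le; apply: CVsummableM => //; exact: BGamma_row. Qed.

Lemma kopD alpha eta xi : BGamma k alpha -> l2 eta -> l2 xi ->
  kop alpha (fun x => eta x + xi x) = fun x => kop alpha eta x + kop alpha xi x.
Proof.
move=> bA l1 l2'; apply/funext => x; rewrite /kop -!/(CVsum _) -CVsumD; try exact: kop_summable.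
by congr CVsum; apply/funext => y; rewrite mulrDr.
Qed.

Lemma kopZ alpha c eta : BGamma k alpha -> l2 eta ->
  kop alpha (fun x => c * eta x) = fun x => c * kop alpha eta x.
Proof.
move=> bA l1; apply/funext => x; rewrite /kop -!/(CVsum _) -CVsumZ; last exact: kop_summable.
by congr CVsum; apply/funext => y; rewrite mulrCA.
Qed.

Lemma kop_addl alpha beta c eta : BGamma k alpha -> BGamma k beta -> l2 eta ->
  kop (fun n => alpha n + c * beta n) eta = fun x => kop alpha eta x + c * kop beta eta x.
Proof.
move=> bA bB le; apply/funext => x; have sA := kop_summable x bA le; have sB := kop_summable x bB le.
rewrite /kop -!/(CVsum _) -CVsumZ // -CVsumD //; last exact: CVsummableZ.
by congr CVsum; apply/funext => y; ring.
Qed.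

(** The kernel being symmetric, its conjugate is the kernel of the adjoint. The adjoint is thus the
    operator itself between two complex conjugations, and inherits its bounds. *)
Lemma kop_conj alpha eta : BGamma k alpha -> l2 eta ->
  kop (fun n => cconj (alpha n)) eta = fun x => cconj (kop alpha (fun y => cconj (eta y)) x).
Proof.
move=> bA le; apply/funext => x; rewrite /kop -!/(CVsum _) -CVsum_conj; last first.
  by apply: kop_summable => //; exact: l2_conj.
by congr CVsum; apply/funext => y; rewrite cconjM cconjK.
Qed.

Lemma BGamma_conj alpha : BGamma k alpha -> BGamma k (fun n => cconj (alpha n)).
Proof.
move=> bA; have [M HM] := bA; exists M => eta le.
have lc := l2_conj le; have [_ [lk nk]] := HM _ lc.
split; last first.
  rewrite kop_conj //; split; first exact: l2_conj.
  by rewrite !l2normE !nsq_conj in nk *.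
move=> x; apply: CVsummable_ccvg; apply: CVsummableM => //.
exact: (@l2_conj R k (fun y => alpha (dist x y)) (@BGamma_row alpha x bA)).
Qed.

Lemma CVsum_sph (F : V -> R[i]) o : CVsummable F ->
  CVsum F = csum (fun n => \sum_(x <- sph o n) F x).
Proof.
move=> [s1 s2]; apply: (@complex_ext R).
  rewrite Re_CVsum -(cvg_lim _ (cvg_sph_Vsum o s1)) //= /csum /=.
  by under eq_fun do rewrite -Re_sum.
rewrite Im_CVsum -(cvg_lim _ (cvg_sph_Vsum o s2)) //= /csum /=.
by under eq_fun do rewrite -Im_sum.
Qed.

(* The action of the kernel operator of [alpha] on radial profiles; it does not involve the base point. *)
Definition profile_op alpha g (m : nat) : R[i] := csum (fun n => g n * sphQ k n alpha m).

(** Summability replaces boundedness so that the kernel of T[phi] is covered when only its rows are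
    known to be in l^2. *)
Lemma kop_rad_summable alpha g o : (forall x, CVsummable (fun y => alpha (dist x y) * rad o g y)) ->
  kop alpha (rad o g) = rad o (profile_op alpha g).
Proof.
move=> s; apply/funext => x; rewrite /kop -/(CVsum _) (CVsum_sph o) //.
rewrite /rad /profile_op; congr csum; apply/funext => n.
rewrite -sum_sph_dist mulr_sumr; apply: eq_big_seq => y.
by rewrite mem_sph => /eqP ->; rewrite distC mulrC.
Qed.

Lemma kop_rad alpha g o : BGamma k alpha -> l2 (rad o g) ->
  kop alpha (rad o g) = rad o (profile_op alpha g).
Proof. by move=> bA lg; apply: kop_rad_summable => x; exact: kop_summable. Qed.

Lemma sphcardE o n : (1 <= k)%N -> sphcard R o n = sphn R k n.
Proof.
move=> k1; rewrite -(size_sph R k1 o) /sphcard.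
under eq_bigr do rewrite rvsumE.
rewrite -(@big_ball_seq k (size (val o) + n).+1 R (fun x => if dist x o == n then 1 else 0)).
by rewrite -big_mkcond -big_sph // big_const_seq count_predT iter_addr_0.
Qed.

Lemma sphsumE o n (F : V -> R[i]) : sphsum o n F = \sum_(x <- sph o n) F x.
Proof.
rewrite /sphsum; under eq_bigr do rewrite vsumE.
rewrite -(@big_ball_seq k (size (val o) + n).+1 R[i] (fun x => if dist x o == n then F x else 0)).
by rewrite -big_mkcond -big_sph.
Qed.

Lemma radproj_id o eta : (1 <= k)%N -> radial o eta -> radproj o eta = eta.
Proof.
move=> k1 re; apply/funext => x; rewrite /radproj sphcardE // sphsumE.
rewrite (eq_big_seq (fun=> eta x)) => [|y]; last by rewrite mem_sph => /eqP /re.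
rewrite big_const_seq count_predT iter_addr_0.
have -> : eta x *+ size (sph o (dist x o)) = rC (sphn R k (dist x o)) * eta x.
  rewrite -(size_sph R k1 o); case: (eta x) => u v; elim: (size _) => [|n IH].
    by rewrite mulr0n; apply: complex_ext => /=; ring.
  by rewrite mulrS IH -natr1; apply: complex_ext => /=; ring.
have := sphn_gt0 R k1 (dist x o); case: (eta x) => u v; move: (sphn R k _) => h h0.
by apply: complex_ext => /=; field; rewrite gt_eqF.
Qed.

Lemma radialP o eta : (1 <= k)%N -> radial o eta -> exists g, eta = rad o g.
Proof.
move=> k1 re; exists (fun n => eta (sval (sph_point R k1 o n))).
by apply/funext => x; rewrite /rad; apply: re; case: sph_point.
Qed.

Lemma kop_radial alpha eta o : (1 <= k)%N -> BGamma k alpha -> radial o eta -> l2 eta ->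
  radial o (kop alpha eta).
Proof.
move=> k1 bA re le; have [g gE] := radialP k1 re; rewrite gE in le *.
by rewrite kop_rad //; exact: radial_rad_fun.
Qed.

Lemma jo_radial alpha eta o : (1 <= k)%N -> BGamma k alpha -> radial o eta -> l2 eta ->
  jo o alpha eta = kop alpha eta.
Proof.
move=> k1 bA re le; rewrite /jo (radproj_id k1 re) radproj_id //.
exact: kop_radial.
Qed.

Lemma sqn_rad_sph o g N : (1 <= k)%N ->
  \sum_(n < N) \sum_(x <- sph o n) sqn (rad o g x) =
  series (fun n => sphn R k n * sqn (g n)) N.
Proof.
move=> k1; rewrite seriesEnat /= big_mkord; apply: eq_bigr => n _.
rewrite (eq_big_seq (fun=> sqn (g n))) => [|x]; last by rewrite mem_sph /rad => /eqP ->.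
by rewrite big_const_seq count_predT iter_addr_0 -(size_sph R k1 o) mulr_natl.
Qed.

Lemma cvg_nsq_rad o g : (1 <= k)%N -> l2 (rad o g) ->
  series (fun n => sphn R k n * sqn (g n)) @ \oo --> nsq (rad o g).
Proof.
move=> k1 /l2P s; have := cvg_sph_Vsum o s.
rewrite (_ : series (fun n => \sum_(x <- _) _) = series (fun n => sphn R k n * sqn (g n))) //.
by apply/funext => N; rewrite -(@sqn_rad_sph o) // seriesEnat /= big_mkord.
Qed.

Lemma l2_radP o g : (1 <= k)%N ->
  l2 (rad o g) <-> cvgn (series (fun n => sphn R k n * sqn (g n))).
Proof.
move=> k1; split=> [lg|cg].
  by apply/cvg_ex; exists (nsq (rad o g)); exact: cvg_nsq_rad.
apply/l2P; apply: (@Vsummable_sph _ _ o _ (limn (series (fun n => sphn R k n * sqn (g n))))).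
  by move=> x; exact: sqn_ge0.
move=> N; rewrite sqn_rad_sph //; apply: nondecreasing_cvgn_le => //.
apply/nondecreasing_seqP => n; rewrite seriesEnat /= big_nat_recr //= lerDl.
by rewrite mulr_ge0 ?sqn_ge0 // ltW // sphn_gt0.
Qed.

(** The norm of a radial vector involves only its profile and the sizes of the spheres, which do not
    depend on the centre. *)
Lemma nsq_rad_base o o' g : (1 <= k)%N -> l2 (rad o g) ->
  l2 (rad o' g) /\ nsq (rad o' g) = nsq (rad o g).
Proof.
move=> k1 lg; have /(l2_radP o g k1) cg := lg.
have lg' : l2 (rad o' g) by apply/(l2_radP o' g k1).
split; first exact: lg'.
exact: (cvg_unique _ (cvg_nsq_rad k1 lg') (cvg_nsq_rad k1 lg)).
Qed.

(** For a truncated vector the interchange of sums involves one finite sum; the general adjoint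
    relation is the limit in [N]. *)
Lemma rdot_kop_trunc alpha eta xi N : BGamma k alpha -> l2 eta -> l2 xi ->
  rdot (kop alpha (trunc N eta)) xi =
  \sum_(y <- ball_seq k N) Re (eta y * cconj (kop (fun n => cconj (alpha n)) xi y)).
Proof.
move=> bA le lx; have bA' := BGamma_conj bA; have lx' := l2_conj lx.
have srow y : CVsummable (fun x => alpha (dist y x) * cconj (xi x)).
  by apply: CVsummableM => //; exact: BGamma_row.
have -> : kop alpha (trunc N eta) = fun x => \sum_(y <- ball_seq k N) alpha (dist x y) * eta y.
  apply/funext => x; rewrite /kop -/(CVsum _).
  rewrite (@CVsum_supp _ _ _ N) => [|y /negPf yN]; last by rewrite /trunc yN mulr0.
  by apply: eq_big_seq => y; rewrite mem_ball_seq /trunc => ->.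
rewrite /rdot /l2dot -/(CVsum _).
have -> : (fun x => (\sum_(y <- ball_seq k N) alpha (dist x y) * eta y) * cconj (xi x)) =
    fun x => \sum_(y <- ball_seq k N) eta y * (alpha (dist y x) * cconj (xi x)).
  apply/funext => x; rewrite mulr_suml; apply: eq_bigr => y _.
  by rewrite distC; ring.
rewrite CVsum_sum => [|y]; last exact: CVsummableZ.
rewrite Re_sum; apply: eq_bigr => y _; rewrite CVsumZ //; congr (Re (_ * _)).
rewrite /kop -/(CVsum _) -CVsum_conj; last exact: (@kop_summable _ xi y bA' lx).
by congr CVsum; apply/funext => x; rewrite cconjM cconjK.
Qed.

Lemma cvg_rdot_kop_trunc alpha eta xi : BGamma k alpha -> l2 eta -> l2 xi ->
  (fun N => rdot (kop alpha (trunc N eta)) xi) @ \oo --> rdot (kop alpha eta) xi.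
Proof.
move=> bA le lx; have [M M0 HM] := BGamma_bound bA.
apply: (@cvg_sqr_dist _ _ _ (fun N => M * nsq (fun x => eta x - trunc N eta x) * nsq xi)).
  move=> N; have lt := @l2_trunc R k N eta.
  have ld : l2 (fun x => eta x - trunc N eta x).
    have := l2D le (l2Z (c := - 1) lt).
    by congr l2; apply/funext => x; rewrite mulN1r.
  have lkd := BGamma_l2 bA ld; have lkt := BGamma_l2 bA lt.
  have -> : rdot (kop alpha eta) xi = rdot (kop alpha (trunc N eta)) xi +
      rdot (kop alpha (fun x => eta x - trunc N eta x)) xi.
    rewrite -(rdotDl lkt lkd lx) -(kopD bA lt ld).
    have -> // : (fun x => trunc N eta x + (eta x - trunc N eta x)) = eta.
    by apply/funext => x; rewrite addrC subrK.
  rewrite opprD addNKr sqrrN; apply: le_trans (rdot_cauchy_schwarz lkd lx) _.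
  by rewrite ler_wpM2r ?nsq_ge0 ?HM.
suff : (fun N => M * nsq (fun x => eta x - trunc N eta x) * nsq xi) @ \oo --> M * 0 * nsq xi.
  by rewrite mulr0 mul0r.
by apply: cvgMl; apply: cvgMr; exact: nsq_trunc_cvg.
Qed.

Lemma rdot_adjoint alpha eta xi : BGamma k alpha -> l2 eta -> l2 xi ->
  rdot (kop alpha eta) xi = rdot eta (kop (fun n => cconj (alpha n)) xi).
Proof.
move=> bA le lx; have bA' := BGamma_conj bA; have lk := BGamma_l2 bA' lx.
have c1 : (fun N => rdot (kop alpha (trunc N eta)) xi) @ \oo -->
    rdot eta (kop (fun n => cconj (alpha n)) xi).
  under eq_fun do rewrite rdot_kop_trunc //.
  rewrite /rdot /l2dot -/(CVsum _) Re_CVsum; apply: cvg_ball_Vsum.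
  by have [] := CVsummableM le (l2_conj lk).
exact: (cvg_unique _ (cvg_rdot_kop_trunc bA le lx) c1).
Qed.

(** The imaginary part of an inner product is its real part after the second vector is multiplied by
    [i], which commutes with the operator. *)
Lemma l2dot_adjoint alpha eta xi : BGamma k alpha -> l2 eta -> l2 xi ->
  l2dot (kop alpha eta) xi = l2dot eta (kop (fun n => cconj (alpha n)) xi).
Proof.
move=> bA le lx; have bA' := BGamma_conj bA; have lk := BGamma_l2 bA le.
have lk' := BGamma_l2 bA' lx; apply: complex_ext; first exact: rdot_adjoint.
have Im_rdot zeta zeta' : l2 zeta -> l2 zeta' -> Im (l2dot zeta zeta') =
    rdot zeta (fun x => Complex 0 1 * zeta' x).
  move=> l1 l2'; rewrite /rdot /l2dot -!/(CVsum _) Im_CVsum Re_CVsum.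
  by congr Vsum; apply/funext => x; case: (zeta x) => a b; case: (zeta' x) => c d /=; ring.
rewrite !Im_rdot // -kopZ // rdot_adjoint //; exact: l2Z.
Qed.

End kernel_operators.

(** * The isometry *)

(** If [b 1 / b 0] exceeded [q], then so would all later ratios, which are nondecreasing by
    log-convexity, and [b m] would outgrow [C * q ^ m]. The size of [C] is immaterial. *)
Lemma log_convex_bound (R : realType) (b : nat -> R) (C q : R) :
  (forall m, 0 <= b m) -> (forall m, b m.+1 ^+ 2 <= b m * b m.+2) ->
  0 <= q -> (forall m, b m <= C * q ^+ m) -> b 1%N <= q * b 0%N.
Proof.
move=> b_ge0 b_conv q0 bC; rewrite leNgt; apply/negP => b1.
have [b00|b0N] := eqVneq (b 0%N) 0.
  have := b_conv 0%N; rewrite b00 mul0r => h; rewrite b00 mulr0 in b1.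
  have : 0 < b 1%N ^+ 2 by rewrite exprn_gt0.
  by rewrite ltNge h.
have b0 : 0 < b 0%N by rewrite lt_neqAle eq_sym b0N b_ge0.
pose r := b 1%N / b 0%N.
have qr : q < r by rewrite ltr_pdivlMr.
have r0 : 0 < r by exact: le_lt_trans qr.
have H m : 0 < b m /\ r * b m <= b m.+1.
  elim: m => [|m [bm IH]]; first by rewrite /r divfK.
  have bS : 0 < b m.+1 by apply: lt_le_trans IH; rewrite mulr_gt0.
  split=> //; have := b_conv m => h.
  have h2 : b m * (r * b m.+1) <= b m * b m.+2.
    by apply: le_trans h; rewrite expr2 mulrCA mulrA ler_pM2r.
  by rewrite ler_pM2l in h2.
have G m : r ^+ m * b 0%N <= b m.
  elim: m => [|m IH]; first by rewrite expr0 mul1r.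
  by have [_ Hm] := H m; apply: le_trans Hm; rewrite exprS -mulrA ler_pM2l.
have qpos : 0 < q.
  rewrite lt_neqAle q0 andbT; apply/eqP => qz.
  have [b1' _] := H 1%N; have := bC 1%N.
  by rewrite -qz expr1 mulr0 leNgt b1'.
have cv : (fun m => C * (q / r) ^+ m) @ \oo --> (0 : R).
  rewrite -[X in _ --> X](mulr0 C); apply: cvgMr; apply: cvg_expr.
  have qr0 : 0 <= q / r by apply: divr_ge0 => //; exact: ltW.
  by rewrite ger0_norm // ltr_pdivrMr // mul1r.
have : b 0%N <= 0.
  rewrite -(cvg_lim _ cv) //; apply: limr_ge; first by apply/cvg_ex; exists 0.
  apply: nearW => m; rewrite expr_div_n mulrA ler_pdivlMr ?exprn_gt0 // mulrC.
  exact: le_trans (G m) (bC m).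
by rewrite leNgt b0.
Qed.

Section operator_norm.
Variables (R : realType) (k : nat) (o : vertex k) (alpha : nat -> R[i]).
Hypothesis k1 : (1 <= k)%N.
Hypothesis bA : BGamma k alpha.
Local Notation V := (vertex k).
Implicit Types (eta xi : V -> R[i]).

Let alpha' n := cconj (alpha n).
Let bA' : BGamma k alpha'. Proof. exact: BGamma_conj. Qed.

Let B eta := kop alpha' (kop alpha eta).

Let B_l2 eta : l2 eta -> l2 (B eta).
Proof. by move=> le; do 2!apply: BGamma_l2 => //. Qed.

Let iterB_l2 m eta : l2 eta -> l2 (iter m B eta).
Proof. by move=> le; elim: m => //= m; exact: B_l2. Qed.

Let iterBD m eta xi : l2 eta -> l2 xi ->
  iter m B (fun x => eta x + xi x) = fun x => iter m B eta x + iter m B xi x.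
Proof.
move=> le lx; elim: m => //= m ->.
have l1 := @iterB_l2 m _ le; have l2' := @iterB_l2 m _ lx.
rewrite /B (kopD bA l1 l2') (kopD bA') //; exact: BGamma_l2.
Qed.

Let alphaK : (fun n => cconj (alpha' n)) = alpha.
Proof. by apply/funext => n; rewrite /alpha' cconjK. Qed.

Let B_self_adjoint eta xi : l2 eta -> l2 xi -> rdot (B eta) xi = rdot eta (B xi).
Proof.
move=> le lx; have lk := BGamma_l2 bA le; have lk' := BGamma_l2 bA lx.
by rewrite /B (rdot_adjoint bA' lk lx) alphaK (rdot_adjoint bA le lk').
Qed.

(** [B] is self-adjoint, so [||B^(m+1) eta||^2] is the inner product of [B^m eta] and
    [B^(m+2) eta]. *)
Let iterB_log_convex eta m : l2 eta ->
  nsq (iter m.+1 B eta) ^+ 2 <= nsq (iter m B eta) * nsq (iter m.+2 B eta).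
Proof.
move=> le; have l0 := @iterB_l2 m _ le; have l1 := @iterB_l2 m.+1 _ le.
have lS := @iterB_l2 m.+2 _ le.
rewrite -[in leLHS]rdot_nsq [iter m.+1 B eta in X in rdot X _]iterS.
rewrite B_self_adjoint //; exact: rdot_cauchy_schwarz.
Qed.

Let iterB_rad m o' g : l2 (rad o' g) ->
  iter m B (rad o' g) = rad o' (iter m (fun g => profile_op k alpha' (profile_op k alpha g)) g).
Proof.
move=> lg; elim: m => //= m IH; have lm := @iterB_l2 m _ lg.
rewrite IH in lm *; have lk := BGamma_l2 bA lm.
by rewrite /B kop_rad // kop_rad // -kop_rad.
Qed.

Variable q : R.
Hypothesis q0 : 0 <= q.
Hypothesis kop_radial_le : forall xi, radial o xi -> l2 xi -> nsq (kop alpha xi) <= q * nsq xi.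

(** Complex conjugation preserves radial vectors and norms, so through [kop_conj] the bound [q] for
    the operator also holds for its adjoint. *)
Let B_radial xi : radial o xi -> l2 xi ->
  radial o (B xi) /\ nsq (B xi) <= q ^+ 2 * nsq xi.
Proof.
move=> rx lx; have lk := BGamma_l2 bA lx; have rk := kop_radial k1 bA rx lx.
have lc := l2_conj lk; have rc : radial o (fun x => cconj (kop alpha xi x)).
  by move=> x y xy; rewrite (rk x y xy).
have -> : B xi = fun x => cconj (kop alpha (fun x => cconj (kop alpha xi x)) x).
  by rewrite /B /alpha' kop_conj.
split; first by move=> x y xy; rewrite (kop_radial k1 bA rc lc xy).
rewrite nsq_conj (le_trans (kop_radial_le rc lc)) // nsq_conj expr2 -mulrA.
by rewrite ler_wpM2l // kop_radial_le.
Qed.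

Let iterB_radial m xi : radial o xi -> l2 xi ->
  radial o (iter m B xi) /\ nsq (iter m B xi) <= (q ^+ 2) ^+ m * nsq xi.
Proof.
move=> rx lx; elim: m => [|m [rm IH]]; first by rewrite expr0 mul1r.
have lm := @iterB_l2 m _ lx; have [rS nS] := B_radial rm lm.
split=> //; rewrite iterS (le_trans nS) // [_ ^+ m.+1]exprS -mulrA ler_wpM2l //.
exact: exprn_ge0.
Qed.

(* The orbit of [single y c] under [B] is radial about [y] with a profile that does not depend on [y], hence its growth can be read off at [o]. *)
Let iterB_single m y (c : R[i]) :
  nsq (iter m B (single y c)) <= (q ^+ 2) ^+ m * nsq (single o c).
Proof.
have lo := @l2_single R k o c; have ly := @l2_single R k y c.
have -> : nsq (iter m B (single y c)) = nsq (iter m B (single o c)).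
  have lmo := @iterB_l2 m _ lo; move: lo ly lmo; rewrite !single_rad => lo ly lmo.
  rewrite iterB_rad // iterB_rad // in lmo *.
  by have [] := @nsq_rad_base R k o y _ k1 lmo.
have ro : radial o (single o c) by rewrite single_rad; exact: radial_rad_fun.
by have [] := iterB_radial m ro lo.
Qed.

(** The constant grows with the support, since [nsqD_le] costs a factor two at each point, but
    [log_convex_bound] uses only the exponential rate. *)
Let iterB_finite (s : seq V) (c : V -> R[i]) :
  l2 (fun x => \sum_(y <- s) single y (c y) x) /\
  exists C, forall m, nsq (iter m B (fun x => \sum_(y <- s) single y (c y) x)) <= C * (q ^+ 2) ^+ m.
Proof.
elim: s => [|y s [ls [C IH]]].
  have -> : (fun x => \sum_(y <- [::]) single y (c y) x) = single o 0.
    by apply/funext => x; rewrite big_nil /single; case: ifP.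
  split; first exact: l2_single.
  by exists (nsq (single o (0 : R[i]))) => m; rewrite mulrC; exact: iterB_single.
have -> : (fun x => \sum_(z <- y :: s) single z (c z) x) =
    (fun x => single y (c y) x + \sum_(z <- s) single z (c z) x).
  by apply/funext => x; rewrite big_cons.
have ly := @l2_single R k y (c y); split; first exact: l2D.
exists (2 * (nsq (single o (c y)) + C)) => m.
rewrite (iterBD m ly ls) (le_trans (nsqD_le (@iterB_l2 m _ ly) (@iterB_l2 m _ ls))) //.
rewrite -mulrA ler_wpM2l // mulrDl lerD //.
by rewrite mulrC; exact: iterB_single.
Qed.

Let trunc_single N eta :
  trunc N eta = fun x => \sum_(y <- ball_seq k N) single y (eta y) x.
Proof.
apply/funext => x; rewrite /trunc -mem_ball_seq; case: ifP => [xN|/negbT xN].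
  rewrite (bigD1_seq x) ?ball_seq_uniq //= {1}/single eqxx big1 ?addr0 // => y yx.
  by rewrite /single eq_sym (negPf yx).
rewrite big1_seq // => y /andP[_ yN]; rewrite /single; case: eqP => // xy.
by rewrite xy yN in xN.
Qed.

(** Writing [A] for the operator, [||A eta||^2 = <eta, B eta> <= ||eta|| ||B eta||], and
    [||B eta|| <= q ||eta||] by log-convexity. *)
Let kop_trunc_le N eta : nsq (kop alpha (trunc N eta)) <= q * nsq (trunc N eta).
Proof.
have lt := @l2_trunc R k N eta; have lk := BGamma_l2 bA lt.
have [_ [C HC]] := iterB_finite (ball_seq k N) eta; rewrite -trunc_single in HC.
have H1 : nsq (B (trunc N eta)) <= q ^+ 2 * nsq (trunc N eta).
  have b0 m : 0 <= nsq (iter m B (trunc N eta)) by apply: nsq_ge0; exact: iterB_l2.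
  have bc m := iterB_log_convex m lt.
  exact: (@log_convex_bound R (fun m => nsq (iter m B (trunc N eta))) C _ b0 bc (sqr_ge0 q) HC).
have n0 := nsq_ge0 lt; have nk := nsq_ge0 lk.
rewrite -(@ler_pXn2r _ 2) ?nnegrE ?mulr_ge0 //.
rewrite -[in leLHS]rdot_nsq (rdot_adjoint bA lt lk) -/(B _).
apply: le_trans (rdot_cauchy_schwarz lt (B_l2 lt)) _.
by rewrite exprMn mulrC [nsq (trunc N eta) ^+ 2]expr2 mulrA ler_wpM2r.
Qed.

(** Testing the images of the truncations against the image of [eta] gives the limit [||A eta||^2];
    Cauchy-Schwarz then bounds its square, and one factor [||A eta||^2] cancels. *)
Lemma kop_le_of_radial eta : l2 eta -> nsq (kop alpha eta) <= q * nsq eta.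
Proof.
move=> le; have lk := BGamma_l2 bA le; have n0 := nsq_ge0 le; have nk := nsq_ge0 lk.
have H : nsq (kop alpha eta) ^+ 2 <= q * nsq eta * nsq (kop alpha eta).
  have c1 := cvg_rdot_kop_trunc bA le lk; rewrite rdot_nsq in c1.
  have c2 : (fun N => rdot (kop alpha (trunc N eta)) (kop alpha eta) ^+ 2) @ \oo -->
      nsq (kop alpha eta) ^+ 2.
    by rewrite expr2; under eq_fun do rewrite expr2; exact: cvgM.
  rewrite -(cvg_lim _ c2) //; apply: limr_le; first by apply/cvg_ex; exists (nsq (kop alpha eta) ^+ 2).
  apply: nearW => N; have lt := @l2_trunc R k N eta.
  apply: le_trans (rdot_cauchy_schwarz (BGamma_l2 bA lt) lk) _.
  rewrite ler_wpM2r // (le_trans (kop_trunc_le N eta)) // ler_wpM2l //.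
  exact: nsq_trunc.
move: nk; rewrite le_eqVlt => /predU1P[<-|nk]; first by rewrite mulr_ge0.
by rewrite expr2 ler_pM2r in H.
Qed.

End operator_norm.

Lemma l2_zero (R : realType) (k : nat) : l2 (fun _ : vertex k => 0 : R[i]).
Proof. by apply: (@l2_supp R k _ 0). Qed.

Lemma nsq_zero (R : realType) (k : nat) : nsq (fun _ : vertex k => 0 : R[i]) = 0.
Proof.
rewrite /nsq (@Vsum_supp _ _ _ 0) => [|x _]; last exact: sqn0.
by rewrite /ball_seq big_nil.
Qed.

(** Restriction to radial vectors can only lower the norm; the converse is [kop_le_of_radial]. Both
    sets are nonempty and bounded, so each [sup] is a true supremum. *)
Lemma opnorm_jo (R : realType) (k : nat) (o : vertex k) (alpha : nat -> R[i]) :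
  (1 <= k)%N -> BGamma k alpha ->
  opnorm (radial o) (jo o alpha) = opnorm (@setT (vertex k -> R[i])) (kop alpha).
Proof.
move=> k1 bA; have [M M0 HM] := BGamma_bound bA.
rewrite /opnorm; set S1 := (X in sup X = _); set S2 := (X in _ = sup X).
have l0 := @l2_zero R k.
have n01 : l2norm (fun _ : vertex k => 0 : R[i]) <= 1 by rewrite l2normE nsq_zero sqrtr0.
have r0 : radial o (fun _ : vertex k => 0 : R[i]) by [].
have S12 : S1 `<=` S2.
  by move=> _ [eta [re [le ne]] <-]; exists eta => //; rewrite jo_radial.
have S1_ne : S1 !=set0 by exists (l2norm (jo o alpha (fun=> 0))); exists (fun=> 0).
have S2_ne : S2 !=set0 by case: S1_ne => y /S12; exists y.
have S2_ub : ubound S2 (Num.sqrt M).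
  move=> _ [eta [_ [le ne]] <-]; rewrite l2normE ler_wsqrtr // (le_trans (HM _ le)) //.
  rewrite -[leRHS]mulr1 ler_wpM2l //; move: ne; rewrite l2normE => ne.
  rewrite -(sqr_sqrtr (nsq_ge0 le)) -[leRHS](expr1n _ 2) lerXn2r // nnegrE ?sqrtr_ge0 //.
have S1_ub : ubound S1 (Num.sqrt M) by move=> y /S12; exact: S2_ub.
have hs1 : has_sup S1 by split=> //; exists (Num.sqrt M).
have hs2 : has_sup S2 by split=> //; exists (Num.sqrt M).
apply/eqP; rewrite eq_le; apply/andP; split.
  by apply: ge_sup => // y /S12; exact: sup_upper_bound.
(* [N ^ 2] will serve as [q]; the bound on the unit ball extends to all radial vectors by
   homogeneity. *)
pose N := sup S1.
have N0 : 0 <= N.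
  have h : S1 (l2norm (jo o alpha (fun=> 0))) by exists (fun=> 0).
  by apply: le_trans (sup_upper_bound hs1 h); rewrite l2normE sqrtr_ge0.
have radN xi : radial o xi -> l2 xi -> nsq (kop alpha xi) <= N ^+ 2 * nsq xi.
  move=> rx lx; have nx := nsq_ge0 lx; have lk := BGamma_l2 bA lx.
  move: nx; rewrite le_eqVlt => /predU1P[n0|nx].
    by have := HM _ lx; rewrite -n0 !mulr0.
  pose c : R := (Num.sqrt (nsq xi))^-1.
  have c2 : c ^+ 2 = (nsq xi)^-1 by rewrite /c exprVn sqr_sqrtr // ltW.
  have sc : sqn (rC c) = (nsq xi)^-1 by rewrite /sqn /= expr0n addr0.
  have lc := l2Z (c := rC c) lx.
  have rc : radial o (fun x => rC c * xi x) by move=> x y xy; rewrite (rx x y xy).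
  have h : S1 (l2norm (jo o alpha (fun x => rC c * xi x))).
    exists (fun x => rC c * xi x) => //; split=> //; split=> //.
    by rewrite l2normE nsqZ // sc mulVf ?sqrtr1 // gt_eqF.
  have := sup_upper_bound hs1 h; rewrite jo_radial // kopZ // l2normE nsqZ // sc => h'.
  rewrite -ler_pdivrMr // mulrC -/N.
  rewrite -[leLHS]sqr_sqrtr; first by rewrite lerXn2r // nnegrE ?sqrtr_ge0.
  by rewrite mulr_ge0 ?invr_ge0 ?nsq_ge0.
apply: ge_sup => // _ [eta [_ [le ne]] <-].
have := kop_le_of_radial k1 bA (sqr_ge0 N) radN le => H.
rewrite l2normE -/N -(ger0_norm N0) -sqrtr_sqr ler_wsqrtr // (le_trans H) //.
rewrite -[leRHS]mulr1 ler_wpM2l ?sqr_ge0 //; move: ne; rewrite l2normE => ne.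
by rewrite -(sqr_sqrtr (nsq_ge0 le)) -[leRHS](expr1n _ 2) lerXn2r // nnegrE ?sqrtr_ge0.
Qed.

(** * The unitary operator *)

Section intertwiner.
Variables (R : realType) (k : nat) (o : vertex k).
Hypothesis k1 : (1 <= k)%N.
Local Notation V := (vertex k).
Local Notation Re := (@complex.Re R).
Local Notation Im := (@complex.Im R).
Local Notation mu := (@lebesgue_measure R).
Local Notation P := (@CDpoly R k).
Local Notation w := (@CDw R k).
Local Notation D := (@supp R k).
Local Notation h := (sphn R k).
Implicit Types (eta xi : V -> R[i]) (e : nat -> R).

Let w_ge0 (t : R) : D t -> 0 <= w t.
Proof. by rewrite /supp /= in_itv /=; exact: CDw_ge0. Qed.

(* A function with Cartier-Dunau coefficients [e n]; the zero function when there is none in [L^2]. *)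
Definition CDseries e : R -> R :=
  xget (fun=> 0) [set g | Pi_L2 k g /\ forall n, Pi_dot k g (P n) = e n].

Lemma CDseries_spec e g : Pi_L2 k g -> (forall n, Pi_dot k g (P n) = e n) ->
  Pi_L2 k (CDseries e) /\ forall n, Pi_dot k (CDseries e) (P n) = e n.
Proof.
move=> g2 gn; rewrite /CDseries.
have : (exists f, [set g | Pi_L2 k g /\ forall n, Pi_dot k g (P n) = e n] f) by exists g.
by move/xgetPex => /(_ (fun=> 0)).
Qed.

Lemma CDseries_ae e g : Pi_L2 k g -> (forall n, Pi_dot k g (P n) = e n) ->
  Pi_ae k (fun t => CDseries e t = g t).
Proof.
move=> g2 gn; have [c2 cn] := CDseries_spec g2 gn.
by apply: Pi_L2_ext => // n; rewrite gn cn.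
Qed.

Definition square_summable e : Prop := cvgn (series (fun n => h n * e n ^+ 2)).

Lemma CDseriesP e : square_summable e ->
  [/\ Pi_L2 k (CDseries e), forall n, Pi_dot k (CDseries e) (P n) = e n &
   Pi_dot k (CDseries e) (CDseries e) = limn (series (fun n => h n * e n ^+ 2))].
Proof.
move=> ce; have [g [g2 gn _]] := Riesz_Fischer k1 ce.
have [c2 cn] := CDseries_spec g2 gn; split=> //.
have := Pi_Parseval k1 c2 => /cvg_lim <- //.
by under eq_fun do rewrite cn.
Qed.

Let pt n : V := sval (sph_point R k1 o n).
Let dist_pt n : dist (pt n) o = n. Proof. exact: (svalP (sph_point R k1 o n)). Qed.

Definition radial_profile eta n : R[i] := eta (pt n).

(** [U_o] must send the indicator of [S_n(o)] to [#S_n * P_n], whose [n]-th coefficient is one.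
    Hence the Cartier-Dunau coefficients of [U_o eta] are the profile of [eta] itself. *)
Definition Uo eta (t : R) : R[i] :=
  Complex (CDseries (fun n => Re (radial_profile eta n)) t)
          (CDseries (fun n => Im (radial_profile eta n)) t).

Lemma radial_profile_rad g : radial_profile (rad o g) = g.
Proof. by apply/funext => n; rewrite /radial_profile /rad dist_pt. Qed.

Lemma rad_radial_profile eta : radial o eta -> eta = rad o (radial_profile eta).
Proof. by move=> re; apply/funext => x; rewrite /rad /radial_profile; apply: re; rewrite dist_pt. Qed.

Let square_summable_le (u v : nat -> R) : (forall n, 0 <= u n <= v n) ->
  cvgn (series (fun n => h n * v n)) -> cvgn (series (fun n => h n * u n)).
Proof.
move=> uv cv; have h0 n : 0 <= h n by rewrite ltW // sphn_gt0.
apply: (series_le_cvg _ _ _ cv) => n.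
- by case/andP: (uv n) => u0 _; rewrite mulr_ge0.
- by case/andP: (uv n) => u0 /(le_trans u0) v0; rewrite mulr_ge0.
- by case/andP: (uv n) => _ uvn; rewrite ler_wpM2l.
Qed.

Lemma square_summable_profile eta : radial o eta -> l2 eta ->
  square_summable (fun n => Re (radial_profile eta n)) /\
  square_summable (fun n => Im (radial_profile eta n)).
Proof.
move=> re le; rewrite (rad_radial_profile re) in le.
have /(l2_radP o _ k1) cg := le.
split; apply: square_summable_le cg => n; rewrite sqr_ge0 /= /sqn.
  by rewrite lerDl sqr_ge0.
by rewrite lerDr sqr_ge0.
Qed.

(** [CDseries] chooses representatives, so the two sides are compared through their coefficients and
    agree almost everywhere. *)
Lemma Uo_linear eta xi (c : R[i]) : radial o eta -> l2 eta -> radial o xi -> l2 xi ->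
  Pi_ae k (fun t => Uo (fun x => eta x + c * xi x) t = Uo eta t + c * Uo xi t).
Proof.
move=> re le rx lx.
have [/CDseriesP[a2 an _] /CDseriesP[b2 bn _]] := square_summable_profile re le.
have [/CDseriesP[c2 cn _] /CDseriesP[d2 dn _]] := square_summable_profile rx lx.
have P2 := Pi_L2_CDpoly R k1.
pose F1 t := CDseries (fun n => Re (radial_profile eta n)) t +
  (Re c * CDseries (fun n => Re (radial_profile xi n)) t -
   Im c * CDseries (fun n => Im (radial_profile xi n)) t).
pose F2 t := CDseries (fun n => Im (radial_profile eta n)) t +
  (Re c * CDseries (fun n => Im (radial_profile xi n)) t +
   Im c * CDseries (fun n => Re (radial_profile xi n)) t).
have h1 : Pi_ae k (fun t => CDseries (fun n => Re (radial_profile (fun x => eta x + c * xi x) n)) t = F1 t).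
  have l1 := Pi_L2Z (Re c) c2; have l2' := Pi_L2Z (Im c) d2.
  have lB := Pi_L2B k1 l1 l2'.
  apply: CDseries_ae; first exact: Pi_L2D.
  move=> n; rewrite Pi_dotDl // Pi_dotBl // !Pi_dotZl // an cn dn.
  by rewrite /radial_profile Re_add Re_mul.
have h2 : Pi_ae k (fun t => CDseries (fun n => Im (radial_profile (fun x => eta x + c * xi x) n)) t = F2 t).
  have l1 := Pi_L2Z (Re c) d2; have l2' := Pi_L2Z (Im c) c2.
  have lB := Pi_L2D k1 l1 l2'.
  apply: CDseries_ae; first exact: Pi_L2D.
  move=> n; rewrite Pi_dotDl // Pi_dotDl // !Pi_dotZl // bn cn dn.
  by rewrite /radial_profile Im_add Im_mul.
apply: Pi_ae_imp (Pi_ae_and h1 h2) => t [e1 e2].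
by rewrite /Uo e1 e2 /F1 /F2; case: c {h1 h2 F1 F2 e1 e2} => x y; apply: complex_ext => /=; ring.
Qed.

Lemma L2PiP (f : R -> R[i]) : L2Pi k f <->
  Pi_L2 k (fun t => Re (f t)) /\ Pi_L2 k (fun t => Im (f t)).
Proof.
split=> [[[m1 m2] fi]|[[m1 i1] [m2 i2]]].
  have si : Pi_integrable k (fun t => sqn (f t)).
    apply/integrableP; split.
      apply/measurable_EFinP; apply: measurable_funM; last exact: CDw_measurable.
      by apply: measurable_funD; exact: measurable_funX.
    rewrite [ltLHS](_ : _ = \int[mu]_(t in D) (sqn (f t) * w t)%:E)%E //.
    apply: eq_integral => t; rewrite inE => Dt.
    by rewrite /= ger0_norm // mulr_ge0 ?sqn_ge0 ?w_ge0.
  split; split=> //; apply: (Pi_integrable_le k1 _ si); try exact: measurable_funX.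
    by move=> t _; rewrite ger0_norm ?sqr_ge0 // /sqn lerDl sqr_ge0.
  by move=> t _; rewrite ger0_norm ?sqr_ge0 // /sqn lerDr sqr_ge0.
split=> //; have si := Pi_integrableD i1 i2.
by rewrite Pi_integrable_integral // ltry.
Qed.

Lemma L2Pi_Uo eta : radial o eta -> l2 eta -> L2Pi k (Uo eta).
Proof.
move=> re le; have [/CDseriesP[a2 _ _] /CDseriesP[b2 _ _]] := square_summable_profile re le.
by apply/L2PiP.
Qed.

Let series_sqn (g : nat -> R[i]) : series (fun n => h n * sqn (g n)) =
  series (fun n => h n * Re (g n) ^+ 2) + series (fun n => h n * Im (g n) ^+ 2).
Proof.
apply/funext => N; rewrite -[RHS]/(series _ N + series _ N) !seriesEnat /= -big_split.
by apply: eq_bigr => n _ /=; rewrite -mulrDr.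
Qed.

Lemma L2Pinorm_Uo eta : radial o eta -> l2 eta -> L2Pinorm k (Uo eta) = l2norm eta.
Proof.
move=> re le; have [s1 s2] := square_summable_profile re le.
have [a2 _ an] := CDseriesP s1; have [b2 _ bn] := CDseriesP s2.
rewrite l2normE /L2Pinorm; congr Num.sqrt.
have -> : PiInt k (fun t => sqn (Uo eta t)) =
   Pi_dot k (CDseries (fun n => Re (radial_profile eta n))) (CDseries (fun n => Re (radial_profile eta n))) +
   Pi_dot k (CDseries (fun n => Im (radial_profile eta n))) (CDseries (fun n => Im (radial_profile eta n))).
  rewrite /Pi_dot -PiIntD; [|exact: Pi_L2M..].
  by congr PiInt; apply/funext => t; rewrite /sqn !expr2.
have le' := le; rewrite (rad_radial_profile re) in le'.
rewrite an bn [in RHS](rad_radial_profile re) -(cvg_lim _ (cvg_nsq_rad k1 le')) //.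
by rewrite series_sqn limD.
Qed.

Lemma square_summable_l2 (g : nat -> R[i]) :
  square_summable (fun n => Re (g n)) -> square_summable (fun n => Im (g n)) ->
  l2 (rad o g).
Proof.
move=> s1 s2; apply/(l2_radP o g k1).
by rewrite series_sqn; exact: is_cvgD.
Qed.

Lemma Uo_surjective (f : R -> R[i]) : L2Pi k f ->
  exists2 eta, radial o eta /\ l2 eta & Pi_ae k (fun t => Uo eta t = f t).
Proof.
move=> /L2PiP[f1 f2].
pose g n := Complex (Pi_dot k (fun t => Re (f t)) (P n)) (Pi_dot k (fun t => Im (f t)) (P n)).
have lg : l2 (rad o g) by apply: square_summable_l2; exact: Pi_Bessel.
exists (rad o g); first by split=> //; exact: radial_rad_fun.
have h1 : Pi_ae k (fun t => CDseries (fun n => Re (g n)) t = Re (f t)) by exact: CDseries_ae.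
have h2 : Pi_ae k (fun t => CDseries (fun n => Im (g n)) t = Im (f t)) by exact: CDseries_ae.
apply: Pi_ae_imp (Pi_ae_and h1 h2) => t [e1 e2].
by rewrite /Uo radial_profile_rad e1 e2; case: (f t).
Qed.

Lemma Uo_sphvec n : Pi_ae k (fun t => Uo (sphvec R o n) t = CDnormalized k n t).
Proof.
have P2 := Pi_L2_CDpoly R k1; have h0 := sphn_gt0 R k1.
(* [c] is [sqrt (h n)], and the [n]-th coefficient of [c * P n] is [c / h n = 1 / sqrt (h n)], the
   value of [sphvec] on the sphere. *)
pose c : R := (Num.sqrt (PiInt k (fun s => P n s ^+ 2)))^-1.
have cE : c = Num.sqrt (h n).
  rewrite /c (_ : PiInt k _ = Pi_dot k (P n) (P n)) /Pi_dot ?PiInt_orth ?eqxx ?mul1r //.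
  by rewrite sqrtrV ?invrK // ltW.
have h1 : Pi_ae k (fun t => CDseries (fun m => Re (radial_profile (sphvec R o n) m)) t = c * P n t).
  apply: CDseries_ae; first exact: Pi_L2Z.
  move=> m; rewrite Pi_dotZl // /Pi_dot PiInt_orth // cE /radial_profile /sphvec dist_pt eq_sym.
  case: eqP => _; last by rewrite mul0r mulr0.
  have := h0 n; rewrite sphcardE // mul1r -sqrtr_gt0 => s0.
  by rewrite /= -{2}(sqr_sqrtr (ltW (h0 n))) expr2 invfM mulrA divff ?mul1r // gt_eqF.
have h2 : Pi_ae k (fun t => CDseries (fun m => Im (radial_profile (sphvec R o n) m)) t = 0).
  apply: CDseries_ae; first exact: Pi_L2_0.
  move=> m; rewrite /radial_profile /sphvec; case: eqP => _ /=;
    by rewrite -[RHS](@PiInt0 R k); congr PiInt; apply/funext => t; rewrite mul0r.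
apply: Pi_ae_imp (Pi_ae_and h1 h2) => t [e1 e2].
by rewrite /Uo e1 e2 /CDnormalized /rC mulrC.
Qed.

(** Elements of [LinfPi] are bounded only almost everywhere, while [Pi_L2_mul_bounded] asks for a
    bound at every point of the support. *)
Lemma clip_bounded (f : R -> R) (C : R) : 0 <= C -> measurable_fun D f ->
  Pi_ae k (fun t => `|f t| <= C) ->
  exists g : R -> R, [/\ measurable_fun D g, forall t, `|g t| <= C & Pi_ae k (fun t => f t = g t)].
Proof.
move=> C0 mf fC; exists (fun t => Num.max (- C) (Num.min C (f t))); split.
- apply: measurable_maxr; first exact: measurable_cst.
  by apply: measurable_minr => //; exact: measurable_cst.
- move=> t; rewrite ler_norml le_max lexx /= ge_max ge_min lexx /= andbT.
  by rewrite ge0_cp.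
apply: Pi_ae_imp fC => t; rewrite ler_norml => /andP[h1 h2].
by rewrite (min_idPr h2) (max_idPr h1).
Qed.

(** The product formula under the integral: up to [h n], the sphere sums of the kernel are the
    matrix entries of multiplication by [phi] between [P m] and [P n]. *)
Lemma sphQ_CDcoef (phi : R -> R) (C : R) n m : measurable_fun D phi ->
  (forall t, `|phi t| <= C) ->
  sphQ k n (fun l => PiInt k (fun t => P l t * phi t)) m =
  h n * Pi_dot k (fun t => phi t * P m t) (P n).
Proof.
move=> mphi phiC.
have iP l : Pi_integrable k (fun t => P l t * phi t).
  by apply: (integrable_CDpolyM k1 _ (M := C)) => // t _; exact: phiC.
have phi2 : Pi_L2 k (fun t => phi t * P m t).
  by apply: (Pi_L2_mul_bounded k1 (M := C)) => //; exact: Pi_L2_CDpoly.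
rewrite -[in LHS](dist_pt m) -sum_sph_dist.
rewrite -PiInt_sum // /Pi_dot -PiIntZ; last by apply: Pi_L2M => //; exact: Pi_L2_CDpoly.
congr PiInt; apply/funext => t.
by rewrite -mulr_suml sum_sph_CDpoly // dist_pt; ring.
Qed.

Lemma Re_sphQ (al : nat -> R[i]) n m : Re (sphQ k n al m) = sphQ k n (fun l => Re (al l)) m.
Proof. by rewrite -(dist_pt m) -!sum_sph_dist Re_sum. Qed.

Lemma Im_sphQ (al : nat -> R[i]) n m : Im (sphQ k n al m) = sphQ k n (fun l => Im (al l)) m.
Proof. by rewrite -(dist_pt m) -!sum_sph_dist Im_sum. Qed.

(** By [sphQ_CDcoef] the profile of the image at [m] is the sum over [n] of [h n] times the [n]-th
    coefficients of [U_o eta] and of [phi * P m]. Parseval makes it the integral of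
    [phi * U_o eta * P m], the [m]-th coefficient of the right-hand side. *)
Lemma Uo_intertwines (phi : R -> R[i]) eta : LinfPi k phi -> radial o eta -> l2 eta ->
  Pi_ae k (fun t => Uo (jo o (CDhat k phi) eta) t = phi t * Uo eta t).
Proof.
move=> [[m1 m2] [M HM]] re le.
(* [x ^+ 2 <= M] implies that the absolute value of [x] is at most [C], without a square root and
   for either sign of [M]. *)
pose C : R := 1 + `|M|.
have C0 : 0 <= C by rewrite addr_ge0.
have small (x : R) : x ^+ 2 <= M -> `|x| <= C.
  move=> xM; have : `|x| ^+ 2 <= `|M| by rewrite real_normK ?num_real // (le_trans xM) // ler_norm.
  by have := normr_ge0 x; rewrite /C; move: `|x| `|M| => u v; nra.
have [phi1 [mp1 p1C p1E]] : exists g : R -> R, [/\ measurable_fun D g, forall t, `|g t| <= C &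
    Pi_ae k (fun t => Re (phi t) = g t)].
  apply: clip_bounded => //; apply: Pi_ae_imp HM => t; rewrite /sqn => H.
  by apply: small; apply: le_trans H; rewrite lerDl sqr_ge0.
have [phi2 [mp2 p2C p2E]] : exists g : R -> R, [/\ measurable_fun D g, forall t, `|g t| <= C &
    Pi_ae k (fun t => Im (phi t) = g t)].
  apply: clip_bounded => //; apply: Pi_ae_imp HM => t; rewrite /sqn => H.
  by apply: small; apply: le_trans H; rewrite lerDr sqr_ge0.
pose al n := Complex (PiInt k (fun t => P n t * phi1 t)) (PiInt k (fun t => P n t * phi2 t)).
have alE : CDhat k phi = al.
  apply/funext => n; rewrite /CDhat /al; congr Complex.
    apply: PiInt_ae_eq => //.
    - by apply: measurable_funM => //; exact: measurable_CDpoly.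
    - by apply: measurable_funM => //; exact: measurable_CDpoly.
    - by apply: Pi_ae_imp p1E => t ->.
  apply: PiInt_ae_eq => //.
  - by apply: measurable_funM => //; exact: measurable_CDpoly.
  - by apply: measurable_funM => //; exact: measurable_CDpoly.
  - by apply: Pi_ae_imp p2E => t ->.
rewrite alE; have P2 := Pi_L2_CDpoly R k1.
have phi12 : Pi_L2 k phi1 by apply: (Pi_L2_bounded k1 (M := C)).
have phi22 : Pi_L2 k phi2 by apply: (Pi_L2_bounded k1 (M := C)).
have ss p : Pi_L2 k p -> square_summable (fun n => PiInt k (fun t => P n t * p t)).
  move=> p2; rewrite (_ : (fun n => _) = fun n => Pi_dot k p (P n)); first exact: Pi_Bessel.
  by apply/funext => n; congr PiInt; apply/funext => t; rewrite mulrC.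
(* The kernel coefficients are those of a bounded function, so Bessel's inequality puts each row in
   l^2. *)
have lal (x : V) : l2 (rad x al).
  apply/(l2_radP x al k1)/(l2_radP o al k1).
  by apply: square_summable_l2; exact: ss.
set g := radial_profile eta.
have etaE := rad_radial_profile re.
have lg : l2 (rad o g) by rewrite -etaE.
have joE : jo o al eta = rad o (profile_op k al g).
  rewrite /jo (radproj_id k1 re) etaE kop_rad_summable.
    by rewrite radproj_id //; exact: radial_rad_fun.
  move=> x; apply: CVsummableM => //.
  by have := lal x; congr l2; apply/funext => y; rewrite /rad distC.
have [/CDseriesP[a2 an _] /CDseriesP[b2 bn _]] := square_summable_profile re le.
rewrite -/g in a2 an b2 bn.
set F1 := CDseries (fun n => Re (g n)) in a2 an *.
set F2 := CDseries (fun n => Im (g n)) in b2 bn *.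
have bd (f p : R -> R) : Pi_L2 k f -> measurable_fun D p -> (forall t, `|p t| <= C) ->
    Pi_L2 k (fun t => p t * f t).
  by move=> f2 mp pC; apply: (Pi_L2_mul_bounded k1 (M := C)).
(* One real case for the four products of a part of [phi] with a part of [U_o eta]; the factor [p]
   is moved across the inner product. *)
have ps (f p : R -> R) (c : nat -> R) m : Pi_L2 k f -> measurable_fun D p -> (forall t, `|p t| <= C) ->
    (forall n, Pi_dot k f (P n) = c n) ->
    series (fun n => c n * sphQ k n (fun l => PiInt k (fun t => P l t * p t)) m) @ \oo -->
      Pi_dot k (fun t => p t * f t) (P m).
  move=> f2 mp pC fc; have pP := bd _ _ (P2 m) mp pC.
  have := Pi_Parseval2 k1 f2 pP.
  have -> : Pi_dot k f (fun t => p t * P m t) = Pi_dot k (fun t => p t * f t) (P m).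
    by congr PiInt; apply/funext => t; ring.
  rewrite (_ : (fun n => h n * _ * _) = fun n => c n * sphQ k n (fun l => PiInt k (fun t => P l t * p t)) m) //.
  by apply/funext => n; rewrite fc (sphQ_CDcoef _ _ mp pC); ring.
pose H1 t := phi1 t * F1 t - phi2 t * F2 t.
pose H2 t := phi2 t * F1 t + phi1 t * F2 t.
have l11 := bd _ _ a2 mp1 p1C; have l22 := bd _ _ b2 mp2 p2C.
have l12 := bd _ _ a2 mp2 p2C; have l21 := bd _ _ b2 mp1 p1C.
have h1 : Pi_ae k (fun t => CDseries (fun m => Re (profile_op k al g m)) t = H1 t).
  apply: CDseries_ae; first exact: Pi_L2B.
  move=> m; rewrite Pi_dotBl // /profile_op /csum /=; apply/esym/cvg_lim => //.
  rewrite (_ : series _ = fun N =>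
    series (fun n => Re (g n) * sphQ k n (fun l => PiInt k (fun t => P l t * phi1 t)) m) N -
    series (fun n => Im (g n) * sphQ k n (fun l => PiInt k (fun t => P l t * phi2 t)) m) N).
    by apply: cvgB; exact: ps.
  apply/funext => N; rewrite !seriesEnat /= -sumrB; apply: eq_bigr => n _.
  by rewrite Re_mul Re_sphQ Im_sphQ.
have h2 : Pi_ae k (fun t => CDseries (fun m => Im (profile_op k al g m)) t = H2 t).
  apply: CDseries_ae; first exact: Pi_L2D.
  move=> m; rewrite Pi_dotDl // /profile_op /csum /=; apply/esym/cvg_lim => //.
  rewrite (_ : series _ = fun N =>
    series (fun n => Re (g n) * sphQ k n (fun l => PiInt k (fun t => P l t * phi2 t)) m) N +
    series (fun n => Im (g n) * sphQ k n (fun l => PiInt k (fun t => P l t * phi1 t)) m) N).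
    by apply: cvgD; exact: ps.
  apply/funext => N; rewrite !seriesEnat /= -big_split; apply: eq_bigr => n _.
  by rewrite Im_mul Re_sphQ Im_sphQ.
apply: Pi_ae_imp (Pi_ae_and (Pi_ae_and h1 h2) (Pi_ae_and p1E p2E)) => t [[e1 e2] [e3 e4]].
rewrite joE /Uo radial_profile_rad e1 e2 -/g -/F1 -/F2 /H1 /H2 -e3 -e4.
by case: (phi t) => x y; apply: complex_ext => /=; ring.
Qed.

End intertwiner.

Theorem theorem1p4 (R : realType) (k : nat) (o : vertex k) :
  (1 <= k)%N ->
  (* j_o is an isometric *-embedding B_Gamma -> B(l^2_rad(o)) *)
  ((forall (alpha beta : nat -> R[i]) (c : R[i]),
      BGamma k alpha -> BGamma k beta ->
      forall eta, radial o eta -> l2 eta ->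
        jo o (fun n => alpha n + c * beta n) eta
          = (fun x => jo o alpha eta x + c * jo o beta eta x)) /\
   (forall alpha beta : nat -> R[i], BGamma k alpha -> BGamma k beta ->
      forall eta, radial o eta -> l2 eta ->
        radproj o (kop alpha (kop beta (radproj o eta)))
          = jo o alpha (jo o beta eta)) /\
   (forall alpha : nat -> R[i], BGamma k alpha ->
      forall eta xi, radial o eta -> l2 eta -> radial o xi -> l2 xi ->
        l2dot (jo o alpha eta) xi
          = l2dot eta (jo o (fun n => cconj (alpha n)) xi)) /\
   (forall alpha : nat -> R[i], BGamma k alpha ->
      opnorm (radial o) (jo o alpha) = opnorm (@setT (vertex k -> R[i])) (kop alpha))) /\
  (* the unitary U_o and the intertwining relation *)
  (exists U : (vertex k -> R[i]) -> (R -> R[i]),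
     (forall eta xi c, radial o eta -> l2 eta -> radial o xi -> l2 xi ->
        Pi_ae k (fun t => U (fun x => eta x + c * xi x) t = U eta t + c * U xi t)) /\
     (forall eta, radial o eta -> l2 eta ->
        L2Pi k (U eta) /\ L2Pinorm k (U eta) = l2norm eta) /\
     (forall f, L2Pi k f ->
        exists2 eta, radial o eta /\ l2 eta & Pi_ae k (fun t => U eta t = f t)) /\
     (forall n : nat, Pi_ae k (fun t => U (sphvec R o n) t = CDnormalized k n t)) /\
     (forall phi : R -> R[i], LinfPi k phi ->
        forall eta, radial o eta -> l2 eta ->
          Pi_ae k (fun t => U (jo o (CDhat k phi) eta) t = phi t * U eta t))).
Proof.
move=> k1; split.
  split=> [alpha beta c bA bB eta re le|].
    rewrite /jo (radproj_id k1 re) kop_addl //.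
    have rA := kop_radial k1 bA re le; have rB := kop_radial k1 bB re le.
    rewrite (radproj_id k1 rA) (radproj_id k1 rB) radproj_id // => x y xy.
    by rewrite (rA x y xy) (rB x y xy).
  split=> [alpha beta bA bB eta re le|].
    have rB := kop_radial k1 bB re le.
    by rewrite /jo (radproj_id k1 re) (radproj_id k1 rB) (radproj_id k1 rB).
  split=> [alpha bA eta xi re le rx lx|alpha bA]; last exact: opnorm_jo.
  by rewrite jo_radial // jo_radial //; [exact: l2dot_adjoint | exact: BGamma_conj].
exists (Uo (R := R) o k1); split=> [eta xi c|]; first exact: Uo_linear.
split=> [eta re le|]; first by split; [exact: L2Pi_Uo | exact: L2Pinorm_Uo].
split; first exact: Uo_surjective.
by split; [exact: Uo_sphvec | move=> phi Hphi eta; exact: Uo_intertwines].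
Qed.
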